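(* Let $K$ be a field of characteristic $p>0$ and let $M$ be a nonzero finitely presented $\mathcal D(P_n)$-module. Then $M\simeq \mathcal D(P_n)\otimes_{T_k}M'$ for some $k\ge0$ and some finitely generated $T_k$-module $M'$. Let $\{M_i':=\mathcal T_{k,i}M_0'\}$ be a standard filtration on the $T_k$-module $M'$ (with $M_0'$ a finite dimensional generating subspace of $M'$), so that $\dim_K(M_i')=\frac{e(M')}{d!}i^d+\cdots$ for $i\gg0$, where $d=\mathrm{GK}(M')$. Let $\{M_i:=F_iM_0'\}$ be the corresponding filtration on the $\mathcal D(P_n)$-module $M$ (where $M_0'$ is identified with $1\otimes M_0'$). Then: 1. $\dim_K(M_i)=\frac{e(M')}{p^{kn}(n+d)!}i^{n+d}+\cdots$ is an almost polynomial of period $p^k$ with coefficients from $\frac{1}{p^{k(n+d)}(n+d)!}\mathbb Z$, and $e(M)=\frac{e(M')}{p^{kn}}\in\frac1{p^{kn}}\mathbb N$. 2. The dimension $\mathrm{Dim}(M)=n+d\ge n$ is equal to $t-1$, where $t$ is the order of the pole of the Poincaré series $P_M(\omega)=\sum_{i\ge0}\dim_K(M_i)\omega^i$ at the point $\omega=1$, and the multiplicity is $e(M)=(1-\omega)^{\mathrm{Dim}(M)+1}P_M(\omega)|_{\omega=1}$. The dimension $\mathrm{Dim}(M)$ of a nonzero finitely presented $\mathcal D(P_n)$-module $M$ can be any natural number from the interval $[n,2n]$.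
   Context: $P_n=K[x_1,\dots,x_n]$, $n\ge1$; $\mathcal D(P_n)$ is the ring of $K$-linear differential operators on $P_n$. For $k\ge0$ let $\partial_i^{[k]}=\frac{\partial_i^k}{k!}$ be the operator $x^\alpha\mapsto\binom{\alpha_i}{k}x^{\alpha-ke_i}$ (zero if $k>\alpha_i$), and $\partial^{[\beta]}=\prod_i\partial_i^{[\beta_i]}$. Then $\mathcal D(P_n)=\bigoplus_{\alpha,\beta\in\mathbb N^n}Kx^\alpha\partial^{[\beta]}$. Canonical filtration: $F_i=\bigoplus_{|\alpha|+|\beta|\le i}Kx^\alpha\partial^{[\beta]}$. Modules are left modules. $T_k:=\bigoplus_{\beta\in\{0,\dots,p^k-1\}^n}\partial^{[\beta]}P_n$, a (Noetherian, finitely generated) subalgebra of $\mathcal D(P_n)$; it carries the filtration $\mathcal T_{k,i}:=T_k\cap F_i$. For a finitely generated $T_k$-module $M'$ and finite dimensional generating subspace $M_0'$, $\dim_K(\mathcal T_{k,i}M_0')$ is, for $i\gg0$, a polynomial in $i$ of degree $d=\mathrm{GK}(M')$ (Gelfand–Kirillov dimension) with leading coefficient $e(M')/d!$; $e(M')\in\mathbb N$ is independent of $M'_0$ and is called the multiplicity of $M'$. A function $f:\mathbb N\to\mathbb N$ is a quasi-polynomial of period $m$ if there are polynomials $p_s\in\mathbb Q[t]$, $s\in\mathbb Z/m\mathbb Z$, with $f(i)=p_{i\bmod m}(i)$ for $i\gg0$; it has coefficients from $S\subseteq\mathbb Q$ if all $p_s$ have coefficients in $S$; it is an almost polynomial if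 all $p_s$ have the same degree and the same leading coefficient. For $f:\mathbb N\to\mathbb N$, $\gamma(f):=\inf\{r\ge0: f(i)\le i^r\text{ for }i\gg0\}$; for a finitely generated module $M=\mathcal D(P_n)M_0$ with $\dim_KM_0<\infty$, $\mathrm{Dim}(M):=\gamma(i\mapsto\dim_K F_iM_0)$ (independent of $M_0$). The multiplicity $e(M)$ is defined by $\dim_K(F_iM_0)=\frac{e(M)}{D!}i^{D}+o(i^{D})$, $D=\mathrm{Dim}(M)$ (independent of $M_0$). The three dots denote terms of smaller order. *)

(* Defs.v *)
From HB Require Import structures.
From mathcomp Require Import all_boot all_order all_algebra.
(* mpoly has to be imported before MathComp-Analysis: the converse order
   produces incompatible notation levels *)
From mathcomp Require Import ssrcomplements mpoly.
From mathcomp Require Import boolp classical_sets reals ereal topology.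
From mathcomp Require Import normedtype landau exp.
From mathcomp Require Import ring.

Set Implicit Arguments.
Unset Strict Implicit.
Unset Printing Implicit Defensive.

Import Order.TTheory GRing.Theory Num.Theory.
Import numFieldNormedType.Exports.

Local Open Scope ring_scope.
Local Open Scope classical_set_scope.

Section DiffOp.
Variables (K : fieldType) (n : nat).
Local Notation P := {mpoly K[n]}.

Definition comm_mul (g : P) (u : P -> P) : P -> P :=
  fun f => g * u f - u (g * f).

(* u is a differential operator of order < j, in Grothendieck's sense *)
Fixpoint diff_order_lt (j : nat) (u : P -> P) : Prop :=
  match j with
  | 0 => forall f, u f = 0
  | j'.+1 => forall g, diff_order_lt j' (comm_mul g u)
  end.

Definition is_diffop (u : P -> P) : Prop :=
  linear u /\ exists j, diff_order_lt j u.

Record diffop := DiffOp { diffop_fun :> P -> P; diffop_subproof : is_diffop diffop_fun }.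

HB.instance Definition _ := gen_eqMixin diffop.
HB.instance Definition _ := gen_choiceMixin diffop.

Lemma diffop_eq (u v : diffop) : diffop_fun u =1 diffop_fun v -> u = v.
Proof.
case: u v => [u Pu] [v Pv] /= uv.
have e : u = v by apply/funext.
by case: _ / e in Pv uv *; congr DiffOp; exact: Prop_irrelevance.
Qed.

Lemma diffop_linear (u : diffop) : linear u.
Proof. by have [] := diffop_subproof u. Qed.
HB.instance Definition _ (u : diffop) :=
  GRing.isLinear.Build K P P *:%R u (diffop_linear u).

Lemma lin0 (u : P -> P) : linear u -> u 0 = 0.
Proof.
by move=> lu; have := lu (-1) 0 0; rewrite scaler0 addr0 scaleN1r addNr.
Qed.

Lemma dol_ext j u v : u =1 v -> diff_order_lt j u -> diff_order_lt j v.
Proof. by move=> /funext ->. Qed.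

Lemma dolS j u : linear u -> diff_order_lt j u -> diff_order_lt j.+1 u.
Proof.
elim: j u => [|j IH] u lu /= du g.
  by move=> f; rewrite /comm_mul !du mulr0 subrr.
apply: IH; last exact: du.
move=> c f h; rewrite /comm_mul lu mulrDr mulrDr -!scalerAr lu.
by rewrite opprD scalerBr addrACA.
Qed.

Lemma comm_mul_linear g u : linear u -> linear (comm_mul g u).
Proof.
move=> lu c f h; rewrite /comm_mul lu mulrDr mulrDr -!scalerAr lu.
by rewrite opprD scalerBr addrACA.
Qed.

Lemma dolW j k u : linear u -> (j <= k)%N ->
  diff_order_lt j u -> diff_order_lt k u.
Proof.
move=> lu /subnK <-; elim: (k - j)%N => //= i IH /IH; exact: dolS.
Qed.

Lemma dol0 j : diff_order_lt j (fun=> 0).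
Proof.
elim: j => //= j IH g; apply: dol_ext IH => f.
by rewrite /comm_mul mulr0 subrr.
Qed.

Lemma dolD j u v : diff_order_lt j u -> diff_order_lt j v ->
  diff_order_lt j (fun f => u f + v f).
Proof.
elim: j u v => [|j IH] u v /= du dv; first by move=> f; rewrite du dv addr0.
move=> g; apply: dol_ext (IH _ _ (du g) (dv g)) => f.
by rewrite /comm_mul mulrDr opprD addrACA.
Qed.

Lemma dolZ j c u : diff_order_lt j u -> diff_order_lt j (fun f => c *: u f).
Proof.
elim: j u => [|j IH] u /= du; first by move=> f; rewrite du scaler0.
move=> g; apply: dol_ext (IH _ (du g)) => f.
by rewrite /comm_mul -scalerAr scalerBr.
Qed.

Lemma dolM j h u : diff_order_lt j u -> diff_order_lt j (fun f => h * u f).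
Proof.
elim: j u => [|j IH] u /= du; first by move=> f; rewrite du mulr0.
move=> g; apply: dol_ext (IH _ (du g)) => f.
by rewrite /comm_mul mulrBr mulrCA.
Qed.

Lemma dolMr j h u : diff_order_lt j u -> diff_order_lt j (fun f => u (h * f)).
Proof.
elim: j u => [|j IH] u /= du; first by move=> f; rewrite du.
move=> g; apply: dol_ext (IH _ (du g)) => f.
by rewrite /comm_mul mulrCA.
Qed.

Lemma dol_comp a b (u v : P -> P) : linear u -> linear v ->
  diff_order_lt a u -> diff_order_lt b v -> diff_order_lt (a + b) (u \o v).
Proof.
elim: a b u v => [|a IHa] b u v lu lv du dv.
  by apply: dol_ext (dol0 b) => f /=; rewrite du.
elim: b u v lu lv du dv => [|b IHb] u v lu lv du dv.
  apply: dol_ext (dol0 _) => f /=; rewrite dv.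
  by rewrite lin0.
rewrite addnS /= => g.
have h1 := IHb _ _ lu (comm_mul_linear g lv) du (dv g).
have h2 := IHa b.+1 _ _ (comm_mul_linear g lu) lv (du g) dv.
rewrite addnS -addSn in h2.
apply: dol_ext (dolD h1 h2) => f; rewrite /comm_mul /=.
have lB x y : u (x - y) = u x - u y.
  by rewrite -scaleN1r [x + _]addrC lu scaleN1r addrC.
by rewrite lB addrC addrA subrK.
Qed.

Fact diffop0_subproof : is_diffop (fun=> 0).
Proof. by split; [move=> c f g; rewrite scaler0 addr0|exists 0%N]. Qed.
Definition diffop0 := DiffOp diffop0_subproof.

Fact diffopD_subproof (u v : diffop) : is_diffop (fun f => u f + v f).
Proof.
case: u v => [u [lu [a du]]] [v [lv [b dv]]] /=; split.
  by move=> c f g; rewrite lu lv scalerDr addrACA.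
exists (maxn a b); apply: dolD.
  by apply: (dolW lu _ du); rewrite leq_maxl.
by apply: (dolW lv _ dv); rewrite leq_maxr.
Qed.
Definition diffopD u v := DiffOp (diffopD_subproof u v).

Fact diffopZ_subproof c (u : diffop) : is_diffop (fun f => c *: u f).
Proof.
case: u => [u [lu [a du]]] /=; split; last by exists a; exact: dolZ.
by move=> b f g; rewrite lu scalerDr !scalerA mulrC.
Qed.
Definition diffopZ c u := DiffOp (diffopZ_subproof c u).

Fact diffopM_subproof (u v : diffop) : is_diffop (u \o v).
Proof.
case: u v => [u [lu [a du]]] [v [lv [b dv]]] /=; split.
  by move=> c f g /=; rewrite lv lu.
by exists (a + b)%N; exact: dol_comp.
Qed.
Definition diffopM u v := DiffOp (diffopM_subproof u v).

Fact mulop_subproof (g : P) : is_diffop (fun f => g * f).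
Proof.
split; first by move=> c f h; rewrite mulrDr scalerAr.
by exists 1%N => /= h f; rewrite /comm_mul mulrCA subrr.
Qed.
(* multiplication by g; this is the embedding of P_n into D(P_n) *)
Definition mulop g := DiffOp (mulop_subproof g).

Fact diffop_addrA : associative diffopD.
Proof. by move=> u v w; apply: diffop_eq => f /=; rewrite addrA. Qed.
Fact diffop_addrC : commutative diffopD.
Proof. by move=> u v; apply: diffop_eq => f /=; rewrite addrC. Qed.
Fact diffop_add0r : left_id diffop0 diffopD.
Proof. by move=> u; apply: diffop_eq => f /=; rewrite add0r. Qed.
Fact diffop_addNr : left_inverse diffop0 (diffopZ (-1)) diffopD.
Proof. by move=> u; apply: diffop_eq => f /=; rewrite scaleN1r addNr. Qed.

HB.instance Definition _ := GRing.isZmodule.Build diffop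
  diffop_addrA diffop_addrC diffop_add0r diffop_addNr.

Fact diffop_mulrA : associative diffopM.
Proof. by move=> u v w; apply: diffop_eq. Qed.
Fact diffop_mul1r : left_id (mulop 1) diffopM.
Proof. by move=> u; apply: diffop_eq => f /=; rewrite mul1r. Qed.
Fact diffop_mulr1 : right_id (mulop 1) diffopM.
Proof. by move=> u; apply: diffop_eq => f /=; rewrite mul1r. Qed.
Fact diffop_mulrDl : left_distributive diffopM +%R.
Proof. by move=> u v w; apply: diffop_eq. Qed.
Fact diffop_mulrDr : right_distributive diffopM +%R.
Proof. by move=> u v w; apply: diffop_eq => f /=; rewrite linearD. Qed.
Fact diffop_oner_neq0 : mulop 1 != 0 :> diffop.
Proof.
apply/eqP => /(congr1 (fun u : diffop => u 1)) /=.
by rewrite mul1r => /eqP; rewrite oner_eq0.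
Qed.

HB.instance Definition _ := GRing.Zmodule_isNzRing.Build diffop
  diffop_mulrA diffop_mul1r diffop_mulr1 diffop_mulrDl diffop_mulrDr
  diffop_oner_neq0.

Fact diffop_scalerA a b u : diffopZ a (diffopZ b u) = diffopZ (a * b) u.
Proof. by apply: diffop_eq => f /=; rewrite scalerA. Qed.
Fact diffop_scale1r : left_id 1 diffopZ.
Proof. by move=> u; apply: diffop_eq => f /=; rewrite scale1r. Qed.
Fact diffop_scalerDr : right_distributive diffopZ +%R.
Proof. by move=> c u v; apply: diffop_eq => f /=; rewrite scalerDr. Qed.
Fact diffop_scalerDl u : {morph diffopZ^~ u : a b / a + b}.
Proof. by move=> a b; apply: diffop_eq => f /=; rewrite scalerDl. Qed.

HB.instance Definition _ := GRing.Zmodule_isLmodule.Build K diffop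
  diffop_scalerA diffop_scale1r diffop_scalerDr diffop_scalerDl.

Fact diffop_scalerAl c (u v : diffop) : c *: (u * v) = (c *: u) * v.
Proof. exact: diffop_eq. Qed.
HB.instance Definition _ :=
  GRing.Lmodule_isLalgebra.Build K diffop diffop_scalerAl.

Fact diffop_scalerAr c (u v : diffop) : c *: (u * v) = u * (c *: v).
Proof. by apply: diffop_eq => f; rewrite [RHS]linearZ. Qed.
HB.instance Definition _ :=
  GRing.Lalgebra_isAlgebra.Build K diffop diffop_scalerAr.

Definition divd_fun (i : 'I_n) (k : nat) (f : P) : P :=
  \sum_(m <- msupp f) (f@_m *+ 'C(m i, k)) *: 'X_[m - U_(i) *+ k].

Lemma divd_funwE i k d f : (msize f <= d)%N ->
  divd_fun i k f =
  \sum_(m : 'X_{1..n < d}) (f@_m *+ 'C(m i, k)) *: 'X_[m - U_(i) *+ k].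
Proof.
move=> le_fd; pose I : subFinType _ := 'X_{1..n < d}.
rewrite /divd_fun (big_mksub I) /=; first last.
  by move=> x /msize_mdeg_lt /leq_trans; apply.
  by rewrite msupp_uniq.
rewrite big_rmcond //= => m /memN_msupp_eq0 ->.
by rewrite mul0rn scale0r.
Qed.

Lemma divd_fun_linear i k : linear (divd_fun i k).
Proof.
move=> c f g; set d := maxn (msize (c *: f + g)) (maxn (msize f) (msize g)).
rewrite !(@divd_funwE i k d); first last.
- by rewrite /d leq_max leqnn.
- by rewrite /d !leq_max leqnn !orbT.
- by rewrite /d !leq_max leqnn !orbT.
rewrite scaler_sumr -big_split /=; apply: eq_bigr => m _.
by rewrite mcoeffD mcoeffZ scalerA -scalerDl mulrnDl mulrnAr.
Qed.

Lemma divd_funX i k m :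
  divd_fun i k 'X_[m] = 'C(m i, k)%:R *: 'X_[m - U_(i) *+ k].
Proof. by rewrite /divd_fun msuppX big_seq1 mcoeffX eqxx. Qed.

Lemma linear_funX_ext (u v : P -> P) : linear u -> linear v ->
  (forall m, u 'X_[m] = v 'X_[m]) -> u =1 v.
Proof.
move=> lu lv uv; elim/mpolyind => [|c m p _ _ IH]; last by rewrite lu lv uv IH.
by rewrite !lin0.
Qed.

Lemma divd_fun_mulX i k j f :
  divd_fun i k ('X_j * f) =
  'X_j * divd_fun i k f + (if (i == j) && (0 < k)%N then divd_fun i k.-1 f else 0).
Proof.
move: f; apply: linear_funX_ext => [c f g|c f g|m].
- by rewrite mulrDr -scalerAr divd_fun_linear.
- rewrite divd_fun_linear mulrDr -scalerAr.
  case: ifP => _; last by rewrite !addr0.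
  by rewrite divd_fun_linear scalerDr addrACA.
rewrite -mpolyXD !divd_funX mnmDE mnm1E -scalerAr -mpolyXD.
case: (eqVneq j i) => [->|nji]; last first.
  rewrite /= addr0 add0n; congr (_ *: 'X_[_]).
  apply/mnmP => l; rewrite !(mnmDE, mnmBE, mulmnE, mnm1E).
  case: (eqVneq i l) => [<-|]; first by rewrite (negPf nji).
  by rewrite mul0n !subn0.
rewrite /= add1n; case: k => [|k] /=.
  by rewrite !bin0 addr0; congr (_ *: 'X_[_]); rewrite !mulm0n !subm0.
rewrite binS natrD scalerDl; congr (_ + _).
- have [lmk|lkm] := leqP (m i) k; first by rewrite bin_small // !scale0r.
  congr (_ *: 'X_[_]); apply/mnmP => l.
  rewrite !(mnmDE, mnmBE, mulmnE, mnm1E).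
  case: (eqVneq i l) => [<-|]; rewrite ?mul0n ?subn0 // !mul1n.
  by rewrite addnBA.
- congr (_ *: 'X_[_]); apply/mnmP => l.
  rewrite !(mnmDE, mnmBE, mulmnE, mnm1E).
  by case: (eqVneq i l) => [<-|]; rewrite ?mul0n ?subn0 // !mul1n subnDl.
Qed.

Lemma divd_fun_order i k : diff_order_lt k.+1 (divd_fun i k).
Proof.
elim: k => [|k IH] g.
  have h : divd_fun i 0 =1 id.
    apply: linear_funX_ext => // [c f h|m]; first by rewrite divd_fun_linear.
    by rewrite divd_funX bin0 scale1r mulm0n subm0.
  by move=> f; rewrite /comm_mul !h subrr.
suff: diff_order_lt k.+1 (comm_mul g (divd_fun i k.+1)) by [].
have hD c g1 g2 : diff_order_lt k.+1 (comm_mul g1 (divd_fun i k.+1)) ->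
    diff_order_lt k.+1 (comm_mul g2 (divd_fun i k.+1)) ->
    diff_order_lt k.+1 (comm_mul (c *: g1 + g2) (divd_fun i k.+1)).
  move=> h1 h2; apply: dol_ext (dolD (dolZ c h1) h2) => f.
  rewrite /comm_mul mulrDl -scalerAl scalerBr [(_ + _) * f]mulrDl -scalerAl.
  by rewrite divd_fun_linear opprD addrACA.
have hM g1 g2 : diff_order_lt k.+1 (comm_mul g1 (divd_fun i k.+1)) ->
    diff_order_lt k.+1 (comm_mul g2 (divd_fun i k.+1)) ->
    diff_order_lt k.+1 (comm_mul (g1 * g2) (divd_fun i k.+1)).
  move=> h1 h2; apply: dol_ext (dolD (dolM g1 h2) (dolMr g2 h1)) => f.
  by rewrite /comm_mul mulrBr !mulrA addrA subrK.
have h1 : diff_order_lt k.+1 (comm_mul 1 (divd_fun i k.+1)).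
  by apply: dol_ext (dol0 _) => f; rewrite /comm_mul !mul1r subrr.
elim/mpolyind: g => [|c m g _ _ IHg].
  apply: dol_ext (dol0 _) => f; rewrite /comm_mul !mul0r.
  by rewrite (lin0 (@divd_fun_linear i k.+1)) subrr.
apply: hD => //; rewrite mpolyXE_id.
elim/big_ind: _ => // j _; elim: (m j) => [|e IHe]; first by rewrite expr0.
rewrite exprS; apply: hM => //.
apply: dol_ext (dolZ (if i == j then -1 else 0) IH) => f.
rewrite /comm_mul divd_fun_mulX opprD addrA subrr add0r andbT.
by case: ifP; rewrite ?scale0r ?oppr0 // scaleN1r.
Qed.

Fact divd_subproof i k : is_diffop (divd_fun i k).
Proof. by split; [exact: divd_fun_linear|exists k.+1; exact: divd_fun_order]. Qed.
(* the divided power operator \partial_i^[k] *)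
Definition divd i k := DiffOp (divd_subproof i k).

(* \partial^[b] *)
Definition divpow (b : 'I_n -> nat) : diffop := \prod_(i < n) divd i (b i).

End DiffOp.
Lemma bin_mul_bin m a b :
  ('C(m, b) * 'C(m - b, a) = 'C(a + b, a) * 'C(m, a + b))%N.
Proof.
have [lt_m|le_m] := ltnP m (a + b).
  rewrite (bin_small lt_m) muln0; have [lt_mb|le_bm] := ltnP m b.
    by rewrite bin_small.
  by rewrite [X in (_ * X)%N]bin_small ?muln0 // ltn_subLR // addnC.
have le_bm : (b <= m)%N by rewrite (leq_trans _ le_m) ?leq_addl.
have le_am : (a <= m - b)%N by rewrite leq_subRL // addnC.
apply/eqP; rewrite -(@eqn_pmul2r (a`! * b`! * (m - (a + b))`!)) ?muln_gt0 ?fact_gt0 //.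
have h1 := bin_fact le_bm; have h2 := bin_fact le_am.
have h3 := bin_fact le_m; have h4 := bin_fact (leq_addr b a).
rewrite addKn in h4; rewrite -subnDA [(b + a)%N]addnC in h2.
apply/eqP; transitivity m`!; first by rewrite -h1 -h2; ring.
by rewrite -h3 -h4; ring.
Qed.

Lemma dvdn_bin_carry p k a b : prime p ->
  (a < p ^ k)%N -> (b < p ^ k)%N -> (p ^ k <= a + b)%N -> (p %| 'C(a + b, a))%N.
Proof.
move=> pr_p lt_a lt_b le_ab; rewrite -(subnKC le_ab) -binomial.Vandermonde.
apply: dvdn_sum => -[j /= lt_j] _; rewrite ltnS in lt_j.
case: (posnP j) => [->|j_gt0].
  rewrite subn0 [X in (_ * X)%N]bin_small ?muln0 ?dvdn0 //.
  by rewrite ltn_subLR // addnC ltn_add2r.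
apply: dvdn_mulr; case: (boolP (p %| 'C(p ^ k, j))%N) => // ndv.
have : (p ^ k %| j)%N.
  have cop : coprime (p ^ k) 'C(p ^ k, j) by rewrite coprimeXl // prime_coprime.
  rewrite -(Gauss_dvdl _ cop); case: (j) j_gt0 => // i _.
  by rewrite -mul_bin_diag dvdn_mulr.
by move/(dvdn_leq j_gt0); rewrite leqNgt (leq_ltn_trans lt_j lt_a).
Qed.

Section DivPow.
Variables (K : fieldType) (n : nat).
Local Notation D := (diffop K n).
Local Notation P := {mpoly K[n]}.

Lemma diffopX_ext (u v : D) : (forall m, u 'X_[m] = v 'X_[m]) -> u = v.
Proof.
move=> uv; apply: diffop_eq; apply: linear_funX_ext => //; exact: diffop_linear.
Qed.

Lemma diffopME (u v : D) f : (u * v) f = u (v f). Proof. by []. Qed.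

Lemma diffopZE (u : D) c f : u (c *: f) = c *: u f. Proof. exact: linearZ. Qed.

Lemma divdX (i : 'I_n) k m : divd K i k 'X_[m] = 'C(m i, k)%:R *: 'X_[m - U_(i) *+ k].
Proof. exact: divd_funX. Qed.

Lemma divdM (i : 'I_n) a b : divd K i a * divd K i b = 'C(a + b, a)%:R *: divd K i (a + b).
Proof.
apply: diffopX_ext => m; rewrite diffopME divdX diffopZE divdX.
rewrite [RHS](_ : _ = 'C(a + b, a)%:R *: divd K i (a + b) 'X_[m]) // divdX.
rewrite !scalerA -!natrM mnmBE mulmnE mnm1E eqxx mul1n bin_mul_bin.
rewrite submDA; congr (_ *: 'X_[_ - _]); apply/mnmP => l.
by rewrite !(mnmDE, mulmnE) -mulnDr addnC.
Qed.

Lemma divd_comm (i j : 'I_n) a b : GRing.comm (divd K i a) (divd K j b).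
Proof.
rewrite /GRing.comm; case: (eqVneq i j) => [->|nij].
  by rewrite !divdM -bin_sub ?leq_addr // addKn addnC.
apply: diffopX_ext => m; rewrite !diffopME !divdX !diffopZE !divdX.
rewrite !scalerA !mnmBE !mulmnE !mnm1E (negPf nij) [j == i]eq_sym (negPf nij).
by rewrite !mul0n !subn0 mulrC !submDA addmC.
Qed.

Lemma divpowM (a b : 'I_n -> nat) : divpow K a * divpow K b =
  (\prod_i 'C(a i + b i, a i))%N%:R *: divpow K (fun i => a i + b i)%N.
Proof.
rewrite /divpow -prodrM_comm => [|i j _ _]; last exact: divd_comm.
rewrite natr_prod; elim/big_rec3: _ => [|i x y z _ ->]; first by rewrite scale1r.
by rewrite divdM -scalerAl -scalerAr scalerA.
Qed.

Lemma mulop1 : mulop (1 : P) = 1. Proof. by []. Qed.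
Lemma mulopM (f g : P) : mulop f * mulop g = mulop (f * g).
Proof. by apply: diffop_eq => h; rewrite /= mulrA. Qed.
Lemma mulopD (f g : P) : mulop (f + g) = mulop f + mulop g.
Proof. by apply: diffop_eq => h; rewrite /= mulrDl. Qed.
Lemma mulopZ c (f : P) : mulop (c *: f) = c *: mulop f.
Proof. by apply: diffop_eq => h; rewrite /= -scalerAl. Qed.

Lemma mulX_divd (i : 'I_n) k j : mulop 'X_j * divd K i k =
  divd K i k * mulop 'X_j - ((i == j) && (0 < k)%N)%:R *: divd K i k.-1.
Proof.
apply/eqP; rewrite eq_sym subr_eq; apply/eqP.
apply: diffop_eq => f; rewrite /= divd_fun_mulX.
by case: ifP => _; rewrite ?scale1r ?scale0r.
Qed.

Lemma mulX_divpow (b : 'I_n -> nat) j : mulop 'X_j * divpow K b =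
  divpow K b * mulop 'X_j - (0 < b j)%N%:R *: divpow K (fun i => b i - (i == j))%N.
Proof.
rewrite /divpow.
have: uniq (index_enum 'I_n) := index_enum_uniq _.
have: j \in index_enum 'I_n := mem_index_enum j.
set s := index_enum _; move: s => s js us.
suff: mulop 'X_j * \prod_(i <- s) divd K i (b i) =
   \prod_(i <- s) divd K i (b i) * mulop 'X_j -
   ((j \in s) && (0 < b j)%N)%:R *: \prod_(i <- s) divd K i (b i - (i == j)).
  by rewrite js.
elim: s us {js} => [|i s IH] /=.
  by rewrite !big_nil mulr1 mul1r scale0r subr0.
case/andP=> nis us; rewrite !big_cons mulrA mulX_divd mulrBl -!mulrA IH //.
rewrite mulrBr in_cons [j == i]eq_sym.
case: (eqVneq i j) => [eij|nij] /=; last first.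
  by rewrite scale0r mul0r subr0 subn0 -scalerAr.
rewrite -eij (negPf nis) /= scale0r mulr0 subr0; congr (_ - _).
rewrite -scalerAl subn1; congr (_ *: (_ * _)).
rewrite !big_seq; apply: eq_bigr => l ls.
by case: (eqVneq l i) => [eli|]; [rewrite -eli ls in nis|rewrite subn0].
Qed.

End DivPow.

Section Tk.
Variables (K : fieldType) (n : nat).

(* t belongs to the sum of the \partial^[b] P_n, b in {0,...,p^k-1}^n *)
Definition inT (p k : nat) (t : diffop K n) : Prop :=
  exists f : {ffun 'I_n -> 'I_(p ^ k)} -> {mpoly K[n]},
    t = \sum_(b : {ffun 'I_n -> 'I_(p ^ k)}) divpow K (fun i => b i) * mulop (f b).

Variables (p : nat) (hp : p \in [pchar K]) (k : nat).

Let q_gt0 : (0 < p ^ k)%N.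
Proof. by rewrite expn_gt0 prime_gt0 // (pcharf_prime hp). Qed.

Lemma inT0 : inT p k 0.
Proof.
exists (fun=> 0); rewrite big1 // => b _; apply: diffop_eq => f /=.
by rewrite mul0r linear0.
Qed.

Lemma inTD c t u : inT p k t -> inT p k u -> inT p k (c *: t + u).
Proof.
move=> [f ->] [g ->]; exists (fun b => c *: f b + g b).
rewrite scaler_sumr -big_split; apply: eq_bigr => b _ /=.
by rewrite mulopD mulopZ mulrDr -scalerAr.
Qed.

Lemma inTZ c t : inT p k t -> inT p k (c *: t).
Proof. by move=> /(inTD c) /(_ inT0); rewrite addr0. Qed.

Lemma inT_sum I (s : seq I) (F : I -> diffop K n) :
  (forall i, inT p k (F i)) -> inT p k (\sum_(i <- s) F i).
Proof.
move=> h; elim/big_ind: _ => //; first exact: inT0.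
by move=> x y hx hy; have := inTD 1 hx hy; rewrite scale1r.
Qed.

Lemma inT_mulr t g : inT p k t -> inT p k (t * mulop g).
Proof.
move=> [f ->]; exists (fun b => f b * g); rewrite mulr_suml.
by apply: eq_bigr => b _; rewrite -mulrA mulopM.
Qed.

Lemma inT_divpow (b : 'I_n -> nat) :
  (forall i, (b i < p ^ k)%N) -> inT p k (divpow K b).
Proof.
move=> hb; pose b0 := [ffun i => Ordinal (hb i)].
exists (fun c => (c == b0)%:R).
rewrite (bigD1 b0) //= big1 => [|c /negPf->]; last first.
  by apply: diffop_eq => f; rewrite /= mul0r linear0.
rewrite eqxx addr0 mulr1; apply: eq_bigr => i _.
by rewrite ffunE.
Qed.

Lemma inT_divpowM (b : 'I_n -> nat) t : (forall i, (b i < p ^ k)%N) ->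
  inT p k t -> inT p k (divpow K b * t).
Proof.
move=> hb [f ->]; rewrite mulr_sumr; apply: inT_sum => c.
rewrite mulrA; apply: inT_mulr; rewrite divpowM.
case: (boolP [forall i, b i + c i < p ^ k]%N) => [/forallP h|].
  by apply: inTZ; apply: inT_divpow.
rewrite negb_forall => /existsP[i]; rewrite -leqNgt => le_i.
rewrite (_ : _%:R = 0) ?scale0r; first exact: inT0.
apply/eqP; rewrite -(dvdn_pcharf hp) (bigD1 i) //= dvdn_mulr //.
by rewrite (dvdn_bin_carry _ (hb i) (ltn_ord (c i))) // (pcharf_prime hp).
Qed.

Lemma inT_mull g t : inT p k t -> inT p k (mulop g * t).
Proof.
have hX j u : inT p k u -> inT p k (mulop 'X_j * u).
  move=> [f ->]; rewrite mulr_sumr; apply: inT_sum => c.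
  rewrite mulrA; apply: inT_mulr; rewrite mulX_divpow addrC -scaleNr.
  apply: inTD.
    by apply: inT_divpow => i; apply: leq_ltn_trans (leq_subr _ _) (ltn_ord _).
  by apply: inT_mulr; apply: inT_divpow => i.
move=> ht; elim/mpolyind: g => [|c m g _ _ IH].
  by rewrite (_ : mulop 0 * t = 0); [exact: inT0|apply: diffop_eq => f; rewrite /= mul0r].
rewrite mulopD mulopZ mulrDl -scalerAl; apply: inTD => //.
rewrite mpolyXE_id; elim/big_rec: _ t ht {IH} => [|j h _ IH] t ht.
  by rewrite mulop1 mul1r.
rewrite -mulopM -mulrA; have {}IH := IH _ ht.
elim: (m j) => [|e IHe]; first by rewrite expr0 mulop1 mul1r.
by rewrite exprS -mulopM -mulrA; apply: hX.
Qed.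

Lemma inTM t u : inT p k t -> inT p k u -> inT p k (t * u).
Proof.
move=> [f ->] hu; rewrite mulr_suml; apply: inT_sum => b.
by rewrite -mulrA; apply: inT_divpowM => //; exact: inT_mull.
Qed.

Lemma inT1 : inT p k 1.
Proof.
rewrite (_ : 1 = divpow K (fun=> 0%N)); first exact: inT_divpow.
apply: diffopX_ext => m; rewrite /divpow.
have h i : divd K i 0 = 1.
  by apply: diffopX_ext => l; rewrite divdX bin0 scale1r mulm0n subm0 /= mul1r.
by rewrite big1 // => i _; rewrite h.
Qed.

End Tk.

(* hp is a parameter because T_k is closed under multiplication only when p is
   the characteristic of K *)
Definition Tk_pred (K : fieldType) (n p : nat) (hp : p \in [pchar K]) (k : nat)
  : pred (diffop K n) := fun t => `[< inT p k t >].

Record Tk (K : fieldType) (n p : nat) (hp : p \in [pchar K]) (k : nat) :=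
  MkTk { Tk_val : diffop K n; _ : Tk_pred hp k Tk_val }.
Arguments Tk {K} n {p} hp k.

Section TkStructure.
Variables (K : fieldType) (n p : nat) (hp : p \in [pchar K]) (k : nat).

Fact Tk_subalg : GRing.subsemialg_closed (@Tk_pred K n p hp k).
Proof.
split.
- exact/asboolP/inT1.
- split=> [|t u /asboolP ht /asboolP hu]; first exact/asboolP/inT0.
  by apply/asboolP; have := inTD 1 ht hu; rewrite scale1r.
- by move=> c t /asboolP ht; apply/asboolP; exact: inTZ.
- by move=> t u /asboolP ht /asboolP hu; apply/asboolP; exact: inTM.
Qed.

HB.instance Definition _ := [isSub for @Tk_val K n p hp k].
HB.instance Definition _ := [Choice of Tk n hp k by <:].
HB.instance Definition _ := GRing.SubChoice_isSubAlgebra.Build K (diffop K n)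
  (@Tk_pred K n p hp k) (Tk n hp k) Tk_subalg.

End TkStructure.

Section LinearAlgebra.
Variables (K : fieldType) (V : lmodType K).

Definition lspan (S : set V) : set V :=
  [set v | exists m (c : 'I_m -> K) (w : 'I_m -> V),
     (forall j, S (w j)) /\ v = \sum_j c j *: w j].

Definition has_dim (U : set V) (m : nat) : Prop :=
  exists b : 'I_m -> V,
    (forall c : 'I_m -> K, \sum_j c j *: b j = 0 -> forall j, c j = 0) /\
    (forall v, U v <-> exists c : 'I_m -> K, v = \sum_j c j *: b j).

Definition fin_dim (U : set V) : Prop := exists m, has_dim U m.

(* 0 by convention when U is not a finite dimensional subspace *)
Definition dimK (U : set V) : nat := xget 0%N (has_dim U).

End LinearAlgebra.

(* an A-module over a K-algebra A, seen as a K-vector space *)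
Definition restr (K : fieldType) (A : algType K) (M : lmodType A) : Type := M.

Section Restr.
Variables (K : fieldType) (A : algType K) (M : lmodType A).

HB.instance Definition _ := GRing.Zmodule.on (restr M).

Definition restr_scale (c : K) (m : restr M) : restr M := c%:A *: (m : M).

Fact restr_scalerA a b m : restr_scale a (restr_scale b m) = restr_scale (a * b) m.
Proof. by rewrite /restr_scale scalerA -scalerAl mul1r scalerA. Qed.
Fact restr_scale1r : left_id 1 restr_scale.
Proof. by move=> m; rewrite /restr_scale !scale1r. Qed.
Fact restr_scalerDr : right_distributive restr_scale +%R.
Proof. by move=> c m m'; rewrite /restr_scale scalerDr. Qed.
Fact restr_scalerDl m : {morph restr_scale^~ m : a b / a + b}.
Proof. by move=> a b; rewrite /restr_scale !scalerDl. Qed.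

HB.instance Definition _ := GRing.Zmodule_isLmodule.Build K (restr M)
  restr_scalerA restr_scale1r restr_scalerDr restr_scalerDl.

End Restr.

Section Modules.
Variables (K : fieldType) (A : algType K) (M : lmodType A).

Definition fin_dim_sub (U : set M) : Prop := fin_dim (U : set (restr M)).
Definition dim_sub (U : set M) : nat := dimK (U : set (restr M)).

(* the set S U of finite sums of products s u, s in S, u in U *)
Definition act_set (S : set A) (U : set M) : set M :=
  [set x | exists m (s : 'I_m -> A) (u : 'I_m -> M),
     (forall j, S (s j) /\ U (u j)) /\ x = \sum_j s j *: u j].

(* U is a finite dimensional generating subspace of M *)
Definition fd_generating (U : set M) : Prop :=
  fin_dim_sub U /\ act_set setT U = setT.

Definition fin_generated : Prop :=
  exists m (g : 'I_m -> M), forall x, exists a : 'I_m -> A, x = \sum_j a j *: g j.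

(* exactness of A^r --B--> A^m --phi--> M --> 0, free modules being made of
   row vectors *)
Definition fin_presented : Prop :=
  exists m r (B : 'M[A]_(r, m)) (phi : {linear 'rV[A]_m -> M}),
    (forall x, exists v, phi v = x) /\
    (forall v, phi v = 0 <-> exists u : 'rV[A]_r, v = u *m B).

End Modules.

Section Growth.
Variable R : realType.

Definition growth (f : nat -> nat) : \bar R :=
  ereal_inf [set r%:E | r in
    [set r : R | 0 <= r /\ \forall i \near \oo, (f i)%:R <= i%:R `^ r]].

Variables (K : fieldType) (A : algType K).

(* powers of a subspace W of A *)
Fixpoint pow_set (W : set A) (i : nat) : set A :=
  if i is i'.+1 then act_set W (pow_set W i' : set A^o)
  else [set c%:A | c in setT].

(* W ranges over the finite dimensional subspaces of A containing 1, U over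
   those of M *)
Definition GKdim (M : lmodType A) : \bar R :=
  ereal_sup [set x | exists (W : set A) (U : set M),
    [/\ fin_dim W, W 1, fin_dim_sub U &
        x = growth (fun i => dim_sub (act_set (pow_set W i) U))]].

End Growth.

(* tau : A x N -> M makes M the left A-module A (x)_B N, where A is a right
   B-module through iota *)
Section Tensor.
Variables (B A : nzRingType) (iota : B -> A) (N : lmodType B).

Definition balanced (Z : zmodType) (beta : A -> N -> Z) : Prop :=
  [/\ forall a a' x, beta (a + a') x = beta a x + beta a' x,
      forall a x x', beta a (x + x') = beta a x + beta a x'
    & forall a b x, beta (a * iota b) x = beta a (b *: x)].

Definition is_tensor (M : lmodType A) (tau : A -> N -> M) : Prop :=
  [/\ balanced tau,
      forall a a' x, tau (a * a') x = a *: tau a' x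
    & forall (Z : zmodType) (beta : A -> N -> Z), balanced beta ->
        exists g : {additive M -> Z},
          (forall a x, g (tau a x) = beta a x) /\
          (forall g' : {additive M -> Z},
             (forall a x, g' (tau a x) = beta a x) -> g' =1 g)].

End Tensor.

Section Filtrations.
Variables (K : fieldType) (n : nat).

Definition filtF (i : nat) : set (diffop K n) :=
  lspan [set t | exists a b : 'X_{1..n},
           (mdeg a + mdeg b <= i)%N /\ t = mulop 'X_[a] * divpow K b].

Definition filtT (p : nat) (hp : p \in [pchar K]) (k i : nat) :
  set (Tk n hp k) := [set t | filtF i (Tk_val t)].

(* dim_K F_i M_0 and dim_K T_{k,i} M_0' *)
Definition hilbF (M : lmodType (diffop K n)) (M0 : set M) (i : nat) : nat :=
  dim_sub (act_set (filtF i) M0).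

Definition hilbT (p : nat) (hp : p \in [pchar K]) (k : nat)
  (M' : lmodType (Tk n hp k)) (M0' : set M') (i : nat) : nat :=
  dim_sub (act_set (filtT i) M0').

End Filtrations.

Section Multiplicity.
Variables (R : realType) (K : fieldType) (n : nat).

(* Dim(M) = r *)
Definition has_Dim (M : lmodType (diffop K n)) (r : \bar R) : Prop :=
  (exists M0 : set M, fd_generating M0) /\
  forall M0 : set M, fd_generating M0 ->
    growth R (hilbF M0) = r.

(* e(M) = e *)
Definition has_mult (M : lmodType (diffop K n)) (e : R) : Prop :=
  exists D : nat, has_Dim M (D%:R)%:E /\
  forall M0 : set M, fd_generating M0 ->
    (fun i : nat => (hilbF M0 i)%:R - e / (D`!)%:R * i%:R ^+ D : R^o)
      =o_\oo (fun i : nat => i%:R ^+ D : R^o).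

Variables (p : nat) (hp : p \in [pchar K]) (k : nat).

(* d = GK(M') and e = e(M') *)
Definition has_GK_mult (M' : lmodType (Tk n hp k)) (d e : nat) : Prop :=
  GKdim R M' = (d%:R)%:E /\
  forall M0' : set M', fd_generating M0' ->
    exists h : {poly rat},
      [/\ \forall i \near \oo, (hilbT M0' i)%:R = h.[i%:R],
          size h = d.+1 & lead_coef h = e%:R / (d`!)%:R].

End Multiplicity.

Section QuasiPolynomials.
Variables (m : nat) (f : nat -> nat).

(* f is the quasi-polynomial of period m with components P 0, ..., P (m - 1) *)
Definition quasi_poly_of (P : nat -> {poly rat}) : Prop :=
  (0 < m)%N /\ \forall i \near \oo, (f i)%:R = (P (i %% m)%N).[i%:R].

Definition coefs_from (P : nat -> {poly rat}) (S : set rat) : Prop :=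
  forall s, (s < m)%N -> forall j, S (P s)`_j.

Definition almost_poly_of (P : nat -> {poly rat}) : Prop :=
  quasi_poly_of P /\
  forall s t, (s < m)%N -> (t < m)%N ->
    size (P s) = size (P t) /\ lead_coef (P s) = lead_coef (P t).

End QuasiPolynomials.

Section RationalFunctions.
Variable F : fieldType.
Local Notation "x %:F" := (@FracField.tofrac {poly F} x).

(* the power series expansion at 0 of the rational function f is
   \sum_i a_i w^i *)
Definition expands_as (f : {fraction {poly F}}) (a : nat -> F) : Prop :=
  exists N Q : {poly F}, [/\ Q.[0] != 0, f = N%:F / Q%:F
    & forall i, \sum_(j < i.+1) Q`_j * a (i - j)%N = N`_i].

Definition pole_order (f : {fraction {poly F}}) (x : F) (t : nat) : Prop :=
  (0 < t)%N /\ exists N Q : {poly F},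
    [/\ N.[x] != 0, Q.[x] != 0 & f = N%:F / (('X - x%:P) ^+ t * Q)%:F].

Definition has_value (f : {fraction {poly F}}) (x v : F) : Prop :=
  exists N Q : {poly F}, [/\ Q.[x] != 0, f = N%:F / Q%:F & v = N.[x] / Q.[x]].

End RationalFunctions.

(* Main.v *)
(* Put q = p^k.  The ring D is a free right T_k-module on the divided powers
   d^[q m], m in N^n, and this basis is compatible with the filtrations, so
   M = D (x) M' is the direct sum of the d^[q m] (x) M' and its Poincare series
   is that of M' divided by (1 - w^q)^n.  Freeness comes from the commutators
   with x_j^q, which centralise T_k and send d^[q m] to d^[q (m - e_j)].

   The series of M' is rational with a power of 1 - w as denominator: T_k is a
   finite module over the polynomial ring, and the monomials in the generators
   that are not combinations of smaller ones form down-closed subsets of N^n,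
   whose counting functions are handled with Dickson's lemma.  Writing the
   series of M' as A / (1 - w)^(d+1) with A(1) = e(M') > 0, everything is read
   off A / ((1 - w)^(d+1) (1 - w^q)^n).

   A finitely presented M is induced from the T_k-submodule generated by the
   images of the generators as soon as T_k contains the entries of the matrix
   of relations.  The dimension n + d is attained by D / (D x_(d+1) + ... +
   D x_n), which is induced from K[x_1, ..., x_d] over T_0. *)
Require Import Defs.
From HB Require Import structures.
From mathcomp Require Import all_boot all_order all_algebra.
From mathcomp Require Import mpoly.
From mathcomp Require Import boolp classical_sets reals ereal topology.
From mathcomp Require Import normedtype landau exp.
From mathcomp Require Import ring lra zify.

Set Implicit Arguments.
Unset Strict Implicit.
Unset Printing Implicit Defensive.

Import Order.TTheory GRing.Theory Num.Theory.
Import numFieldNormedType.Exports.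

Local Open Scope ring_scope.
Local Open Scope classical_set_scope.

(** A standard filtration depends on the generating subspace, but two of them interleave up to a
    shift of the index. Dimensions and multiplicities are therefore compared through leading terms
    with an error of order i^(N-1), a form that survives such shifts. The common leading coefficient
    comes from rewriting A / ((1 - w)^(d+1) (1 - w^q)^n) over (1 - w^q)^(n+d+1). The numerator
    becomes A (1 + w + ... + w^(q-1))^(d+1), and a multiple of 1 + w + ... + w^(q-1) has the same
    coefficient sum on every residue class mod q. That sum is q^d A(1); the binomial coefficients
    contribute 1 / (q^(n+d) (n+d)!), which leaves e(M') / (q^n (n+d)!) and explains both
    denominators in the statement. The tensor product is known by its universal property alone: its
    direct sum decomposition needs maps out of it, built from coefficients in D, and its generation
    by pure tensors needs the uniqueness clause. *)

Section LinearAlgebraFacts.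

(** * Finite-dimensional linear algebra *)

Variables (K : fieldType) (V : lmodType K).
Implicit Types (U W : set V) (s : seq V).

Definition subspace U := U 0 /\ forall c x y, U x -> U y -> U (c *: x + y).

Lemma subspaceD U x y : subspace U -> U x -> U y -> U (x + y).
Proof. by move=> [_ h] ux uy; rewrite -[x]scale1r; exact: h. Qed.

Lemma subspaceZ U c x : subspace U -> U x -> U (c *: x).
Proof. by move=> [h0 h] ux; rewrite -[_ *: _]addr0; exact: h. Qed.

Lemma subspace_sum U (I : Type) (r : seq I) (P : pred I) (F : I -> V) :
  subspace U -> (forall i, P i -> U (F i)) -> U (\sum_(i <- r | P i) F i).
Proof.
move=> hU hF; elim/big_rec: _ => [|i x /hF ? ?]; first exact: (proj1 hU).
exact: subspaceD.
Qed.

Lemma subspace_sum_seq U (I : eqType) (r : seq I) (F : I -> V) :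
  subspace U -> (forall i, i \in r -> U (F i)) -> U (\sum_(i <- r) F i).
Proof.
move=> hU; elim: r => [|i r IH] hF; first by rewrite big_nil; exact: (proj1 hU).
rewrite big_cons; apply: subspaceD => //; first exact/hF/mem_head.
by apply: IH => j jr; apply: hF; rewrite inE jr orbT.
Qed.

Lemma lspan_subspace (S : set V) : subspace (lspan S).
Proof.
split; first by exists 0%N, (fun=> 0), (fun=> 0); split; [case|rewrite big_ord0].
move=> c _ _ [m1 [c1 [w1 [S1 ->]]]] [m2 [c2 [w2 [S2 ->]]]].
exists (m1 + m2)%N,
  (fun j => match split j with inl j => c * c1 j | inr j => c2 j end),
  (fun j => match split j with inl j => w1 j | inr j => w2 j end); split.
  by move=> j; case: (split j).
rewrite big_split_ord /= scaler_sumr; congr (_ + _); apply: eq_bigr => j _.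
  by rewrite (unsplitK (inl j : 'I_m1 + 'I_m2)) scalerA.
by rewrite (unsplitK (inr j : 'I_m1 + 'I_m2)).
Qed.

Lemma lspan_min (S : set V) U : subspace U -> S `<=` U -> lspan S `<=` U.
Proof.
move=> hU SU x [m [c [w [Sw ->]]]]; apply: subspace_sum => // j _.
by apply: subspaceZ => //; exact: SU.
Qed.

Lemma sub_lspan (S : set V) : S `<=` lspan S.
Proof.
move=> x Sx; exists 1%N, (fun=> 1), (fun=> x); split=> //.
by rewrite big_ord1 scale1r.
Qed.

(** Peeling off generators one at a time lets a basis be extracted from the right end of a list: the
    head is compared with the span of the tail only. On a list in decreasing order this is the test
    for standard monomials. *)
Fixpoint spanv s : set V :=
  if s is x :: s' then [set y | exists c z, spanv s' z /\ y = c *: x + z]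
  else [set 0].

Fixpoint freev s : Prop :=
  if s is x :: s' then ~ spanv s' x /\ freev s' else True.

Lemma spanv_subspace s : subspace (spanv s).
Proof.
elim: s => [|x s [h0 IH]] /=.
  by split=> // c x y -> ->; rewrite scaler0 addr0.
split; first by exists 0, 0; rewrite scale0r addr0.
move=> c _ _ [c1 [z1 [s1 ->]]] [c2 [z2 [s2 ->]]].
exists (c * c1 + c2), (c *: z1 + z2); split; first exact: IH.
by rewrite scalerDr scalerDl scalerA addrACA.
Qed.

Lemma spanv_mem s x : x \in s -> spanv s x.
Proof.
elim: s => //= y s IH; rewrite inE => /orP[/eqP->|/IH hx].
  by exists 1, 0; rewrite scale1r addr0; split=> //; exact: (proj1 (spanv_subspace s)).
by exists 0, x; rewrite scale0r add0r.
Qed.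

Lemma spanv_min s U : subspace U -> (forall x, x \in s -> U x) -> spanv s `<=` U.
Proof.
move=> hU; elim: s => [|x s IH] hs /= y; first by move=> ->; exact: (proj1 hU).
move=> [c [z [/IH hz ->]]]; apply: (proj2 hU); first exact/hs/mem_head.
by apply: hz => t ts; apply: hs; rewrite inE ts orbT.
Qed.

Lemma spanv_lspan s : spanv s = lspan [set x | x \in s].
Proof.
apply/seteqP; split; last first.
  by apply: lspan_min; [exact: spanv_subspace|move=> x; exact: spanv_mem].
by apply: spanv_min => [|x xs]; [exact: lspan_subspace|exact: sub_lspan].
Qed.

Lemma freev_dim s : freev s -> has_dim (spanv s) (size s).
Proof.
elim: s => [|x s IH] /=.
  move=> _; exists (fun=> 0); split=> [c _ []//|v]; split=> [->|[c ->]].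
    by exists (fun=> 0); rewrite big_ord0.
  by rewrite big_ord0.
move=> [nx fs]; have [b [fb sb]] := IH fs.
exists (fun j => oapp b x (unlift ord0 j)); split.
  move=> c; rewrite big_ord_recl unlift_none /= => e.
  have e' : c ord0 *: x + \sum_i c (lift ord0 i) *: b i = 0.
    by rewrite -[RHS]e; congr (_ + _); apply: eq_bigr => i _; rewrite liftK.
  have c0 : c ord0 = 0.
    apply: contrapT => /eqP c0; apply: nx.
    rewrite (_ : x = - (c ord0)^-1 *: \sum_i c (lift ord0 i) *: b i).
      by apply: subspaceZ; [exact: spanv_subspace|apply/sb; eexists; reflexivity].
    rewrite scaleNr; apply: (scalerI c0); rewrite scalerN scalerA mulfV // scale1r.
    by apply/eqP; rewrite -addr_eq0 e'.
  move: e'; rewrite c0 scale0r add0r => /fb h j.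
  by case: (unliftP ord0 j) => [i ->|->].
move=> v; split.
  move=> [c [z [/sb[d ->] ->]]].
  exists (fun j => oapp d c (unlift ord0 j)); rewrite big_ord_recl unlift_none /=.
  by congr (_ + _); apply: eq_bigr => i _; rewrite liftK.
move=> [c ->]; exists (c ord0), (\sum_i c (lift ord0 i) *: b i); split.
  by apply/sb; eexists; reflexivity.
rewrite big_ord_recl unlift_none /=.
by congr (_ + _); apply: eq_bigr => i _; rewrite liftK.
Qed.

Fixpoint greedy_basis s :=
  if s is x :: s' then
    if `[< spanv s' x >] then greedy_basis s' else x :: greedy_basis s'
  else [::].

Lemma spanv_greedy s : spanv (greedy_basis s) = spanv s.
Proof.
elim: s => //= x s IH; case: asboolP => [hx|_] /=; last by rewrite IH.
rewrite IH; apply/seteqP; split=> y; first by exists 0, y; rewrite scale0r add0r.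
by move=> [c [z [hz ->]]]; apply: (proj2 (spanv_subspace s)).
Qed.

Lemma freev_greedy s : freev (greedy_basis s).
Proof. by elim: s => //= x s IH; case: asboolP => //=; rewrite spanv_greedy. Qed.

Lemma greedy_dim s : has_dim (spanv s) (size (greedy_basis s)).
Proof. by rewrite -spanv_greedy; apply: freev_dim; exact: freev_greedy. Qed.

Lemma has_dim_subspace U m : has_dim U m -> subspace U.
Proof.
move=> [b [_ sb]]; split.
  by apply/sb; exists (fun=> 0); rewrite big1 // => j; rewrite scale0r.
move=> c _ _ /sb[c1 ->] /sb[c2 ->]; apply/sb; exists (fun j => c * c1 j + c2 j).
rewrite scaler_sumr -big_split; apply: eq_bigr => j _ /=.
by rewrite scalerDl scalerA.
Qed.

Lemma fin_dim_subspace U : fin_dim U -> subspace U.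
Proof. by move=> [m]; exact: has_dim_subspace. Qed.

Lemma has_dim_mem U m b : (forall v, U v <-> exists c : 'I_m -> K, v = \sum_j c j *: b j) ->
  forall j, U (b j).
Proof.
move=> sb j; apply/sb; exists (fun i => (i == j)%:R).
by rewrite (bigD1 j) //= eqxx scale1r big1 ?addr0 // => i /negPf->; rewrite scale0r.
Qed.

Lemma has_dim_spanv U m : has_dim U m -> exists s, size s = m /\ U = spanv s.
Proof.
move=> hU; have [b [_ sb]] := hU; exists [seq b j | j <- enum 'I_m]; split.
  by rewrite size_map size_enum_ord.
apply/seteqP; split=> x.
  move=> /sb[c ->]; apply: subspace_sum => [|j _]; first exact: spanv_subspace.
  apply: subspaceZ; first exact: spanv_subspace.
  by apply: spanv_mem; rewrite map_f ?mem_enum.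
apply: spanv_min => [|_ /mapP[j _ ->]]; first exact: has_dim_subspace hU.
exact: has_dim_mem sb j.
Qed.

(** The coordinates of the [u j] on the [w i] form a matrix with independent rows, and such a matrix
    has at most as many rows as columns. *)
Lemma has_dim_le U W a b : U `<=` W -> has_dim U a -> has_dim W b -> (a <= b)%N.
Proof.
move=> UW [u [fu su]] [w [fw sw]].
have h j : exists c : 'I_b -> K, u j = \sum_i c i *: w i.
  by apply/sw/UW; exact: has_dim_mem su j.
have [A hA] := choice h.
pose B : 'M[K]_(a, b) := \matrix_(j, i) A j i.
have fB : row_free B.
  apply: inj_row_free => v vB; apply/rowP => j; rewrite mxE.
  apply: (fu (fun j => v 0 j)); under eq_bigr => i _ do rewrite hA scaler_sumr.
  rewrite exchange_big big1 //= => i _.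
  under eq_bigr => l _ do rewrite scalerA.
  rewrite -scaler_suml; have /matrixP/(_ 0 i) := vB; rewrite !mxE => e.
  rewrite (_ : \sum_ _ _ = 0) ?scale0r // -[RHS]e.
  by apply: eq_bigr => l _; rewrite mxE.
by move: fB; rewrite /row_free => /eqP <-; exact: rank_leq_col.
Qed.

Lemma has_dimP U m : has_dim U m -> dimK U = m.
Proof.
move=> hU; rewrite /dimK; case: xgetP => [a _ ha|/(_ m)//].
by apply/eqP; rewrite eqn_leq (has_dim_le _ ha hU) //= (has_dim_le _ hU ha).
Qed.

Lemma fin_dimP U : fin_dim U -> has_dim U (dimK U).
Proof. by move=> [m hm]; rewrite (has_dimP hm). Qed.

Lemma dimK_le U W : U `<=` W -> fin_dim U -> fin_dim W -> (dimK U <= dimK W)%N.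
Proof. by move=> h /fin_dimP hU /fin_dimP hW; exact: has_dim_le h hU hW. Qed.

Lemma fin_dim_spanv s : fin_dim (spanv s).
Proof. by eexists; exact: greedy_dim. Qed.

(** Free lists in [U] are no longer than the dimension of [W]. If no finite list spanned [U], every
    free list could be extended by a vector outside its span, without end. *)
Lemma fin_dim_subset U W : fin_dim W -> subspace U -> U `<=` W -> fin_dim U.
Proof.
move=> /fin_dimP hW hU UW; set m := dimK W in hW.
have h s : (forall x, x \in s -> U x) -> freev s -> (size s <= m)%N.
  move=> sU fs; apply: (has_dim_le _ (freev_dim fs) hW).
  by apply: spanv_min; [exact: has_dim_subspace hW|move=> x /sU; exact: UW].
apply: contrapT => nf.
suff H d : exists s, [/\ size s = d, forall x, x \in s -> U x & freev s].
  by have [s [sd sU fs]] := H m.+1; have := h s sU fs; rewrite sd ltnn.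
elim: d => [|d [s [sd sU fs]]]; first by exists [::].
have [x [Ux nx]] : exists x, U x /\ ~ spanv s x.
  apply: contrapT => H; apply: nf; rewrite (_ : U = spanv s); first exact: fin_dim_spanv.
  apply/seteqP; split; last exact: spanv_min.
  by move=> x Ux; apply: contrapT => nx; apply: H; exists x.
exists (x :: s); split=> //=; first by rewrite sd.
by move=> y; rewrite inE => /orP[/eqP->|/sU].
Qed.

Lemma has_dim0 : has_dim [set (0 : V)] 0.
Proof. exact: (@freev_dim [::]). Qed.

Lemma has_dimD U W a b : has_dim U a -> has_dim W b ->
  (forall u w, U u -> W w -> u + w = 0 -> u = 0) ->
  has_dim [set x | exists u w, [/\ U u, W w & x = u + w]] (a + b).
Proof.
move=> hU hW ind; have [u [fu su]] := hU; have [w [fw sw]] := hW.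
exists (fun j => match split j with inl j => u j | inr j => w j end).
have E c : \sum_(j < a + b) c j *: (match split j with inl j => u j | inr j => w j end)
    = \sum_j c (lshift b j) *: u j + \sum_j c (rshift a j) *: w j.
  rewrite big_split_ord /=; congr (_ + _); apply: eq_bigr => j _.
    by rewrite (unsplitK (inl j : 'I_a + 'I_b)).
  by rewrite (unsplitK (inr j : 'I_a + 'I_b)).
split=> [c|v].
  rewrite E => e.
  have u0 : \sum_j c (lshift b j) *: u j = 0.
    by apply: (ind _ _ _ _ e); [apply/su|apply/sw]; eexists; reflexivity.
  move: e; rewrite u0 add0r => w0 j; case: (split_ordP j) => i ->.
    exact: (fu (fun i => c (lshift b i))).
  exact: (fw (fun i => c (rshift a i))).
split=> [[x [y [/su[c1 ->] /sw[c2 ->] ->]]]|[c ->]].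
  exists (fun j => match split j with inl j => c1 j | inr j => c2 j end).
  rewrite E; congr (_ + _); apply: eq_bigr => j _.
    by rewrite (unsplitK (inl j : 'I_a + 'I_b)).
  by rewrite (unsplitK (inr j : 'I_a + 'I_b)).
rewrite E; eexists; eexists; split; last reflexivity.
- by apply/su; eexists; reflexivity.
- by apply/sw; eexists; reflexivity.
Qed.

End LinearAlgebraFacts.

Lemma has_dim_image (K : fieldType) (V W : lmodType K) (f : V -> W) (U : set V) m :
  linear f -> (forall x, U x -> f x = 0 -> x = 0) -> has_dim U m ->
  has_dim (f @` U) m.
Proof.
move=> lf fI [b [fb sb]].
have f0 : f 0 = 0.
  by have := lf (-1) 0 0; rewrite scaler0 addr0 scaleN1r addNr.
have fD x y : f (x + y) = f x + f y by have := lf 1 x y; rewrite !scale1r.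
have fZ c x : f (c *: x) = c *: f x by have := lf c x 0; rewrite !addr0 f0 addr0.
have E c : \sum_j c j *: f (b j) = f (\sum_j c j *: b j).
  elim/big_rec2: _ => [|i x y _ ->]; first by rewrite f0.
  by rewrite fD fZ.
exists (f \o b); split=> [c /=|v].
  rewrite E => /fI h; apply: fb; apply: h; apply/sb; eexists; reflexivity.
split=> [[x /sb[c ->] <-]|[c ->]]; first by exists c; rewrite E.
by rewrite /= E; exists (\sum_j c j *: b j) => //; apply/sb; exists c.
Qed.

(** The last hypothesis covers both the independence of the images and the injectivity of each [f i]
    on [U i], so the dimensions add up. For the tensor product the maps are [tau (dq K p k m)]. *)
Lemma has_dim_dsum (K : fieldType) (V W : lmodType K) (I : eqType) (r : seq I)
    (f : I -> V -> W) (U : I -> set V) (m : I -> nat) :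
  uniq r -> (forall i, linear (f i)) ->
  (forall i, i \in r -> has_dim (U i) (m i)) ->
  (forall x : I -> V, (forall i, i \in r -> U i (x i)) ->
     \sum_(i <- r) f i (x i) = 0 -> forall i, i \in r -> x i = 0) ->
  has_dim [set y | exists x : I -> V,
     (forall i, i \in r -> U i (x i)) /\ y = \sum_(i <- r) f i (x i)]
   (\sum_(i <- r) m i).
Proof.
move=> + lf; have f0 i : f i 0 = 0.
  by have := lf i (-1) 0 0; rewrite scaler0 addr0 scaleN1r addNr.
elim: r => [|i r IH] /=.
  move=> _ _ _; rewrite big_nil (_ : [set _ | _] = [set 0]); first exact: has_dim0.
  apply/seteqP; split=> [y [x [_ ->]]|_ ->]; first by rewrite big_nil.
  by exists (fun=> 0); rewrite big_nil.
move=> /andP[ir ur] hm inj.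
have U0 j : j \in i :: r -> U j 0 by move=> /hm/has_dim_subspace[].
(* Only the values on [i :: r] are constrained; [upd] forces the value at [i] and puts zero outside,
   so that families on [r] extend to [i :: r]. *)
pose upd (a : V) (x : I -> V) j := if j == i then a else if j \in r then x j else 0.
have ui a x : upd a x i = a by rewrite /upd eqxx.
have Eu a x : \sum_(j <- r) f j (upd a x j) = \sum_(j <- r) f j (x j).
  rewrite !big_seq; apply: eq_bigr => j jr; rewrite /upd jr.
  by case: eqP jr => // ->; rewrite (negPf ir).
have Uu a x : U i a -> (forall j, j \in r -> U j (x j)) ->
    forall j, j \in i :: r -> U j (upd a x j).
  move=> Ua Ux j; rewrite inE /upd; case: eqP => [->//|_] /= jr; rewrite jr.
  exact: Ux.
have h1 : has_dim (f i @` U i) (m i).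
  apply: has_dim_image => [|a Ua fa|]; [exact: lf| |by apply: hm; exact: mem_head].
  have := inj (upd a (fun=> 0)); rewrite big_cons Eu ui fa.
  rewrite big1 => [|j _]; last exact: f0.
  move=> /(_ _ _ i); rewrite ui; apply; rewrite ?addr0 ?mem_head //.
  by apply: (Uu a (fun=> 0)) => // j jr; apply: U0; rewrite inE jr orbT.
have h2 := IH ur _ _.
have {}h2 := h2 (fun j jr => hm j (mem_behead (s := i :: r) jr)).
have {}h2 : has_dim [set y | exists x : I -> V,
     (forall i, i \in r -> U i (x i)) /\ y = \sum_(i <- r) f i (x i)] (\sum_(i <- r) m i).
  apply: h2 => x Ux ex j jr.
  have := inj (upd 0 x); rewrite big_cons Eu ui f0 add0r.
  move=> /(_ _ ex j); rewrite /upd jr; case: eqP => [ji|_]; first by rewrite -ji jr in ir.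
  apply; last by rewrite inE jr orbT.
  by apply: Uu => //; apply: U0; exact: mem_head.
rewrite big_cons (_ : [set _ | _] = [set x | exists u w,
   [/\ (f i @` U i) u, [set y | exists x : I -> V,
     (forall i, i \in r -> U i (x i)) /\ y = \sum_(i <- r) f i (x i)] w & x = u + w]]).
  apply: has_dimD h1 h2 _ => _ _ [a Ua <-] [x [Ux ->]] e.
  have := inj (upd a x); rewrite big_cons Eu ui => /(_ (Uu _ _ Ua Ux) e i).
  by rewrite mem_head ui => -> //; rewrite f0.
apply/seteqP; split=> y.
  move=> [x [Ux ->]]; rewrite big_cons; eexists; eexists; split; last reflexivity.
    by exists (x i) => //; apply: Ux; exact: mem_head.
  by exists x; split=> // j jr; apply: Ux; rewrite inE jr orbT.
move=> [_ [_ [[a Ua <-] [x [Ux ->]] ->]]]; exists (upd a x); split; first exact: Uu.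
by rewrite big_cons Eu ui.
Qed.

(** * Formal power series as Cauchy products *)

Section CauchyProduct.
Variable F : comNzRingType.
Implicit Types (P Q : {poly F}) (a b : nat -> F).

Definition conv Q a (i : nat) : F := \sum_(j < i.+1) Q`_j * a (i - j)%N.

(** The [i]-th term sees only the first [i.+1] values of the sequence, so the series may be
    truncated to a polynomial, and the ring laws of polynomials carry over to series. *)
Lemma convE Q a i N : (i < N)%N -> conv Q a i = (Q * \poly_(j < N) a j)`_i.
Proof.
move=> iN; rewrite coefM; apply: eq_bigr => j _.
by rewrite coef_poly (leq_ltn_trans (leq_subr _ _) iN).
Qed.

Lemma convM P Q a i : conv (P * Q) a i = conv P (conv Q a) i.
Proof.
rewrite (@convE _ _ i i.+1) // -mulrA coefM; apply: eq_bigr => j _.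
by rewrite (@convE _ _ _ i.+1) // ltnS leq_subr.
Qed.

Lemma conv_coef Q P i : conv Q (fun j => P`_j) i = (Q * P)`_i.
Proof. by rewrite coefM. Qed.

Lemma eq_conv Q a b : a =1 b -> conv Q a =1 conv Q b.
Proof. by move=> ab i; apply: eq_bigr => j _; rewrite ab. Qed.

Lemma conv1 a : conv 1 a =1 a.
Proof.
move=> i; rewrite /conv big_ord_recl coef1 mul1r subn0 big1 ?addr0 // => j _.
by rewrite coef1 mul0r.
Qed.

Lemma convB1Xn q a i : (0 < q)%N ->
  conv (1 - 'X^q) a i = a i - (if (q <= i)%N then a (i - q)%N else 0).
Proof.
move=> q0; rewrite /conv.
under eq_bigr => j _ do rewrite coefB coef1 coefXn mulrBl.
rewrite sumrB; congr (_ - _).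
  by rewrite big_ord_recl /= mul1r subn0 big1 ?addr0 // => j _; rewrite mul0r.
case: leqP => [qi|iq].
  have qi' : (q < i.+1)%N by rewrite ltnS.
  rewrite (bigD1 (Ordinal qi')) //= eqxx mul1r big1 ?addr0 // => j.
  by rewrite -val_eqE /= => /negPf->; rewrite mul0r.
rewrite big1 // => j _; have -> : (j == q :> nat) = false; last by rewrite mul0r.
by apply/negbTE; rewrite neq_ltn (leq_trans (ltn_ord j)).
Qed.

(** A series with constant term 1 is invertible: the [i]-th term of the product is the [i]-th value
    plus a combination of earlier ones. This is how denominators are cancelled. *)
Lemma conv_inj Q a b : Q`_0 = 1 -> conv Q a =1 conv Q b -> a =1 b.
Proof.
move=> Q0 ab i; have [m] := ubnP i; elim: m i => // m IH i im.
have := ab i; rewrite /conv !big_ord_recl Q0 !mul1r !subn0.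
rewrite (eq_bigr (fun j : 'I_i => Q`_(lift ord0 j) * b (i - lift ord0 j)%N)).
  exact: addIr.
move=> j _; rewrite IH // lift0; case: i {ab} im j => [|i] im j; first by case: j.
by rewrite subSS (leq_ltn_trans (leq_subr _ _)).
Qed.

End CauchyProduct.

Lemma coef0_prod_eq1 (F : comNzRingType) (P Q : {poly F}) :
  P`_0 = 1 -> Q`_0 = 1 -> (P * Q)`_0 = 1.
Proof. by move=> h1 h2; rewrite coefM big_ord1 h1 h2 mul1r. Qed.

Lemma coef0_exp_eq1 (F : comNzRingType) (P : {poly F}) m :
  P`_0 = 1 -> (P ^+ m)`_0 = 1.
Proof.
move=> h; elim: m => [|m IH]; first by rewrite expr0 coef1.
by rewrite exprS coef0_prod_eq1.
Qed.

Lemma coef0_B1Xn (F : comNzRingType) q : (0 < q)%N -> (1 - 'X^q : {poly F})`_0 = 1.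
Proof. by case: q => // q _; rewrite coefB coef1 coefXn subr0. Qed.

(** * Quasi-polynomials from series over a power of 1 - X^q *)

Section QuasiPolynomial.
Variables (q : nat) (q_gt0 : (0 < q)%N).

(* coefficients of [1 / (1 - X^q)^(N+1)] *)
Definition binseq N i : int := if (q %| i)%N then 'C(i %/ q + N, N)%:Z else 0.

(** One factor [1 - 'X^q] takes the difference at distance [q], which on the multiples of [q] is
    Pascal's rule and lowers [N] by one. *)
Lemma conv_binseq N : conv ((1 - 'X^q) ^+ N.+1) (binseq N) =1 (fun i => (1 : {poly int})`_i).
Proof.
elim: N => [|N IH] i.
  rewrite expr1 convB1Xn // coef1 /binseq !bin0; case: leqP => qi.
    rewrite dvdn_subl //; case: eqP qi => [->|_ _]; first by rewrite leqn0; case: q q_gt0.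
    by case: ifP => _; rewrite subrr.
  rewrite subr0; case: (posnP i) => [->|i0]; first by rewrite dvdn0.
  by rewrite gtnNdvd // gtn_eqF.
rewrite exprSr convM -IH; apply: eq_conv => {IH}i.
rewrite convB1Xn // /binseq; case: leqP => qi.
  rewrite dvdn_subl //; case: ifP => // /dvdnP[m im].
  rewrite im in qi *; have -> : (m * q - q = (m - 1) * q)%N by rewrite mulnBl mul1n.
  rewrite !mulnK //.
  have : (0 < m)%N by case: m {im} qi => //; rewrite mul0n leqn0; case: q q_gt0.
  case: m {im qi} => // m _; rewrite subn1 /= addnS binS addnS -addSn.
  by rewrite [X in X - _]PoszD addrC addrA addNr add0r.
rewrite subr0; case: ifP => // /dvdnP[m im].
case: m im qi => [->|m ->]; first by rewrite div0n !add0n !binn.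
by rewrite mulSn -ltn_subRL subnn ltn0.
Qed.

Lemma conv_closed_form N (B : {poly int}) f :
  conv ((1 - 'X^q) ^+ N.+1) f =1 (fun i => B`_i) -> f =1 conv B (binseq N).
Proof.
move=> hf; apply: (@conv_inj _ ((1 - 'X^q) ^+ N.+1)).
  by apply: coef0_exp_eq1; exact: coef0_B1Xn.
move=> i; rewrite hf -convM mulrC convM (eq_conv _ (conv_binseq N)).
by rewrite conv_coef mulr1.
Qed.

(** This becomes the leading coefficient of the component on the class of [s], up to the factor 1 /
    (q^N N!). *)
Definition residue_sum (s : nat) (B : {poly int}) : int :=
  \sum_(j < size B | (j %% q == s)%N) B`_j.

Lemma residue_sum_widen s (B : {poly int}) m : (size B <= m)%N ->
  residue_sum s B = \sum_(j < m | (j %% q == s)%N) B`_j.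
Proof.
move=> h; rewrite /residue_sum (big_ord_widen_cond m (fun j => j %% q == s)%N) //.
rewrite [RHS](bigID (fun j : 'I_m => (j < size B)%N)) /=.
by rewrite [X in _ = _ + X]big1 ?addr0 // => j /andP[_]; rewrite -leqNgt => /(nth_default 0)->.
Qed.

Lemma residue_sumD s (A B : {poly int}) : residue_sum s (A + B) = residue_sum s A + residue_sum s B.
Proof.
pose m := maxn (size A) (size B).
rewrite !(@residue_sum_widen _ _ m) ?leq_maxl ?leq_maxr ?size_polyD //.
by rewrite -big_split /=; apply: eq_bigr => j _; rewrite coefD.
Qed.

(** Multiplication by ['X] moves every exponent to the next class; the class before [s] is reached
    by adding [q.-1], as subtraction on [nat] would stop at zero. *)
Lemma residue_sumX s (B : {poly int}) : (s < q)%N ->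
  residue_sum s (B * 'X) = residue_sum ((s + q.-1) %% q)%N B.
Proof.
move=> sq; rewrite (@residue_sum_widen _ _ (size B).+1); last first.
  by rewrite (leq_trans (size_polyMleq _ _)) // size_polyX addn2.
rewrite big_mkcond big_ord_recl coefMX /= if_same add0r /residue_sum [RHS]big_mkcond.
apply: eq_bigr => j _; rewrite coefMX /bump leq0n add1n /=; congr (if _ then _ else _).
apply/eqP/eqP => [<-|].
  by rewrite modnDml addSnnS prednK // modnDr.
move=> h; rewrite -[in RHS](modn_small sq) -addn1 -modnDml h modnDml addn1.
by rewrite -addnS prednK // modnDr.
Qed.

Definition geom_poly : {poly int} := \poly_(l < q) 1.

Lemma geom_polyE : (1 - 'X^q : {poly int}) = (1 - 'X) * geom_poly.
Proof.
rewrite /geom_poly poly_def -[1 in LHS](expr1n _ q) subrXX; congr (_ * _).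
by apply: eq_bigr => i _; rewrite expr1n mul1r scale1r.
Qed.

Lemma geom_poly1 : geom_poly.[1] = q%:Z.
Proof.
rewrite /geom_poly poly_def horner_sum; under eq_bigr do rewrite scale1r hornerXn expr1n.
by rewrite sumr_const card_ord natz.
Qed.

(* This is why all the components of the Hilbert quasi-polynomial share one
   leading coefficient. *)
Lemma residue_sum_geom s (C : {poly int}) : (s < q)%N -> residue_sum s (C * geom_poly) = C.[1].
Proof.
elim/poly_ind: C s => [|C c IH] s sq.
  by rewrite mul0r horner0 /residue_sum size_poly0 big_ord0.
rewrite mulrDl residue_sumD mulrAC residue_sumX // IH ?ltn_mod // hornerMXaddC mulr1.
congr (_ + _); rewrite (@residue_sum_widen _ _ q); last first.
  by rewrite mul_polyC (leq_trans (size_scale_leq _ _)) // size_poly.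
rewrite (bigD1 (Ordinal sq)) /= ?modn_small // big1 ?addr0 => [|j].
  by rewrite coefCM coef_poly sq mulr1.
by rewrite modn_small // -val_eqE /= => /andP[/eqP->]; rewrite eqxx.
Qed.

Section ClosedForm.
Variables (N : nat) (B : {poly int}).

Definition shift_prod (j : nat) : {poly int} :=
  \prod_(m < N) ('X - (j%:Z - (q * m.+1)%:Z)%:P).

(* The coefficient of [X^i] in [B / (1 - X^q)^(N+1)] is the sum of
   [B_j * 'C((i - j) / q + N, N)] over [j] congruent to [i] mod [q];
   multiplying by [q^N * N`!] makes it an integral polynomial in [i]. *)
Definition quasi_num (s : nat) : {poly int} :=
  \sum_(j < size B | (j %% q == s)%N) B`_j *: shift_prod j.

Definition quasi_comp (s : nat) : {poly rat} :=
  (q ^ N * N`!)%N%:R^-1 *: map_poly intr (quasi_num s).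

Lemma bin_prod a m : ('C(a + m, m) * m`! = \prod_(l < m) (a + l.+1))%N.
Proof.
elim: m => [|m IH]; first by rewrite bin0 big_ord0.
rewrite big_ord_recr /= -IH factS mulnA [('C(_, _) * _)%N]mulnC -mul_bin_diag addnS /=.
by rewrite -mulnA mulnC.
Qed.

(** With i - j = a q the factor of index m is q (a + m + 1), so the product is q^N times a rising
    factorial, which is N! C(a + N, N). *)
Lemma shift_prodE j i : (j <= i)%N -> (q %| i - j)%N ->
  (shift_prod j).[i%:Z] = (q ^ N * N`! * 'C((i - j) %/ q + N, N))%N%:Z.
Proof.
move=> ji /dvdnP[a ea]; rewrite ea mulnK // -mulnA.
rewrite [(N`! * _)%N]mulnC bin_prod /shift_prod horner_prod.
rewrite (_ : (q ^ N = \prod_(m < N) q)%N); last by rewrite prod_nat_const card_ord.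
rewrite -big_split /= -[RHS]natz natr_prod; apply: eq_bigr => m _.
have {ea}ei : i = (a * q + j)%N by rewrite -ea subnK.
by rewrite hornerXsubC ei; lia.
Qed.

Lemma shift_prod_monic j : shift_prod j \is monic /\ size (shift_prod j) = N.+1.
Proof.
by rewrite monic_prod_XsubC size_prod_XsubC /index_enum -enumT size_enum_ord.
Qed.

(** Once [i] reaches [size B], every coefficient of [B] enters the convolution; [binseq] discards
    those not congruent to [i], and the others contribute polynomially by [shift_prodE]. *)
Lemma quasi_numE i : (size B <= i)%N ->
  (quasi_num (i %% q)).[i%:Z] = (q ^ N * N`!)%N%:Z * conv B (binseq N) i.
Proof.
move=> Bi; rewrite /quasi_num horner_sum /conv mulr_sumr.
rewrite [RHS](bigID (fun j : 'I_i.+1 => (j < size B)%N)) /=.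
rewrite [X in _ = _ + X]big1 ?addr0; last first.
  by move=> j; rewrite -leqNgt => h; rewrite nth_default // mul0r mulr0.
rewrite (big_ord_widen_cond i.+1 (fun j => j %% q == i %% q)%N
   (fun j => (B`_j *: shift_prod j).[i%:Z])); last exact: leqW.
rewrite [RHS](bigID (fun j : 'I_i.+1 => (j %% q == i %% q)%N)) /=.
rewrite [X in _ = _ + X]big1 ?addr0; last first.
  move=> j /andP[_ nj]; rewrite /binseq; case: ifP; last by rewrite !mulr0.
  rewrite -eqn_mod_dvd; last by rewrite -ltnS; exact: ltn_ord.
  by rewrite eq_sym (negPf nj).
apply: eq_big => [j|j /andP[/eqP e _]]; first exact: andbC.
have ji : (j <= i)%N by rewrite -ltnS; exact: ltn_ord.
have d : (q %| i - j)%N by rewrite -eqn_mod_dvd // e.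
by rewrite hornerZ shift_prodE // /binseq d PoszM mulrCA.
Qed.

Hypothesis res0 : forall s, (s < q)%N -> residue_sum s B != 0.

(** All [shift_prod j] are monic of degree [N], so the coefficient in degree [N] is the residue sum,
    and [res0] prevents a drop of degree. *)
Lemma quasi_num_lead s : (s < q)%N ->
  size (quasi_num s) = N.+1 /\ lead_coef (quasi_num s) = residue_sum s B.
Proof.
move=> sq; have h : (quasi_num s)`_N = residue_sum s B.
  rewrite /quasi_num coef_sum; apply: eq_bigr => j _.
  have [/monicP mj sj] := shift_prod_monic j.
  by rewrite coefZ -[N in LHS]/(N.+1.-1) -sj -/(lead_coef _) mj mulr1.
have sz : size (quasi_num s) = N.+1.
  apply/eqP; rewrite eqn_leq; apply/andP; split.
    apply: (leq_trans (size_sum _ _ _)); apply/bigmax_leqP => j _.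
    by rewrite (leq_trans (size_scale_leq _ _)) // (proj2 (shift_prod_monic j)).
  by rewrite ltnNge; apply: contraNN (res0 sq) => h'; rewrite -h nth_default.
by split=> //; rewrite /lead_coef sz.
Qed.

Lemma quasi_comp_lead s : (s < q)%N -> size (quasi_comp s) = N.+1 /\
  lead_coef (quasi_comp s) = (residue_sum s B)%:~R / (q ^ N * N`!)%N%:R.
Proof.
move=> sq; have [sz ld] := quasi_num_lead sq.
have nz : (q ^ N * N`!)%N%:R^-1 != 0 :> rat.
  by rewrite invr_eq0 pnatr_eq0 -lt0n muln_gt0 expn_gt0 q_gt0 fact_gt0.
rewrite /quasi_comp size_scale // lead_coefZ mulrC -ld.
by rewrite size_map_inj_poly ?lead_coef_map_inj //; exact: intr_inj.
Qed.

Lemma quasi_comp_coef s j :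
  (quasi_comp s)`_j = ((quasi_num s)`_j)%:~R / (q ^ N * N`!)%N%:R.
Proof. by rewrite coefZ coef_map mulrC. Qed.

Lemma quasi_compE (f : nat -> nat) i :
  conv ((1 - 'X^q) ^+ N.+1) (fun i => (f i)%:Z) =1 (fun i => B`_i) ->
  (size B <= i)%N -> (f i)%:R = (quasi_comp (i %% q)).[i%:R].
Proof.
move=> /conv_closed_form hf iB; rewrite hornerZ.
rewrite (_ : i%:R = i%:Z%:~R) // horner_map /= quasi_numE // -hf.
by rewrite intrM -!pmulrn mulKf // pnatr_eq0 -lt0n muln_gt0 expn_gt0 q_gt0 fact_gt0.
Qed.

End ClosedForm.
End QuasiPolynomial.

(** Common factors [1 - 'X] of numerator and denominator are cancelled until the numerator is
    nonzero at 1. If the denominator were used up, [f] would list the coefficients of a polynomial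
    and be eventually zero. *)
Lemma conv_normalize (f : nat -> int) N (A : {poly int}) : ~ (exists i0, forall i, (i0 <= i)%N -> f i = 0) ->
  conv ((1 - 'X) ^+ N) f =1 (fun i => A`_i) ->
  exists d (B : {poly int}), conv ((1 - 'X) ^+ d.+1) f =1 (fun i => B`_i) /\ B.[1] != 0.
Proof.
move=> nf; elim: N A => [|N IH] A hA.
  case: nf; exists (size A) => i iA; have := hA i.
  by rewrite expr0 conv1 => ->; rewrite nth_default.
have [/eqP A1|A1] := eqVneq A.[1] 0; last by exists N, A.
have /factor_theorem[C hC] : root A 1 by [].
(* The root gives A = C (X - 1), whereas the denominator is made of factors 1 - X; hence the
   sign. *)
apply: (IH (- C)); apply: (@conv_inj _ (1 - 'X)); first by rewrite coefB coef1 coefX subr0.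
move=> i; rewrite -convM -exprS hA conv_coef hC mulrC -[1 - 'X]opprB mulNr mulrN opprK.
by rewrite mulrC.
Qed.

(** * Leading terms and growth exponents *)

Section Asymptotics.
Variable R : realType.
Implicit Types (f g : nat -> R) (l : R) (N : nat).

(* the equivalence [f i ~ l * i ^ N] with the error term [O(i ^ (N - 1))] *)
Definition asym f N l := exists (C : R) (i0 : nat), forall i, (i0 <= i)%N ->
  `|f i - l * i%:R ^+ N| * i%:R <= C * i%:R ^+ N.

Lemma natr_mul_bounded (x C : R) i0 :
  (forall i, (i0 <= i)%N -> x * i%:R <= C) -> x <= 0.
Proof.
move=> h; rewrite leNgt; apply/negP => x0.
pose i := maxn i0 (Num.truncn (C / x)).+1.
have := h i (leq_maxl _ _); rewrite leNgt => /negP; apply.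
rewrite mulrC -ltr_pdivrMr //; apply: (lt_le_trans (truncnS_gt _)).
by rewrite ler_nat leq_maxr.
Qed.

Lemma asymP f N l : asym f N l -> exists (C : R) (i0 : nat), [/\ 0 <= C, (0 < i0)%N &
  forall i, (i0 <= i)%N -> `|f i - l * i%:R ^+ N| * i%:R <= C * i%:R ^+ N].
Proof.
move=> [C [i0 h]]; exists `|C|, i0.+1; split=> // i /ltnW/h/le_trans; apply.
by rewrite ler_wpM2r ?exprn_ge0 ?ler_norm.
Qed.

Lemma asym_poly (P : {poly R}) N : (size P <= N.+1)%N -> asym (fun i => P.[i%:R]) N P`_N.
Proof.
move=> sP; exists (\sum_(j < N) `|P`_j|), 1%N => i i0.
rewrite (horner_coef_wide _ sP) big_ord_recr /= addrK.
rewrite -normr_nat -normrM mulr_suml [`|i%:R|]normr_nat mulr_suml.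
apply: (le_trans (ler_norm_sum _ _ _)); apply: ler_sum => j _.
rewrite -mulrA -exprSr normrM ler_wpM2l // ger0_norm ?exprn_ge0 //.
by rewrite ler_weXn2l // ler1n.
Qed.

Lemma asym_exp_sub (c : R) N : exists (C : R) i0, [/\ 0 <= C, (0 < i0)%N & forall i, (i0 <= i)%N ->
  `|(i%:R - c) ^+ N - i%:R ^+ N| * i%:R <= C * i%:R ^+ N].
Proof.
have sz := size_exp_XsubC N c.
have ld : (('X - c%:P) ^+ N)`_N = 1.
  have : (('X - c%:P) ^+ N) \is monic by rewrite monic_exp ?monicXsubC.
  by move=> /monicP; rewrite /lead_coef sz.
have [C [i0 [C0 i00 h]]] := asymP (asym_poly (eq_leq sz)).
exists C, i0; split=> // i /h; rewrite ld mul1r.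
by rewrite horner_exp hornerXsubC.
Qed.

Lemma asym_shift_up f N l a : asym f N l -> asym (fun i => f (i + a)%N) N l.
Proof.
move=> /asymP[C [i0 [C0 i00 h]]].
have [C' [i1 [C'0 i10 h']]] := asym_exp_sub (- a%:R) N.
exists (C * (1 + a%:R) ^+ N + `|l| * C'), (maxn i0 i1) => i.
rewrite geq_max => /andP[hi0 hi1].
have ip : (0 < i)%N by apply: leq_trans hi0.
rewrite (_ : _ - _ = (f (i + a)%N - l * (i + a)%:R ^+ N) +
   l * ((i%:R - - a%:R) ^+ N - i%:R ^+ N)); last by rewrite natrD opprK mulrBr addrA subrK.
apply: (@le_trans _ _ ((`|f (i + a)%N - l * (i + a)%:R ^+ N| +
   `|l * ((i%:R - - a%:R) ^+ N - i%:R ^+ N)|) * i%:R)).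
  by rewrite ler_wpM2r // ler_normD.
rewrite mulrDl [leRHS]mulrDl lerD //; last first.
  by rewrite normrM -!mulrA ler_wpM2l // h'.
apply: (@le_trans _ _ (`|f (i + a)%N - l * (i + a)%:R ^+ N| * (i + a)%:R)).
  by rewrite ler_wpM2l // ler_nat leq_addr.
apply: (le_trans (h _ (leq_trans hi0 (leq_addr _ _)))).
rewrite -mulrA ler_wpM2l // -exprMn lerXn2r ?nnegrE ?mulr_ge0 ?addr_ge0 //.
by rewrite natrD mulrDl mul1r lerD2l ler_peMr // ler1n.
Qed.

Lemma asym_shift_down f N l a : asym f N l -> asym (fun i => f (i - a)%N) N l.
Proof.
move=> /asymP[C [i0 [C0 i00 h]]].
have [C' [i1 [C'0 i10 h']]] := asym_exp_sub a%:R N.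
exists (C * (1 + a%:R) + `|l| * C'), (maxn (i0 + a) i1) => i.
rewrite geq_max => /andP[hi0 hi1].
have ai : (a < i)%N by apply: leq_trans hi0; rewrite -addn1 addnC leq_add2r.
have e : (i - a)%:R = i%:R - a%:R :> R by rewrite natrB // ltnW.
have ia0 : (0 < i - a)%N by rewrite subn_gt0.
rewrite (_ : _ - _ = (f (i - a)%N - l * (i - a)%:R ^+ N) +
   l * ((i%:R - a%:R) ^+ N - i%:R ^+ N)); last by rewrite e mulrBr addrA subrK.
apply: (@le_trans _ _ ((`|f (i - a)%N - l * (i - a)%:R ^+ N| +
   `|l * ((i%:R - a%:R) ^+ N - i%:R ^+ N)|) * i%:R)).
  by rewrite ler_wpM2r // ler_normD.
rewrite mulrDl [leRHS]mulrDl lerD //; last first.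
  by rewrite normrM -!mulrA ler_wpM2l // h'.
apply: (@le_trans _ _ (`|f (i - a)%N - l * (i - a)%:R ^+ N| * (i - a)%:R * (1 + a%:R))).
  rewrite -mulrA ler_wpM2l //.
  rewrite -[1 + _](natrD _ 1%N) -natrM ler_nat mulnDr muln1.
  by rewrite -{1}(subnK (ltnW ai)) leq_add2l leq_pmull.
have hia : (i0 <= i - a)%N by rewrite leq_subRL 1?addnC // ltnW.
apply: (@le_trans _ _ (C * (i - a)%:R ^+ N * (1 + a%:R))).
  by rewrite ler_wpM2r ?addr_ge0 // h.
rewrite mulrAC ler_wpM2l ?mulr_ge0 ?addr_ge0 // lerXn2r ?nnegrE //.
by rewrite ler_nat leq_subr.
Qed.

(** A shift of the argument changes the main term by O(i^(N-1)) only. The Hilbert functions of two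
    generating subspaces bound each other in this way, so they share [N] and [l]. *)
Lemma asym_sandwich f g N l a : asym f N l ->
  (forall i, g i <= f (i + a)%N) -> (forall i, f i <= g (i + a)%N) -> asym g N l.
Proof.
move=> hf; have [C1 [i1 [C10 _ h1]]] := asymP (asym_shift_up a hf).
have [C2 [i2 [C20 _ h2]]] := asymP (asym_shift_down a hf).
move=> gf fg; exists (C1 + C2), (maxn (maxn i1 i2) a) => i.
rewrite !geq_max => /andP[/andP[hi1 hi2] ai].
have := h1 _ hi1; have := h2 _ hi2; set L := l * _.
have l1 := gf i; have l2 := fg (i - a)%N; rewrite subnK // in l2.
move=> b2 b1; rewrite [leRHS]mulrDl; apply: le_trans (lerD b1 b2).
rewrite -mulrDl ler_wpM2r // ler_norml; apply/andP; split.
  rewrite lerNl; apply: (@le_trans _ _ (`|f (i - a)%N - L|)); last by rewrite lerDr.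
  by rewrite distrC; apply: le_trans (ler_norm _); lra.
apply: (@le_trans _ _ (`|f (i + a)%N - L|)); last by rewrite lerDl.
by apply: le_trans (ler_norm _); lra.
Qed.

Lemma asym_ge f N l : asym f N l -> (forall i, 0 <= f i) -> 0 <= l.
Proof.
move=> /asymP[C [i0 [C0 i00 h]]] f0; rewrite -oppr_le0.
apply: (@natr_mul_bounded _ C i0) => i hi; have ip : (0 < i)%N by apply: leq_trans hi.
have iN : 0 < i%:R ^+ N :> R by rewrite exprn_gt0 // ltr0n.
rewrite -(ler_pM2r iN); apply: le_trans (h i hi).
rewrite mulrAC ler_wpM2r // mulNr; apply: le_trans (ler_norm _).
by rewrite lerDr.
Qed.

Lemma asym_upper f N l : asym f N l ->
  exists (c : R) i0, 0 < c /\ forall i, (i0 <= i)%N -> f i <= c * i%:R ^+ N.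
Proof.
move=> /asymP[C [i0 [C0 i00 h]]]; exists (C + `|l| + 1), i0; split.
  by rewrite ltr_wpDl ?addr_ge0.
move=> i hi; have ip : (0 < i)%N by apply: leq_trans hi.
have iN : 0 <= i%:R ^+ N :> R by rewrite exprn_ge0.
have h' : `|f i - l * i%:R ^+ N| <= C * i%:R ^+ N.
  by apply: le_trans (h i hi); rewrite ler_peMr // ler1n.
have := le_trans (ler_norm _) h'; rewrite lerBlDr => /le_trans; apply.
rewrite -mulrDl ler_wpM2r //; have := ler_norm l; lra.
Qed.

Lemma asym_lower f N l : asym f N l -> 0 < l ->
  exists (c : R) i0, 0 < c /\ forall i, (i0 <= i)%N -> c * i%:R ^+ N <= f i.
Proof.
move=> /asymP[C [i0 [C0 i00 h]]] l0.
pose i1 := maxn i0 (Num.truncn (2 * C / l)).+1.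
exists (l / 2), i1; split; first by rewrite divr_gt0.
move=> i; rewrite geq_max => /andP[hi hi']; have ip : (0 < i)%N by apply: leq_trans hi.
have ip' : 0 < i%:R :> R by rewrite ltr0n.
have iN : 0 <= i%:R ^+ N :> R by rewrite exprn_ge0.
have Ci : C <= l / 2 * i%:R.
  rewrite mulrAC ler_pdivlMr // mulrC [leRHS]mulrC -ler_pdivrMr //.
  by apply: (le_trans (ltW (truncnS_gt _))); rewrite ler_nat.
have h' : `|f i - l * i%:R ^+ N| <= l / 2 * i%:R ^+ N.
  rewrite -(ler_pM2r ip'); apply: (le_trans (h i hi)).
  by rewrite mulrAC ler_wpM2r.
move: h'; rewrite distrC => h'; have := le_trans (ler_norm _) h'; lra.
Qed.

(** As both coefficients are positive, unequal exponents would bound a positive constant by a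
    multiple of 1/i for all large i. With equal exponents |l - l'| i stays bounded, which forces l =
    l'. *)
Lemma asym_unique f N N' l l' : asym f N l -> asym f N' l' -> 0 < l -> 0 < l' ->
  N = N' /\ l = l'.
Proof.
have key f1 M M' m m' : asym f1 M m -> asym f1 M' m' -> 0 < m' -> (M' <= M)%N.
  move=> /asym_upper[c [i0 [c0 h]]] /asym_lower h' /h'{h'}[c' [i1 [c'0 h']]].
  rewrite leqNgt; apply/negP => MM'.
  have : c' <= 0.
    apply: (@natr_mul_bounded _ c (maxn 1 (maxn i0 i1))) => i.
    rewrite !geq_max => /and3P[ip hi0 hi1].
    have ip' : 0 < i%:R :> R by rewrite ltr0n.
    rewrite -(ler_pM2r (exprn_gt0 M ip')); apply: le_trans (h i hi0).
    apply: le_trans (h' i hi1); rewrite -mulrA -exprS (ler_wpM2l (ltW c'0)) //.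
    by rewrite ler_weXn2l // ler1n.
  by rewrite leNgt c'0.
move=> h h' l0 l'0; have e : N = N'.
  by apply/eqP; rewrite eqn_leq (key _ _ _ _ _ h h' l'0) (key _ _ _ _ _ h' h l0).
split=> //; move: h'; rewrite -e => /asymP[C' [i1 [C'0 i10 h']]].
have [C [i0 [C0 i00 {}h]]] := asymP h.
apply/eqP; rewrite -subr_eq0 -normr_le0.
apply: (@natr_mul_bounded _ (C + C') (maxn i0 i1)) => i.
rewrite geq_max => /andP[hi0 hi1]; have ip : (0 < i)%N by apply: leq_trans hi0.
have iN : 0 < i%:R ^+ N :> R by rewrite exprn_gt0 // ltr0n.
rewrite -(ler_pM2r iN) [leRHS]mulrDl; apply: le_trans (lerD (h i hi0) (h' i hi1)).
rewrite -mulrDl mulrAC ler_wpM2r //.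
rewrite -{1}(gtr0_norm iN) -normrM mulrBl.
rewrite (_ : _ - _ = (f i - l' * i%:R ^+ N) - (f i - l * i%:R ^+ N)); last by ring.
by apply: (le_trans (ler_normB _ _)); rewrite addrC.
Qed.

Lemma asym_littleo f N l : asym f N l ->
  (fun i : nat => f i - l * i%:R ^+ N : R^o) =o_\oo (fun i : nat => i%:R ^+ N : R^o).
Proof.
move=> /asymP[C [i0 [C0 i00 h]]]; apply/eqoP => e e0.
exists (maxn i0 (Num.truncn (C / e)).+1) => // i /=; rewrite geq_max => /andP[hi hi'].
have ip' : 0 < i%:R :> R by rewrite ltr0n; apply: leq_trans hi.
rewrite [X in _ <= _ * X]ger0_norm ?exprn_ge0 // -(ler_pM2r ip').
apply: (le_trans (h i hi)); rewrite mulrAC ler_wpM2r ?exprn_ge0 //.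
rewrite mulrC -ler_pdivrMr //; apply: (le_trans (ltW (truncnS_gt _))).
by rewrite ler_nat.
Qed.

Lemma powR_unbounded (c s : R) : 0 < s -> exists i0, (0 < i0)%N /\
  forall i, (i0 <= i)%N -> c <= i%:R `^ s.
Proof.
move=> s0; exists (Num.truncn (`|c| `^ s^-1)).+1; split=> // i hi.
apply: (le_trans (ler_norm c)); rewrite [leLHS](_ : _ = `|c| `^ (s^-1 * s)); last by rewrite mulVf ?powRr1 // lt0r_neq0.
rewrite powRrM; apply: ge0_ler_powR; rewrite ?nnegrE ?powR_ge0 ?(ltW s0) //.
by apply: (le_trans (ltW (truncnS_gt _))); rewrite ler_nat.
Qed.

(** For every e > 0 the power i^e eventually absorbs the constant [c], so each exponent N + e is
    admissible in the infimum. *)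
Lemma growth_le (f : nat -> nat) N (c : R) i0 :
  (forall i, (i0 <= i)%N -> (f i)%:R <= c * i%:R ^+ N) -> (growth R f <= (N%:R)%:E)%E.
Proof.
move=> h; apply/lee_addgt0Pr => e e0; apply: ereal_inf_lbound; exists (N%:R + e) => //.
split; first by rewrite addr_ge0 // ltW.
have [i1 [i10 h1]] := powR_unbounded c e0.
exists (maxn i0 i1) => // i /=; rewrite geq_max => /andP[hi0 hi1].
have ip : i%:R != 0 :> R by rewrite pnatr_eq0 -lt0n; apply: leq_trans hi1.
apply: (le_trans (h i hi0)); rewrite powRD; last by rewrite ip implybT.
by rewrite powR_mulrn // mulrC ler_wpM2l ?exprn_ge0 // h1.
Qed.

Lemma growth_ge (f : nat -> nat) N (c : R) i0 : 0 < c ->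
  (forall i, (i0 <= i)%N -> c * i%:R ^+ N <= (f i)%:R) -> ((N%:R)%:E <= growth R f)%E.
Proof.
move=> c0 h; apply: le_ereal_inf_tmp => _ [r [r0 [i1 _ hr]] <-]; rewrite lee_fin leNgt.
apply/negP => rN; have sp : 0 < N%:R - r by rewrite subr_gt0.
(* If i^r bounded [f] with r < N, then c i^(N-r) would be at most 1 eventually; the value c^-1 + 1
   is chosen to contradict this. *)
have [i2 [i20 h2]] := powR_unbounded (c^-1 + 1) sp.
pose i := maxn (maxn i0 i1) i2.
have hi0 : (i0 <= i)%N by rewrite !leq_max leqnn.
have hi1 : (i1 <= i)%N by rewrite !leq_max leqnn orbT.
have hi2 : (i2 <= i)%N by rewrite !leq_max leqnn orbT.
have ip : i%:R != 0 :> R by rewrite pnatr_eq0 -lt0n; apply: leq_trans hi2.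
have ip' : 0 < i%:R :> R by rewrite ltr0n lt0n -(pnatr_eq0 R).
have := le_trans (h i hi0) (hr i hi1).
rewrite -powR_mulrn // (_ : N%:R = N%:R - r + r); last by rewrite subrK.
rewrite powRD ?ip ?implybT //.
rewrite mulrA -[leRHS]mul1r ler_pM2r ?powR_gt0 // => h3.
have := le_trans (ler_wpM2l (ltW c0) (h2 i hi2)) h3.
by rewrite mulrDr mulfV ?gt_eqF // mulr1; lra.
Qed.

Lemma asym_growth (f : nat -> nat) N l : asym (fun i => (f i)%:R) N l -> 0 < l ->
  growth R f = (N%:R)%:E.
Proof.
move=> h l0; apply/eqP; rewrite eq_le; apply/andP; split.
  by have [c [i0 [_ hc]]] := asym_upper h; exact: growth_le hc.
by have [c [i0 [c0 hc]]] := asym_lower h l0; exact: growth_ge hc.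
Qed.

(** One constant has to serve all residue classes: the sum of the nonnegative constants of the
    components, with the maximum of their thresholds. *)
Lemma asym_quasi (f : nat -> nat) q N (P : nat -> {poly rat}) (l : rat) i0 : (0 < q)%N ->
  (forall s, (s < q)%N -> size (P s) = N.+1 /\ lead_coef (P s) = l) ->
  (forall i, (i0 <= i)%N -> (f i)%:R = (P (i %% q)%N).[i%:R]) ->
  asym (fun i => (f i)%:R) N (ratr l).
Proof.
move=> q0 hP hf.
have h (s : 'I_q) : exists C : R, exists i1, 0 <= C /\ forall i, (i1 <= i)%N ->
   `|ratr (P s).[i%:R] - ratr l * i%:R ^+ N| * i%:R <= C * i%:R ^+ N.
  have [sz ld] := hP s (ltn_ord s).
  have := @asym_poly (map_poly ratr (P s)) N; rewrite size_map_poly sz => /(_ (leqnn _)).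
  move=> /asymP[C [i1 [C0 _ hC]]]; exists C, i1; split=> // i /hC.
  rewrite coef_map -(ratr_nat R i) horner_map /=.
  by rewrite -ld /lead_coef sz.
have [C {}h] := choice h; have [i1 {}h] := choice h.
exists (\sum_s C s), (maxn i0 (\max_s i1 s)) => i; rewrite geq_max => /andP[hi0 hi1].
pose s := Ordinal (ltn_pmod i q0).
rewrite -(ratr_nat R (f i)) hf //.
have [_ /(_ i)] := h s; rewrite /= => hh; apply: (le_trans (hh _)).
  by apply: leq_trans hi1; exact: (leq_bigmax s).
rewrite ler_wpM2r ?exprn_ge0 // (bigD1 s) //= lerDl sumr_ge0 // => t _.
by case: (h t).
Qed.

End Asymptotics.

(** * Sequences with rational generating series *)

Section RationalSequences.
Implicit Types f g : nat -> int.

(* the generating series of [f] is a polynomial over a power of [1 - X] *)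
Definition rational_seq f := exists N (A : {poly int}),
  conv ((1 - 'X) ^+ N) f =1 (fun i => A`_i).

Lemma convD (Q : {poly int}) f g i : conv Q (fun j => f j + g j) i = conv Q f i + conv Q g i.
Proof. by rewrite /conv -big_split; apply: eq_bigr => j _; rewrite mulrDr. Qed.

Lemma rational_seq_ext f g : f =1 g -> rational_seq f -> rational_seq g.
Proof. by move=> fg [N [A h]]; exists N, A => i; rewrite -h; apply: eq_conv => j; rewrite fg. Qed.

Lemma rational_seq0 : rational_seq (fun=> 0).
Proof.
by exists 0%N, 0 => i; rewrite coef0 /conv big1 // => j _; rewrite mulr0.
Qed.

Lemma rational_seqD f g : rational_seq f -> rational_seq g ->
  rational_seq (fun i => f i + g i).
Proof.
move=> [N [A hA]] [M [B hB]]; exists (N + M)%N, ((1 - 'X) ^+ M * A + (1 - 'X) ^+ N * B) => i.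
rewrite exprD convD coefD; congr (_ + _).
  by rewrite mulrC convM (eq_conv _ hA) conv_coef.
by rewrite convM (eq_conv _ hB) conv_coef.
Qed.

Lemma rational_seq_sum I (r : seq I) (F : I -> nat -> int) :
  (forall j, rational_seq (F j)) -> rational_seq (fun i => \sum_(j <- r) F j i).
Proof.
move=> hF; elim: r => [|j r IH].
  by apply: rational_seq_ext rational_seq0 => i; rewrite big_nil.
by apply: rational_seq_ext (rational_seqD (hF j) IH) => i; rewrite big_cons.
Qed.

Lemma rational_seq_shift m f : rational_seq f ->
  rational_seq (fun i => if (m <= i)%N then f (i - m)%N else 0).
Proof.
move=> [N [A hA]]; exists N, ('X^m * A) => i.
rewrite -conv_coef -(eq_conv _ hA) -convM mulrC convM; apply: eq_conv => {}i.
rewrite /conv; case: leqP => mi.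
  have mi' : (m < i.+1)%N by [].
  rewrite (bigD1 (Ordinal mi')) //= coefXn eqxx mul1r big1 ?addr0 // => j.
  by rewrite -val_eqE coefXn /= => /negPf->; rewrite mul0r.
rewrite big1 // => j _; rewrite coefXn (_ : (j == m :> nat) = false) ?mul0r //.
by apply/negbTE; rewrite neq_ltn (leq_trans (ltn_ord j)).
Qed.

Lemma rational_seq_psum f : rational_seq f ->
  rational_seq (fun i => \sum_(j < i.+1) f j).
Proof.
move=> [N [A hA]]; exists N.+1, A => i; rewrite -hA exprSr convM.
apply: eq_conv => {}i; rewrite -['X]expr1 convB1Xn //.
case: i => [|i] /=; first by rewrite subr0 big_ord1.
by rewrite subn1 /= [X in X - _]big_ord_recr /= addrC addrK.
Qed.

(** The generating series is the sum of the X^m G_m. Since G_m is constant from [m0] on, the tail is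
    a shift of G_m0 / (1 - X); splitting off the first term shifts the chain and lowers [m0]. *)
Lemma rational_seq_chain (g : nat -> nat -> int) m0 :
  (forall m, rational_seq (g m)) -> (forall m, (m0 <= m)%N -> g m =1 g m0) ->
  rational_seq (fun i => \sum_(m < i.+1) g m (i - m)%N).
Proof.
elim: m0 g => [|m0 IH] g hg hm.
  apply: rational_seq_ext (rational_seq_psum (hg 0%N)) => i.
  rewrite [RHS](reindex_inj rev_ord_inj); apply: eq_bigr => m _ /=.
  by rewrite subSS hm // subKn // -ltnS.
have h := IH (fun m => g m.+1) (fun m => hg m.+1) (fun m mm => hm m.+1 mm).
apply: rational_seq_ext (rational_seqD (hg 0%N) (rational_seq_shift 1 h)) => i /=.
rewrite [RHS]big_ord_recl subn0; congr (_ + _).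
case: i => [|i]; first by rewrite big_ord0.
by rewrite subn1; apply: eq_bigr => m _; rewrite lift0 subSS.
Qed.

End RationalSequences.

(** * Dickson's lemma *)

Section Dickson.

(** [nxt k] is an index after [k] at which [f] is minimal among all indices after [k]; iterating it
    gives nondecreasing values. *)
Lemma monotone_subseq (f : nat -> nat) : exists phi : nat -> nat,
  (forall i, phi i < phi i.+1)%N /\ (forall i, f (phi i) <= f (phi i.+1))%N.
Proof.
have h k : exists m, (k < m)%N /\ forall m', (k < m')%N -> (f m <= f m')%N.
  have ex : exists v, `[< exists m, (k < m)%N /\ f m = v >].
    by exists (f k.+1); apply/asboolP; exists k.+1.
  have [v /asboolP[m [km <-]] hv] := ex_minnP ex; exists m; split=> // m' km'.
  by apply: hv; apply/asboolP; exists m'.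
have [nxt hn] := choice h.
exists (fix phi i := if i is i'.+1 then nxt (phi i') else nxt 0%N); split=> i.
  exact: (proj1 (hn _)).
have lt k : (k < nxt k)%N by case: (hn k).
case: i => [|i]; apply: (proj2 (hn _)); first exact: ltn_trans (lt _) (lt _).
exact: ltn_trans (lt _) (lt _).
Qed.

Lemma dickson n (s : nat -> seq nat) : (forall i, size (s i) = n) ->
  exists phi : nat -> nat, (forall i, phi i < phi i.+1)%N /\
    forall i, all2 leq (s (phi i)) (s (phi i.+1)).
Proof.
elim: n s => [|n IH] s hs.
  exists id; split=> // i; have := hs i; have := hs i.+1.
  by case: (s i) => // /size0nil ->.
have [psi [psi_lt psi_le]] := monotone_subseq (fun i => head 0%N (s i)).
have [|phi [phi_lt phi_le]] := IH (fun i => behead (s (psi i))).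
  by move=> i; rewrite size_behead hs.
have mono i j : (i <= j)%N -> (head 0 (s (psi i)) <= head 0 (s (psi j)))%N.
  by apply: (@homo_leq _ (fun i => head 0 (s (psi i)))%N (fun x y => x <= y)%N leqnn
    (fun y x z => @leq_trans y x z)).
have psi_mono i j : (i < j)%N -> (psi i < psi j)%N.
  by apply: (@homo_ltn _ psi (fun x y => x < y)%N (fun y x z => @ltn_trans y x z)).
exists (psi \o phi); split=> i /=; first exact: psi_mono.
have := phi_le i; have := mono _ _ (ltnW (phi_lt i)).
have := hs (psi (phi i)); have := hs (psi (phi i.+1)).
by case: (s _) => // a t _; case: (s _) => //= b u _ -> ->.
Qed.

Definition down_closed n (S : set (seq nat)) := forall a b, size a = n -> size b = n ->
  all2 leq a b -> S b -> S a.

(** If the chain never stabilised, each drop would lose some list. Dickson's lemma puts an earlier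
    lost list below a later one; the later one still belongs to the set reached after the earlier
    drop, and down-closure brings the lost list back. *)
Lemma down_closed_chain n (T : nat -> set (seq nat)) :
  (forall m, down_closed n (T m)) -> (forall m, T m.+1 `<=` T m) ->
  exists m0, forall m, (m0 <= m)%N -> forall a, size a = n -> (T m a <-> T m0 a).
Proof.
move=> dT hT; have sub m m' : (m <= m')%N -> T m' `<=` T m.
  move=> /subnK<-; elim: (m' - m)%N => // d IH; rewrite addSn.
  by apply: subset_trans IH; exact: hT.
apply: contrapT => nex.
have h m0 : exists x : nat * seq nat, [/\ (m0 <= x.1)%N, size x.2 = n, T m0 x.2 & ~ T x.1 x.2].
  apply: contrapT => nh; apply: nex; exists m0 => m mm a sa; split; first exact: sub.
  by move=> Ta; apply: contrapT => nT; apply: nh; exists (m, a).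
have [F hF] := choice h.
pose M := fix M i := if i is i'.+1 then (F (M i')).1 else 0%N.
have Mle i j : (i <= j)%N -> (M i <= M j)%N.
  apply: (@homo_leq _ M (fun x y => x <= y)%N leqnn (fun y x z => @leq_trans y x z)).
  by move=> k /=; case: (hF (M k)).
have [i|phi [phi_lt phi_le]] := @dickson n (fun i => (F (M i)).2).
  by case: (hF (M i)).
have [_ s0 _ n0] := hF (M (phi 0%N)); have [_ s1 T1 _] := hF (M (phi 1%N)).
apply: n0; apply: (dT _ _ _ s0 s1 (phi_le 0%N)).
by apply: (sub _ _ _ _ T1); apply: (Mle (phi 0%N).+1); exact: phi_lt.
Qed.

End Dickson.

(** * Counting exponents in down-closed sets *)

Section Exponents.

(** Lists are used so that the first exponent can be split off in inductions on the number of
    variables. *)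
Fixpoint exps (n i : nat) : seq (seq nat) :=
  if n is n'.+1 then flatten [seq [seq m :: a | a <- exps n' (i - m)] | m <- iota 0 i.+1]
  else [:: [::]].

Lemma mem_exps n i a : (a \in exps n i) = (size a == n) && (sumn a <= i)%N.
Proof.
elim: n i a => [|n IH] i a; first by rewrite inE; case: a.
apply/flatten_mapP/andP => [[m]|[]].
  rewrite -[m \in _]/(m \in iota 0 i.+1) mem_iota add0n ltnS /= => mi /mapP[b]; rewrite IH => /andP[/eqP sb hb] ->.
  by rewrite /= sb -leq_subRL.
case: a => //= m a; rewrite eqSS => sa h.
have mi : (m <= i)%N by apply: leq_trans h; exact: leq_addr.
exists m; first by rewrite -[m \in _]/(m \in iota 0 i.+1) mem_iota.
by rewrite map_f // IH sa leq_subRL.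
Qed.

Lemma exps_uniq n i : uniq (exps n i).
Proof.
elim: n i => // n IH i; have -> : exps n.+1 i = flatten [seq [seq m :: a | a <- exps n (i - m)] | m <- iota 0 i.+1] by [].
move: (iota 0 i.+1) (iota_uniq 0 i.+1) => r; elim: r => //= m r IHr /andP[mr ur]; rewrite cat_uniq IHr // andbT.
rewrite map_inj_uniq ?IH //; last by move=> x y [].
apply/hasPn => b /flatten_mapP[m' m'r /mapP[a _ ->]]; apply/negP => /mapP[c _ [em _]].
by rewrite em in m'r; rewrite m'r in mr.
Qed.

Lemma exps_sum (T : nmodType) (G : seq nat -> T) n i : \sum_(a <- exps n.+1 i) G a =
  \sum_(m < i.+1) \sum_(a <- exps n (i - m)%N) G ((m : nat) :: a).
Proof.
have -> : exps n.+1 i = flatten [seq [seq m :: a | a <- exps n (i - m)] | m <- iota 0 i.+1] by [].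
rewrite big_flatten big_map -(big_mkord xpredT (fun m => \sum_(a <- exps n (i - m)%N) G (m :: a))).
by rewrite /index_iota subn0; apply: eq_bigr => m _; rewrite big_map.
Qed.

(** The slices at a fixed first exponent [m] are down-closed and decrease with [m], so they
    stabilise, and the count is a chain sum of the counts of the slices. *)
Lemma rational_count n (S : set (seq nat)) : down_closed n S ->
  rational_seq (fun i => \sum_(a <- exps n i) (`[< S a >] : nat)%:Z).
Proof.
elim: n S => [|n IH] S dS.
  exists 1%N, ((`[< S [::] >] : nat)%:Z)%:P => i.
  rewrite expr1 -['X]expr1 convB1Xn // /= !big_seq1 coefC; case: i => [|i] /=.
    by rewrite subr0.
  by rewrite subrr.
pose T m : set (seq nat) := [set a | S (m :: a)].
have dT m : down_closed n (T m).
  by move=> a b sa sb ab; apply: dS; rewrite /= ?sa ?sb // leqnn.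
(* [down_closed] speaks only of lists of the right length, so the slices are cut to length [n] in
   order to form a decreasing chain. *)
pose T' m : set (seq nat) := [set a | size a = n /\ T m a].
have dT' m : down_closed n (T' m).
  by move=> a b sa sb ab [_ Tb]; split=> //; exact: dT Tb.
have subT' m : T' m.+1 `<=` T' m.
  move=> a [sa Ta]; split=> //; apply: dS Ta; rewrite /= ?sa // leqnSn /=.
  by elim: (a) => //= x s ->; rewrite leqnn.
have [m0 hm0] := down_closed_chain dT' subT'.
apply: rational_seq_ext (@rational_seq_chain
   (fun m i => \sum_(a <- exps n i) (`[< T m a >] : nat)%:Z) m0 (fun m => IH _ (dT m)) _).
  by move=> i; rewrite exps_sum.
move=> m mm i; rewrite !big_seq; apply: eq_bigr => a; rewrite mem_exps => /andP[/eqP sa _].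
congr (Posz (nat_of_bool _)); apply: asbool_equiv_eq.
by have [h1 h2] := hm0 m mm a sa; split=> h; [case: h1|case: h2].
Qed.

End Exponents.

(** * From exponent lists to multinomials *)

Section Monomials.
Variable n : nat.

(** Entries beyond the end of the list read as zero, so that lists of length d <= n give the
    monomials in the first d variables. *)
Definition mnm_of (a : seq nat) : 'X_{1..n} := [multinom nth 0%N a j | j < n].

Definition mons (i : nat) : seq 'X_{1..n} := [seq mnm_of a | a <- exps n i].

Lemma mnm_of_inj : {in [pred a | size a == n] &, injective mnm_of}.
Proof.
move=> a b /eqP sa /eqP sb /mnmP h; apply: (@eq_from_nth _ 0%N); first by rewrite sa.
by move=> i; rewrite sa => ni; have := h (Ordinal ni); rewrite !mnmE.
Qed.

Lemma mdeg_mnm_of a : size a = n -> mdeg (mnm_of a) = sumn a.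
Proof.
move=> sa; rewrite mdegE sumnE (big_nth 0%N) sa big_mkord.
by apply: eq_bigr => i _; rewrite mnmE.
Qed.

Lemma mnm_of_surj (m : 'X_{1..n}) : exists2 a, size a = n & m = mnm_of a.
Proof.
exists [seq m j | j <- enum 'I_n]; first by rewrite size_map size_enum_ord.
apply/mnmP => j; rewrite mnmE (nth_map j) ?size_enum_ord //.
by rewrite nth_ord_enum.
Qed.

Lemma mem_mons i m : (m \in mons i) = (mdeg m <= i)%N.
Proof.
apply/mapP/idP => [[a]|mi].
  by rewrite mem_exps => /andP[/eqP sa ai] ->; rewrite mdeg_mnm_of.
have [a sa em] := mnm_of_surj m; exists a => //.
by rewrite mem_exps sa eqxx -mdeg_mnm_of // -em.
Qed.

Lemma mons_uniq i : uniq (mons i).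
Proof.
rewrite map_inj_in_uniq ?exps_uniq // => a b.
rewrite !mem_exps => /andP[sa _] /andP[sb _]; exact: mnm_of_inj.
Qed.

Lemma mnm_of_le a b : size a = n -> size b = n -> all2 leq a b ->
  (mnm_of a <= mnm_of b)%MM.
Proof.
move=> sa sb ab; apply/forallP => j; rewrite !mnmE.
by elim: a b {sa sb} (nat_of_ord j) ab => [|x a IH] [|y b] [|i] //= /andP[? ?] //; exact: IH.
Qed.

End Monomials.

Lemma Posz_sum I (r : seq I) (F : I -> nat) :
  Posz (\sum_(i <- r) F i)%N = \sum_(i <- r) (F i)%:Z.
Proof. by elim: r => [|i r IH]; rewrite ?big_nil // !big_cons PoszD IH. Qed.

(** * Standard monomials and Hilbert functions over a polynomial ring *)

Section StandardMonomials.
Variables (K : fieldType) (V : lmodType K) (n : nat) (J : finType) (w : J -> nat).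
Variables (v : 'X_{1..n} -> J -> V) (X : 'I_n -> V -> V).
Hypothesis X_linear : forall l, linear (X l).
Hypothesis Xv : forall l a j, X l (v a j) = v (a + U_(l))%MM j.

Let I := ('X_{1..n} * J)%type.
Let wt (x : I) := (mdeg x.1 + w x.2)%N.
(** The weight is compared first, so that the indices of weight at most [i] form an initial segment;
    the monomial order then keeps the key compatible with translation of exponents. *)
Let key (x : I) : (nat *l ('X_{1..n} *l 'I_#|J|))%type := (wt x, (x.1, enum_rank x.2)).

Lemma key_inj : injective key.
Proof. by move=> [a i] [b j] [_ -> /enum_rank_inj ->]. Qed.

Lemma key_shift (u : 'X_{1..n}) (x y : I) :
  (key ((x.1 + u)%MM, x.2) < key ((y.1 + u)%MM, y.2))%O = (key x < key y)%O.
Proof.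
by rewrite !ltxi_pair /= !leEnat /wt /= !mdegD ![(_ + mdeg u + _)%N]addnAC !leq_add2r !lemc_add2l.
Qed.

(* [x] is standard when [v x] is not a combination of smaller vectors; these
   indices are the complement of the leading monomials of the relations *)
Definition standard (x : I) : Prop :=
  ~ lspan [set v y.1 y.2 | y in [set y | (key y < key x)%O]] (v x.1 x.2).

(** [X l] sends an expression of [v c j] by smaller vectors to one of [v (c + U_(l))%MM j], and
    [key_shift] keeps these vectors smaller. So the non-standard exponents are stable under
    multiplication. *)
Lemma standard_down (a b : 'X_{1..n}) j : (a <= b)%MM -> standard (b, j) -> standard (a, j).
Proof.
have step c l : standard ((c + U_(l))%MM, j) -> standard (c, j).
  move=> h h'; apply: h => /=; rewrite -Xv.
  have [m [c' [y [hy ->]]]] := h'; rewrite /=.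
  have X0 : X l 0 = 0.
    by have := X_linear l (-1) 0 0; rewrite scaler0 addr0 scaleN1r addNr.
  rewrite (_ : X l _ = \sum_i c' i *: X l (y i)).
    apply: subspace_sum => [|i _]; first exact: lspan_subspace.
    apply: subspaceZ; first exact: lspan_subspace.
    have [z hz <-] := hy i; rewrite Xv; apply: sub_lspan.
    exists ((z.1 + U_(l))%MM, z.2) => //=.
    by rewrite -[c](erefl ((c, j) : I).1) (@key_shift U_(l)%MM z (c, j)).
  by elim/big_rec2: _ => [|i x1 x2 _ <-]; rewrite ?X0 // X_linear.
move=> ab; rewrite -(submK ab) addmC; move: (b - a)%MM => u.
rewrite [u]multinomUE_id; move: (index_enum 'I_n) => r.
elim: r => [|l r IH]; first by rewrite big_nil addm0.
rewrite big_cons; elim: (u l) => [|d IHd]; first by rewrite mulm0n add0m.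
by rewrite mulmS -addmA [(U_(l) + _)%MM]addmC addmA => /step.
Qed.

Let lst (i : nat) : seq I :=
  [seq (a, j) | j <- [seq j <- enum J | (w j <= i)%N], a <- mons n (i - w j)].

Lemma mem_lst i x : (x \in lst i) = (wt x <= i)%N.
Proof.
apply/allpairsPdep/idP => [[j [a []]]|h].
  rewrite mem_filter mem_enum andbT mem_mons => wj ha ->.
  by rewrite /wt /= addnC -leq_subRL.
have wj : (w x.2 <= i)%N by apply: leq_trans h; exact: leq_addl.
exists x.2, x.1; rewrite mem_filter mem_enum wj mem_mons leq_subRL //.
by rewrite addnC; split=> //; case: x {h wj}.
Qed.

Lemma lst_uniq i : uniq (lst i).
Proof.
apply: allpairs_uniq_dep; first by rewrite filter_uniq ?enum_uniq.
- by move=> j _; exact: mons_uniq.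
- by move=> [j a] [j' a'] _ _ /= [-> ->].
Qed.

Let kgt (x y : I) := (key y < key x)%O.

(** In a decreasing list closed under smaller keys, the tail after an entry consists of all smaller
    indices, so the greedy procedure keeps exactly the standard ones. *)
Lemma greedy_standard (t : seq I) : sorted kgt t ->
  (forall x y, x \in t -> (key y < key x)%O -> y \in t) ->
  size (greedy_basis [seq v x.1 x.2 | x <- t]) = count (fun x => `[< standard x >]) t.
Proof.
have kgt_trans : transitive kgt by move=> x y z h h'; exact: lt_trans h' h.
elim: t => //= x t IH srt dc.
have hx : forall y, (y \in t) = (key y < key x)%O.
  move=> y; apply/idP/idP => [yt|yx].
    by move: srt; rewrite (path_sortedE kgt_trans) => /andP[/allP/(_ y yt)].
  have := dc x y (mem_head _ _) yx; rewrite inE => /orP[/eqP e|//].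
  by rewrite e ltxx in yx.
have h : spanv [seq v x.1 x.2 | x <- t] =
    lspan [set v y.1 y.2 | y in [set y | (key y < key x)%O]].
  rewrite spanv_lspan; congr lspan; apply/seteqP; split=> z /=.
    by move=> /mapP[y yt ->]; exists y; rewrite //= -hx.
  by move=> [y yx <-]; apply/mapP; exists y; rewrite // hx.
have {}IH : size (greedy_basis [seq v x.1 x.2 | x <- t]) = count (fun x => `[< standard x >]) t.
  apply: IH => [|y z]; first exact: path_sorted srt.
  by rewrite !hx => yx zy; exact: lt_trans zy yx.
rewrite h; case: (asboolP (lspan _ _)) => hs.
  by rewrite IH (_ : `[< standard x >] = false) //; apply/asboolP.
by rewrite /= IH (_ : `[< standard x >] = true) //; apply/asboolP.
Qed.

Lemma standard_dim i :
  has_dim (lspan [set y | exists a j, (mdeg a + w j <= i)%N /\ y = v a j])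
    (count (fun x => `[< standard x >]) (lst i)).
Proof.
pose kge (x y : I) := (key y <= key x)%O.
have kge_total : total kge by move=> x y; exact: le_total.
have kgt_trans : transitive kgt by move=> x y z h h'; exact: lt_trans h' h.
have kge_trans : transitive kge by move=> x y z h h'; exact: le_trans h' h.
pose t := sort kge (lst i).
have tl : t =i lst i by move=> x; rewrite mem_sort.
have srt : sorted kgt t.
  have : sorted kge t by exact: sort_sorted.
  have : uniq t by rewrite sort_uniq lst_uniq.
  elim: t {tl} => //= x t IH /andP[xt ut].
  rewrite (path_sortedE kge_trans) (path_sortedE kgt_trans) => /andP[/allP h st].
  rewrite IH // andbT; apply/allP => y yt; rewrite /kgt lt_neqAle.
  rewrite [X in _ && X](h y yt) andbT (inj_eq key_inj).
  by apply: contraNneq xt => <-.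
have -> : count (fun x => `[< standard x >]) (lst i) = count (fun x => `[< standard x >]) t.
  by apply/esym; exact: (permP (permEl (perm_sort _ _))).
rewrite -(greedy_standard srt); last first.
  move=> x y; rewrite !tl !mem_lst => xi.
  by rewrite ltxi_pair leEnat => /andP[/leq_trans + _]; apply.
rewrite (_ : lspan _ = spanv [seq v x.1 x.2 | x <- t]); first exact: greedy_dim.
rewrite spanv_lspan; congr lspan; apply/seteqP; split=> y /=.
  move=> [a [j [h ->]]]; apply/mapP; exists (a, j) => //=.
  by rewrite tl mem_lst.
by move=> /mapP[[a j]]; rewrite tl mem_lst => h ->; exists a, j.
Qed.

(** For fixed [j] the standard exponents form a down-closed set; the weight [w j] only delays its
    counting function. *)
Lemma rational_standard :
  rational_seq (fun i => (count (fun x => `[< standard x >]) (lst i))%:Z).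
Proof.
pose S j : set (seq nat) := [set a | standard (mnm_of n a, j)].
have dS j : down_closed n (S j).
  by move=> a b sa sb ab; apply: standard_down; exact: mnm_of_le.
apply: rational_seq_ext (rational_seq_sum (enum J) (fun j =>
  rational_seq_shift (w j) (rational_count (dS j)))) => i.
rewrite count_flatten -map_comp sumnE big_map big_filter [in RHS]big_mkcond.
rewrite Posz_sum; apply: eq_bigr => j _.
case: leqP => // _; rewrite /= count_map count_map -sum1_count [in RHS]big_mkcond.
rewrite Posz_sum; apply: eq_bigr => a _ /=.
by rewrite /S /=; case: asboolP.
Qed.

Lemma rational_span_dim : exists f : nat -> nat, rational_seq (fun i => (f i)%:Z) /\
  forall i, has_dim (lspan [set y | exists a j, (mdeg a + w j <= i)%N /\ y = v a j]) (f i).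
Proof.
by eexists; split; [exact: rational_standard|move=> i; exact: standard_dim].
Qed.

End StandardMonomials.

Lemma mnm_ind n (P : 'X_{1..n} -> Prop) : P 0%MM ->
  (forall j a, P a -> P (U_(j) + a)%MM) -> forall a, P a.
Proof.
move=> P0 PS a; have [m] := ubnP (mdeg a); elim: m a => // m IH a am.
have [/eqP|] := eqVneq (mdeg a) 0%N; first by rewrite mdeg_eq0 => /eqP->.
rewrite mdegE sum_nat_eq0 negb_forall => /existsP[j]; rewrite /= -lt0n => aj.
have Ua : (U_(j) <= a)%MM by rewrite lep1mP -lt0n.
rewrite -(submK Ua) addmC; apply/PS/IH.
by move: am; rewrite -{1}(submK Ua) mdegD mdeg1 addn1.
Qed.

Section LspanMaps.
Variables (K : fieldType) (V W : lmodType K).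

Lemma linear_zero (f : V -> W) : linear f -> f 0 = 0.
Proof. by move=> lf; have := lf (-1) 0 0; rewrite scaler0 addr0 scaleN1r addNr. Qed.

Lemma subspace_preim (f : V -> W) (U : set W) : linear f -> subspace U ->
  subspace [set x | U (f x)].
Proof.
move=> lf [U0 UD]; split; first by rewrite /= linear_zero.
by move=> c x y Ux Uy; rewrite /= lf; exact: UD.
Qed.

Lemma lspan_map (f : V -> W) (S : set V) (U : set W) : linear f -> subspace U ->
  (forall x, S x -> U (f x)) -> forall x, lspan S x -> U (f x).
Proof. by move=> lf hU h x; exact: (lspan_min (subspace_preim lf hU) h). Qed.

End LspanMaps.

(** * Normal forms of differential operators *)

Section DiffopStructure.
Variables (K : fieldType) (n : nat).
Local Notation D := (diffop K n).
Local Notation P := {mpoly K[n]}.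
Implicit Types (a b m : 'X_{1..n}) (t u v : D) (f g : P).

Lemma eq_divpow (a b : 'I_n -> nat) : a =1 b -> divpow K a = divpow K b.
Proof. by move=> ab; apply: eq_bigr => i _; rewrite ab. Qed.

Lemma mulr_linear t : linear (fun u => t * u).
Proof. by move=> c u v; rewrite mulrDr scalerAr. Qed.

Lemma mulrl_linear t : linear (fun u => u * t).
Proof. by move=> c u v; rewrite mulrDl scalerAl. Qed.

Lemma lspan_mull t (S U : set D) : subspace U -> (forall x, S x -> U (t * x)) ->
  forall x, lspan S x -> U (t * x).
Proof. exact: (lspan_map (mulr_linear t)). Qed.

Lemma lspan_mulr t (S U : set D) : subspace U -> (forall x, S x -> U (x * t)) ->
  forall x, lspan S x -> U (x * t).
Proof. exact: (lspan_map (mulrl_linear t)). Qed.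

Lemma divpowX (b : 'I_n -> nat) m :
  divpow K b 'X_[m] = (\prod_i 'C(m i, b i))%N%:R *: 'X_[m - [multinom b i | i < n]].
Proof.
rewrite /divpow; have -> : [multinom b i | i < n] =
    (\sum_(i <- index_enum 'I_n) U_(i) *+ b i)%MM.
  by apply: (etrans (multinomUE_id _)); apply: eq_bigr => i _; rewrite mnmE.
have := index_enum_uniq 'I_n; move: (index_enum 'I_n) => s.
elim: s => [|i s IH] /=; first by rewrite !big_nil subm0 scale1r /= mul1r.
move=> /andP[ins us]; rewrite !big_cons diffopME IH // diffopZE divdX scalerA -natrM mulnC.
have e : ((\sum_(j <- s) U_(j) *+ b j)%MM : 'X_{1..n}) i = 0%N.
  rewrite mnm_sumE big_seq big1 // => j js; rewrite mulmnE mnm1E.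
  by case: eqP js ins => [-> ->|].
by rewrite mnmBE e subn0 submDA [(_ + _ *+ _)%MM]addmC.
Qed.

(* Both [FL setT] and [FR setT] are the canonical filtration; the exponents of
   the divided powers can be restricted to a box without affecting the
   commutation rules. *)
Definition FL (Q : set 'X_{1..n}) (i : nat) : set D :=
  lspan [set t | exists a b, [/\ Q b, (mdeg a + mdeg b <= i)%N &
     t = mulop 'X_[a] * divpow K b]].
Definition FR (Q : set 'X_{1..n}) (i : nat) : set D :=
  lspan [set t | exists a b, [/\ Q b, (mdeg a + mdeg b <= i)%N &
     t = divpow K b * mulop 'X_[a]]].

Lemma filtFE i : filtF (K := K) i = FL setT i.
Proof.
congr lspan; apply/seteqP; split=> t [a [b]]; first by case=> *; exists a, b.
by case=> *; exists a, b.
Qed.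

Section Box.
Variable Q : set 'X_{1..n}.
Hypothesis Q_down : forall b j, Q b -> Q (b - U_(j))%MM.

Lemma FL_le i j : (i <= j)%N -> FL Q i `<=` FL Q j.
Proof.
move=> ij; apply: lspan_min; first exact: lspan_subspace.
move=> t [a [b [Qb h ->]]]; apply: sub_lspan; exists a, b; split=> //.
exact: leq_trans ij.
Qed.

Lemma FR_le i j : (i <= j)%N -> FR Q i `<=` FR Q j.
Proof.
move=> ij; apply: lspan_min; first exact: lspan_subspace.
move=> t [a [b [Qb h ->]]]; apply: sub_lspan; exists a, b; split=> //.
exact: leq_trans ij.
Qed.

Lemma divpow_mulX b j : divpow K b * mulop 'X_j = mulop 'X_j * divpow K b +
  (0 < b j)%N%:R *: divpow K (b - U_(j))%MM.
Proof.
rewrite mulX_divpow (_ : divpow K (b - U_(j))%MM = divpow K (fun i => b i - (i == j))%N).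
  by rewrite subrK.
by apply: eq_divpow => i; rewrite mnmBE mnm1E eq_sym.
Qed.

Lemma mdeg_subU b j : (0 < b j)%N -> (mdeg (b - U_(j))%MM).+1 = mdeg b.
Proof.
move=> bj; have Ub : (U_(j) <= b)%MM by rewrite lep1mP -lt0n.
by rewrite -[b in RHS](submK Ub) mdegD mdeg1 addn1.
Qed.

Lemma FL_mulXl i j t : FL Q i t -> FL Q i.+1 (mulop 'X_j * t).
Proof.
apply: lspan_mull; first exact: lspan_subspace.
move=> _ [a [b [Qb h ->]]]; apply: sub_lspan; exists (U_(j) + a)%MM, b; split=> //.
  by rewrite mdegD mdeg1 add1n.
by rewrite mpolyXD -mulopM mulrA.
Qed.

Lemma FL_mulXr i j t : FL Q i t -> FL Q i.+1 (t * mulop 'X_j).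
Proof.
apply: lspan_mulr; first exact: lspan_subspace.
move=> _ [a [b [Qb h ->]]]; rewrite -mulrA divpow_mulX mulrDr -scalerAr.
apply: subspaceD; first exact: lspan_subspace.
  apply: sub_lspan; exists (a + U_(j))%MM, b; split=> //.
    by rewrite mdegD mdeg1 addn1.
  by rewrite mpolyXD -mulopM mulrA.
apply: subspaceZ; first exact: lspan_subspace.
apply: sub_lspan; exists a, (b - U_(j))%MM; split=> //; first exact: Q_down.
by rewrite (leq_trans _ (leqW h)) // leq_add2l mdegB.
Qed.

Lemma FR_mulXl i j t : FR Q i t -> FR Q i.+1 (mulop 'X_j * t).
Proof.
apply: lspan_mull; first exact: lspan_subspace.
move=> _ [a [b [Qb h ->]]].
have /(canRL (addrK _)) e := esym (divpow_mulX b j).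
rewrite mulrA e mulrBl -scalerAl; apply: subspaceD; first exact: lspan_subspace.
  apply: sub_lspan; exists (U_(j) + a)%MM, b; split=> //.
    by rewrite mdegD mdeg1 add1n.
  by rewrite mpolyXD -mulopM mulrA.
rewrite -scaleNr; apply: subspaceZ; first exact: lspan_subspace.
apply: sub_lspan; exists a, (b - U_(j))%MM; split=> //; first exact: Q_down.
by rewrite (leq_trans _ (leqW h)) // leq_add2l mdegB.
Qed.

Lemma mulop_monoml (F : nat -> set D) : (forall i j t, F i t -> F i.+1 (mulop 'X_j * t)) ->
  forall a i t, F i t -> F (mdeg a + i)%N (mulop 'X_[a] * t).
Proof.
move=> hF a i t Ft; elim/mnm_ind: a => [|j a IH].
  by rewrite mdeg0 add0n mpolyX0 mulop1 mul1r.
by rewrite mdegD mdeg1 mpolyXD -mulopM -mulrA; exact: hF.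
Qed.

Lemma mulop_monomr (F : nat -> set D) : (forall i j t, F i t -> F i.+1 (t * mulop 'X_j)) ->
  forall a i t, F i t -> F (mdeg a + i)%N (t * mulop 'X_[a]).
Proof.
move=> hF a i t Ft; elim/mnm_ind: a => [|j a IH].
  by rewrite mdeg0 add0n mpolyX0 mulop1 mulr1.
by rewrite mdegD mdeg1 addmC mpolyXD -mulopM mulrA; exact: hF.
Qed.

Lemma FL_divpow b : Q b -> FL Q (mdeg b) (divpow K b).
Proof.
move=> Qb; apply: sub_lspan; exists 0%MM, b; split=> //.
  by rewrite mdeg0.
by rewrite mpolyX0 mulop1 mul1r.
Qed.

Lemma FR_divpow b : Q b -> FR Q (mdeg b) (divpow K b).
Proof.
move=> Qb; apply: sub_lspan; exists 0%MM, b; split=> //.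
  by rewrite mdeg0.
by rewrite mpolyX0 mulop1 mulr1.
Qed.

(** Moving a variable across [divpow K b] creates a term with one entry of [b] lowered: the degree
    does not grow, and [Q] is closed under this, so both normal forms span the same pieces. *)
Lemma FLR i : FL Q i = FR Q i.
Proof.
apply/seteqP; split; (apply: lspan_min; first exact: lspan_subspace);
  move=> _ [a [b [Qb h ->]]].
  apply: (FR_le h); apply: (mulop_monoml FR_mulXl); exact: FR_divpow.
apply: (FL_le h); apply: (mulop_monomr FL_mulXr); exact: FL_divpow.
Qed.

End Box.

Lemma setT_down : forall b j, [set: 'X_{1..n}] b -> [set: 'X_{1..n}] (b - U_(j))%MM.
Proof. by []. Qed.

Lemma filtF_FR i : filtF (K := K) i = FR setT i.
Proof. by rewrite filtFE FLR //; exact: setT_down. Qed.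

Lemma filtF_subspace i : subspace (filtF (K := K) (n := n) i).
Proof. exact: lspan_subspace. Qed.

Lemma filtF_le i j : (i <= j)%N -> filtF (K := K) (n := n) i `<=` filtF j.
Proof. by rewrite !filtFE; exact: FL_le. Qed.

(** The left normal form of [t] and the right normal form of [u] bring the two divided powers
    together, where their product is a multiple of a single divided power. *)
Lemma filtFM i j t u : filtF i t -> filtF j u -> filtF (i + j) (t * u).
Proof.
move=> ht; rewrite filtF_FR; move: u; apply: lspan_mull; first exact: filtF_subspace.
move=> _ [d [c [_ hu ->]]]; move: t ht; rewrite [filtF i]filtFE.
apply: lspan_mulr; first exact: filtF_subspace.
move=> _ [a [b [_ ht ->]]].
have h : filtF (mdeg b + mdeg c) (divpow K b * divpow K c).
  rewrite divpowM; apply: subspaceZ; first exact: filtF_subspace.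
  rewrite filtFE -mdegD (@eq_divpow _ (b + c)%MM) => [|i']; last by rewrite mnmDE.
  exact: FL_divpow.
rewrite filtFE in h.
have h1 := mulop_monoml (@FL_mulXl setT) a h.
have h2 := mulop_monomr (@FL_mulXr setT setT_down) d h1.
rewrite filtFE !mulrA -!mulrA in h2 *; apply: FL_le h2.
by lia.
Qed.

Lemma filtF0_1 : filtF (K := K) (n := n) 0 1.
Proof.
apply: sub_lspan; exists 0%MM, 0%MM; split; first by rewrite mdeg0.
rewrite mpolyX0 mulop1 mul1r; apply/diffopX_ext => m.
rewrite divpowX (_ : [multinom _ | i < n] = 0%MM) ?subm0; last first.
  by apply/mnmP => i; rewrite mnmE.
by rewrite big1 ?scale1r /= ?mul1r // => i _; rewrite mnmE bin0.
Qed.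

Lemma filtF_spanv i : filtF (K := K) (n := n) i =
  spanv [seq mulop 'X_[x.1] * divpow K (x.2 : 'X_{1..n}) | x <- [seq x <- allpairs pair (mons n i) (mons n i) |
     (mdeg x.1 + mdeg x.2 <= i)%N]].
Proof.
rewrite spanv_lspan; congr lspan; apply/seteqP; split=> t /=.
  move=> [a [b [h ->]]]; apply/mapP; exists (a, b) => //; rewrite mem_filter h.
  apply: allpairs_f; rewrite mem_mons; apply: leq_trans h.
    exact: leq_addr.
  exact: leq_addl.
by move=> /mapP[[a b]]; rewrite mem_filter => /andP[h _] ->; exists a, b.
Qed.

Lemma filtF_fin i : fin_dim (filtF (K := K) (n := n) i).
Proof. by rewrite filtF_spanv; exact: fin_dim_spanv. Qed.

(** The polynomials whose commutator with [u] has order less than [j] contain 1 and are closed under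
    linear combinations and products, so testing the variables is enough. *)
Lemma diff_order_comm j (u : P -> P) : linear u ->
  (forall l, diff_order_lt j (comm_mul 'X_l u)) -> diff_order_lt j.+1 u.
Proof.
move=> lu hX g.
have hD c g1 g2 : diff_order_lt j (comm_mul g1 u) -> diff_order_lt j (comm_mul g2 u) ->
    diff_order_lt j (comm_mul (c *: g1 + g2) u).
  move=> h1 h2; apply: dol_ext (dolD (dolZ c h1) h2) => f.
  rewrite /comm_mul mulrDl -scalerAl scalerBr [(_ + _) * f]mulrDl -scalerAl.
  by rewrite lu opprD addrACA.
have hM g1 g2 : diff_order_lt j (comm_mul g1 u) -> diff_order_lt j (comm_mul g2 u) ->
    diff_order_lt j (comm_mul (g1 * g2) u).
  move=> h1 h2; apply: dol_ext (dolD (dolM g1 h2) (dolMr g2 h1)) => f.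
  by rewrite /comm_mul mulrBr !mulrA addrA subrK.
have h1 : diff_order_lt j (comm_mul 1 u).
  by apply: dol_ext (dol0 _ _ _) => f; rewrite /comm_mul !mul1r subrr.
elim/mpolyind: g => [|c m g _ _ IHg].
  by apply: dol_ext (dol0 _ _ _) => f; rewrite /comm_mul !mul0r lin0 // subrr.
apply: hD => //; elim/mnm_ind: m {IHg} => [|l a IH]; first by rewrite mpolyX0.
by rewrite mpolyXD; exact: hM.
Qed.

Lemma divpow_order b : diff_order_lt (mdeg b).+1 (divpow K b).
Proof.
elim: {b}_.+1 {-2}b (ltnSn (mdeg b)) => // m IH b bm.
apply: diff_order_comm => [|l]; first exact: diffop_linear.
have e f : comm_mul 'X_l (divpow K b) f = (- (0 < b l)%N%:R) *: divpow K (b - U_(l))%MM f.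
  have := congr1 (fun t : D => t f) (divpow_mulX b l); rewrite /= => e.
  by rewrite /comm_mul e opprD addrA subrr add0r scaleNr.
apply: (dol_ext (fun f => esym (e f))).
case: (posnP (b l)) => [_|bl]; first by apply: dol_ext (dol0 _ _ _) => f; rewrite oppr0 scale0r.
apply: dolZ; rewrite -(mdeg_subU bl); apply: IH.
by rewrite -ltnS (leq_trans _ bm) // ltnS (mdeg_subU bl).
Qed.

(** By induction the commutators with the variables vanish, so [u] commutes with every variable and
    is determined by its value at 1, which is zero. *)
Lemma diff_order_ext0 j (u : P -> P) : linear u -> diff_order_lt j u ->
  (forall a, (mdeg a < j)%N -> u 'X_[a] = 0) -> forall f, u f = 0.
Proof.
elim: j u => // j IH u lu du h.
have hc l : forall f, comm_mul 'X_l u f = 0.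
  apply: IH; [exact: comm_mul_linear|exact: du|] => a aj.
  rewrite /comm_mul h ?(leq_trans aj) // mulr0 -mpolyXD h ?subrr //.
  by rewrite mdegD mdeg1 add1n.
apply: (linear_funX_ext lu) => [c f g|m]; first by rewrite scaler0 addr0.
elim/mnm_ind: m => [|l a IHa]; first by rewrite h // mdeg0.
have := hc l 'X_[a]; rewrite /comm_mul IHa mulr0 -mpolyXD sub0r => /eqP.
by rewrite oppr_eq0 => /eqP.
Qed.

Lemma divpow_small a b : (mdeg a <= mdeg b)%N -> divpow K b 'X_[a] = (a == b)%:R.
Proof.
move=> ab; rewrite divpowX; case: eqP => [->|nab].
  rewrite big1 => [|i _]; last by rewrite binn.
  rewrite scale1r (_ : (_ - _)%MM = 0%MM) ?mpolyX0 //.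
  by apply/mnmP => i; rewrite mnmBE !mnmE subnn.
have [i ai] : exists i, (a i < b i)%N.
  apply: contrapT => h; apply: nab; have le i : (b i <= a i)%N.
    by rewrite leqNgt; apply/negP => ?; apply: h; exists i.
  have ba : (b <= a)%MM by apply/forallP => i; exact: le.
  have : mdeg (a - b)%MM = 0%N.
    by move: ab; rewrite -{1}(submK ba) mdegD; lia.
  by move/eqP; rewrite mdeg_eq0 => /eqP e; rewrite -(submK ba) e add0m.
by rewrite (bigD1 i) //= bin_small // mul0n scale0r.
Qed.

(** Operators are defined by commutators, so that the x^a d^[b] span them needs proof: [t] is
    matched degree by degree on the monomials below its order bound, after which [diff_order_ext0]
    kills the remainder. *)
Lemma filtF_exhaust t : exists i, filtF i t.
Proof.
pose F : set D := [set t | exists i, filtF i t].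
have F_sub : subspace F.
  split; first by exists 0%N; exact: (proj1 (filtF_subspace 0)).
  move=> c x y [i hx] [j hy]; exists (i + j)%N; apply: (proj2 (filtF_subspace _)).
    by apply: filtF_le hx; exact: leq_addr.
  by apply: filtF_le hy; exact: leq_addl.
have F_mul g b : F (mulop g * divpow K b).
  elim/mpolyind: g => [|c m g _ _ IH].
    have -> : mulop (0 : P) = 0 by apply: diffop_eq => f; rewrite /= mul0r.
    by rewrite mul0r; exact: (proj1 F_sub).
  rewrite mulopD mulopZ mulrDl -scalerAl; apply: (proj2 F_sub) => //.
  by exists (mdeg m + mdeg b)%N; apply: sub_lspan; exists m, b.
have [_ [j dt]] := diffop_subproof t.
have h l : (l <= j)%N -> exists v, [/\ F v, diff_order_lt j (t - v) &
    forall a, (mdeg a < l)%N -> (t - v) 'X_[a] = 0].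
  elim: l => [|l IH] lj.
    by exists 0; split=> //; [exact: (proj1 F_sub)|rewrite subr0].
  have [v [Fv dv hv]] := IH (ltnW lj).
  (* Among monomials of degree at most [mdeg b], the operator [divpow K b] detects ['X_[b]] alone.
     Its coefficient is thus the value of the remainder there, and lower degrees stay untouched. *)
  pose s : D := \sum_(b <- mons n l | mdeg b == l) mulop ((t - v) 'X_[b]) * divpow K b.
  have sE f : s f = \sum_(b <- mons n l | mdeg b == l) (t - v) 'X_[b] * divpow K b f.
    rewrite /s; elim: (mons n l) => [|b r IHr]; first by rewrite !big_nil.
    by rewrite !big_cons; case: ifP => _; rewrite -?IHr.
  exists (v + s); split.
  - apply: subspaceD => //; apply: subspace_sum => // b _; exact: F_mul.
  - apply: (@dol_ext _ _ _ (fun f => (t - v) f + (-1) *: s f)).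
      by move=> f; rewrite /= !scaleN1r opprD addrA.
    apply: dolD => //; apply: dolZ; apply: (dol_ext (fun f => esym (sE f))).
    elim: (mons n l) => [|b r IHr].
      by apply: dol_ext (dol0 _ _ _) => f; rewrite big_nil.
    have [/eqP bl|bl] := boolP (mdeg b == l); last first.
      by apply: dol_ext IHr => f; rewrite big_cons (negPf bl).
    apply: (@dol_ext _ _ _ (fun f => (t - v) 'X_[b] * divpow K b f +
       \sum_(b <- r | mdeg b == l) (t - v) 'X_[b] * divpow K b f)).
      by move=> f; rewrite big_cons bl eqxx.
    apply: dolD => //; apply: dolM; apply: dolW (divpow_order b).
      exact: diffop_linear.
    by rewrite bl.
  - move=> a al; rewrite [LHS](_ : _ = (t - v) 'X_[a] - s 'X_[a]); last first.
      by rewrite /= !scaleN1r opprD addrA.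
    rewrite sE; have [alt|] := ltnP (mdeg a) l.
      rewrite hv // big1 ?subrr // => b /eqP bl.
      rewrite divpow_small ?bl 1?ltnW //; case: eqP => [e|]; last by rewrite mulr0.
      by rewrite e bl ltnn in alt.
    move=> la; have ea : mdeg a = l by apply/eqP; rewrite eqn_leq la -ltnS al.
    rewrite big_mkcond (bigD1_seq a) ?mons_uniq ?mem_mons ?ea //= eqxx.
    rewrite divpow_small // eqxx mulr1 big1 ?addr0 ?subrr // => b ba.
    case: eqP => // bl; rewrite divpow_small ?bl ?ea //.
    by rewrite eq_sym (negPf ba) mulr0.
have [v [Fv dv hv]] := h j (leqnn j).
suff -> : t = v by [].
apply/eqP; rewrite -subr_eq0; apply/eqP; apply: diffop_eq => f.
by rewrite (diff_order_ext0 (diffop_linear _) dv).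
Qed.

End DiffopStructure.

(** * Freeness of D over T_k, with filtrations *)

Section TkDecomposition.
Variables (K : fieldType) (n p : nat) (hp : p \in [pchar K]) (k : nat).
Local Notation D := (diffop K n).
Local Notation P := {mpoly K[n]}.
Local Notation q := (p ^ k)%N.
Implicit Types (a b m : 'X_{1..n}) (t u v : D) (f g : P).

Lemma q_gt0 : (0 < q)%N.
Proof. by rewrite expn_gt0 prime_gt0 // (pcharf_prime hp). Qed.

(** This is (1 + X)^(a+q) = (1 + X)^a (1 + X^q) in characteristic [p]: Vandermonde's sum keeps only
    its end terms, since [p] divides C(q, j) for 0 < j < q. *)
Lemma natr_bin_addq (a i : nat) : ('C(a + q, i))%:R =
  ('C(a, i))%:R + (if (q <= i)%N then ('C(a, i - q))%:R else 0) :> K.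
Proof.
rewrite addnC -binomial.Vandermonde natr_sum.
have h j : (0 < j < q)%N -> ('C(q, j))%:R = 0 :> K.
  move=> /andP[j0 jq]; apply/eqP; rewrite -(dvdn_pcharf hp).
  rewrite -{1}(subnKC (ltnW jq)); apply: (@dvdn_bin_carry p k) => //.
  - exact: pcharf_prime hp.
  - by rewrite ltn_subrL j0 q_gt0.
  - by rewrite subnKC // ltnW.
rewrite big_ord_recl /= bin0 mul1n subn0; congr (_ + _).
case: leqP => qi.
  have qi' : (q.-1 < i)%N by rewrite prednK ?q_gt0.
  rewrite (bigD1 (Ordinal qi')) //= /bump add1n prednK ?q_gt0 // binn mul1n.
  rewrite big1 ?addr0 // => j; rewrite -val_eqE /= => jq.
  rewrite natrM; have [jlt|jge] := ltnP j.+1 q; first by rewrite h ?mul0r.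
  rewrite bin_small ?mul0r // ltn_neqAle jge andbT.
  by apply: contraNneq jq => e; rewrite e.
rewrite big1 // => j _; rewrite /bump add1n natrM h ?mul0r //=.
exact: leq_ltn_trans (ltn_ord j) qi.
Qed.

Lemma divd_mulXq (i j : 'I_n) c : mulop ('X_j ^+ q) * divd K i c =
  divd K i c * mulop ('X_j ^+ q) - ((i == j) && (q <= c)%N)%:R *: divd K i (c - q).
Proof.
apply/eqP; rewrite eq_sym subr_eq; apply/eqP; apply: diffopX_ext => m.
rewrite diffopME [LHS]/= mpolyXn -mpolyXD divd_funX.
rewrite [RHS]/= !divd_funX -scalerAr -mpolyXD.
rewrite mnmDE mulmnE mnm1E.
have [->|nij] := eqVneq j i; last first.
  rewrite /= mul0n add0n scale0r addr0; congr (_ *: 'X_[_]).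
  apply/mnmP => l; rewrite !(mnmDE, mnmBE, mulmnE, mnm1E).
  case: (eqVneq i l) => [<-|_]; last by rewrite mul0n !subn0.
  by rewrite (negPf nij) mul0n !add0n.
rewrite /= mul1n addnC natr_bin_addq scalerDl; congr (_ + _).
  have [lt|le] := ltnP (m i) c; first by rewrite bin_small // !scale0r.
  congr (_ *: 'X_[_]); apply/mnmP => l; rewrite !(mnmDE, mnmBE, mulmnE, mnm1E).
  by case: (eqVneq i l) => [<-|_]; lia.
case: leqP => qc; last by rewrite !scale0r.
rewrite scale1r; congr (_ *: 'X_[_]); apply/mnmP => l.
rewrite !(mnmDE, mnmBE, mulmnE, mnm1E).
by case: (eqVneq i l) => [<-|_]; lia.
Qed.

Lemma divpow_mulXq (b : 'I_n -> nat) j : divpow K b * mulop ('X_j ^+ q) =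
  mulop ('X_j ^+ q) * divpow K b +
  (q <= b j)%N%:R *: divpow K (fun i => b i - (if i == j then q else 0))%N.
Proof.
apply/eqP; rewrite -subr_eq eq_sym; apply/eqP.
rewrite /divpow.
have: uniq (index_enum 'I_n) := index_enum_uniq _.
have: j \in index_enum 'I_n := mem_index_enum j.
set s := index_enum _; move: s => s js us.
suff: mulop ('X_j ^+ q) * \prod_(i <- s) divd K i (b i) =
   \prod_(i <- s) divd K i (b i) * mulop ('X_j ^+ q) -
   ((j \in s) && (q <= b j)%N)%:R *: \prod_(i <- s) divd K i (b i - (if i == j then q else 0)).
  by rewrite js.
elim: s us {js} => [|i s IH] /=.
  by rewrite !big_nil mulr1 mul1r scale0r subr0.
case/andP=> nis us; rewrite !big_cons mulrA divd_mulXq mulrBl -!mulrA IH //.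
rewrite mulrBr in_cons [j == i]eq_sym.
case: (eqVneq i j) => [eij|nij] /=; last first.
  by rewrite scale0r mul0r subr0 subn0 -scalerAr.
rewrite -eij (negPf nis) /= scale0r mulr0 subr0; congr (_ - _).
rewrite -scalerAl; congr (_ *: (_ * _)).
rewrite !big_seq; apply: eq_bigr => l ls.
by case: (eqVneq l i) => [eli|]; [rewrite -eli ls in nis|rewrite subn0].
Qed.

Definition box : set 'X_{1..n} := [set b | forall i, (b i < q)%N].

Lemma box_down b j : box b -> box (b - U_(j))%MM.
Proof. by move=> hb i; rewrite mnmBE (leq_ltn_trans (leq_subr _ _)). Qed.

Lemma inT_subspace : subspace [set t : D | inT p k t].
Proof. by split; [exact: inT0|move=> c x y; exact: inTD]. Qed.

Lemma FR_inT i t : FR box i t -> inT p k t.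
Proof.
apply: (lspan_min inT_subspace) => _ [a [b [hb _ ->]]].
by apply: inT_mulr; apply: inT_divpow.
Qed.

Lemma inT_commXq t j : inT p k t -> t * mulop ('X_j ^+ q) = mulop ('X_j ^+ q) * t.
Proof.
move=> [f ->]; rewrite mulr_suml mulr_sumr; apply: eq_bigr => b _.
rewrite -mulrA mulopM mulrC -mulopM mulrA divpow_mulXq.
by rewrite leqNgt ltn_ord /= scale0r addr0 mulrA.
Qed.

Definition dq m : D := divpow K (fun i => q * m i)%N.

Lemma dq0 : dq 0%MM = 1.
Proof.
apply/diffopX_ext => m; rewrite divpowX (_ : [multinom _ | i < n] = 0%MM) ?subm0; last first.
  by apply/mnmP => i; rewrite !mnmE muln0.
by rewrite big1 ?scale1r /= ?mul1r // => i _; rewrite mnmE muln0 bin0.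
Qed.

Lemma filtF_dq m : filtF (q * mdeg m) (dq m).
Proof.
rewrite filtFE mulnC -mdegMn (_ : dq m = divpow K (m *+ q)%MM).
  exact: FL_divpow.
by apply: eq_divpow => i; rewrite mulmnE mulnC.
Qed.

(** Adding [q] to the upper index does not change C(-, r) modulo [p] when r < q, which reduces the
    claim to c = 0. Hence [dq] times a box divided power carries no coefficient. *)
Lemma natr_binq c r : (r < q)%N -> ('C(q * c + r, q * c))%:R = 1 :> K.
Proof.
move=> rq; rewrite -[in X in 'C(_, X)](addnK r (q * c)%N) bin_sub ?leq_addl //.
elim: c => [|c IH]; first by rewrite muln0 binn.
by rewrite mulnS -addnA addnC natr_bin_addq leqNgt rq /= addr0.
Qed.

Lemma dq_divpow m b : box b -> dq m * divpow K b = divpow K (fun i => q * m i + b i)%N.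
Proof.
move=> hb; rewrite divpowM natr_prod big1 ?scale1r // => i _.
by rewrite natr_binq.
Qed.

Lemma dq_comm m t j : inT p k t ->
  dq m * t * mulop ('X_j ^+ q) - mulop ('X_j ^+ q) * (dq m * t) =
  (if (0 < m j)%N then dq (m - U_(j))%MM * t else 0).
Proof.
move=> ht; rewrite -mulrA inT_commXq // !mulrA -mulrBl divpow_mulXq addrAC subrr add0r.
case: (posnP (m j)) => [->|mj].
  by rewrite muln0 leqNgt q_gt0 /= scale0r mul0r.
rewrite leq_pmulr // scale1r; congr (_ * _); apply: eq_divpow => i.
rewrite mnmBE mnm1E eq_sym mulnBr; case: (j == i) => //=; first by rewrite muln1.
by rewrite muln0.
Qed.

(* The commutator with [X_j ^+ q] shifts the coefficients, so a relation of
   degree [N.+1] yields relations of degree [N]. *)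
Lemma dq_indep N (t : 'X_{1..n} -> D) : (forall m, inT p k (t m)) ->
  \sum_(m <- mons n N) dq m * t m = 0 -> forall m, (mdeg m <= N)%N -> t m = 0.
Proof.
elim: N t => [|N IH] t ht e m mN; last first.
  have t0 m' : (mdeg m' <= N.+1)%N -> m' != 0%MM -> t m' = 0.
    move=> m'N; rewrite -mdeg_eq0 mdegE sum_nat_eq0 negb_forall => /existsP[j].
    rewrite /= -lt0n => mj.
    have Um : (U_(j) <= m')%MM by rewrite lep1mP -lt0n.
    rewrite -(submK Um); apply: (IH (fun m => t (m + U_(j))%MM)) => //; last first.
      by rewrite -ltnS mdeg_subU.
    have e' : \sum_(m <- mons n N.+1) (dq m * t m * mulop ('X_j ^+ q) -
       mulop ('X_j ^+ q) * (dq m * t m)) = 0.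
      by rewrite sumrB -mulr_suml -mulr_sumr e mul0r mulr0 subr0.
    rewrite -[RHS]e'; under [RHS]eq_bigr => c _ do rewrite (dq_comm c j (ht c)).
    rewrite -big_mkcond -[RHS]big_filter.
    have pe : perm_eq [seq c : 'X_{1..n} <- mons n N.+1 | (0 < c j)%N]
        [seq (c + U_(j))%MM | c <- mons n N].
      apply: uniq_perm.
      - by rewrite filter_uniq ?mons_uniq.
      - by rewrite map_inj_uniq ?mons_uniq //; move=> c d /(congr1 (fun x : 'X_{1..n} => (x - U_(j))%MM)); rewrite !addmK.
      move=> c; rewrite mem_filter mem_mons; apply/andP/mapP => [[cj cN]|[d]].
        exists (c - U_(j))%MM; first by rewrite mem_mons -ltnS mdeg_subU.
        by rewrite submK // lep1mP -lt0n.
      rewrite mem_mons => dN ->; rewrite mnmDE mnm1E eqxx addn1; split=> //.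
      by rewrite mdegD mdeg1 addn1.
    rewrite (perm_big _ pe) [RHS]big_map /=; apply: eq_bigr => c _.
    by rewrite addmK.
  have [->|] := eqVneq m 0%MM; last exact: t0.
  move: e; rewrite (bigD1_seq 0%MM) ?mons_uniq ?mem_mons ?mdeg0 //= dq0 mul1r.
  rewrite big_seq_cond big1 ?addr0 // => c; rewrite mem_mons => /andP[cN c0].
  by rewrite t0 // mulr0.
move: mN; rewrite leqn0 mdeg_eq0 => /eqP->.
move: e; rewrite (bigD1_seq 0%MM) ?mons_uniq ?mem_mons ?mdeg0 //= dq0 mul1r.
rewrite big_seq_cond big1 ?addr0 // => c; rewrite mem_mons leqn0 mdeg_eq0.
by case: eqP.
Qed.

(* [t] lists the coefficients of [u] in [D = \bigoplus_m dq m T_k] *)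
Definition decomp u (t : 'X_{1..n} -> D) := exists N,
  [/\ forall m, inT p k (t m), forall m, (N < mdeg m)%N -> t m = 0 &
      u = \sum_(m <- mons n N) dq m * t m].

Lemma mons_widen (V : nmodType) (G : 'X_{1..n} -> V) N N' : (N <= N')%N ->
  (forall m, (N < mdeg m)%N -> G m = 0) ->
  \sum_(m <- mons n N') G m = \sum_(m <- mons n N) G m.
Proof.
move=> NN G0; rewrite (bigID (fun m => mdeg m <= N)%N) /=.
rewrite [X in _ + X]big1 ?addr0 => [|m]; last by rewrite -ltnNge; exact: G0.
rewrite -big_filter; apply: perm_big; apply: uniq_perm.
- by rewrite filter_uniq ?mons_uniq.
- exact: mons_uniq.
- move=> m; rewrite mem_filter !mem_mons; apply/andP/idP => [[]//|h].
  by rewrite h (leq_trans h).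
Qed.

Lemma decomp_unique u (t t' : 'X_{1..n} -> D) : decomp u t -> decomp u t' -> t =1 t'.
Proof.
move=> [N [ht tN e]] [N' [ht' tN' e']] m.
have hN : u = \sum_(m <- mons n (N + N' + mdeg m)) dq m * t m.
  rewrite [LHS]e; apply/esym/mons_widen; first by rewrite -addnA leq_addr.
  by move=> c /tN->; rewrite mulr0.
have hN' : u = \sum_(m <- mons n (N + N' + mdeg m)) dq m * t' m.
  rewrite [LHS]e'; apply/esym/mons_widen; first by rewrite addnAC leq_addl.
  by move=> c /tN'->; rewrite mulr0.
apply/eqP; rewrite -subr_eq0; apply/eqP.
apply: (@dq_indep (N + N' + mdeg m) (fun m => t m - t' m)); last exact: leq_addl.
  by move=> c; rewrite addrC -scaleN1r; exact: inTD.
under eq_bigr do rewrite mulrBr; by rewrite sumrB -hN -hN' subrr.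
Qed.

(** Division of the exponents by [q] with remainder splits each divided power into some [dq c] and a
    box divided power; the degrees add up exactly, so the splitting respects the filtration. *)
Lemma decomp_FR i u : filtF i u -> exists t : 'X_{1..n} -> D,
  [/\ forall m, FR box (i - q * mdeg m) (t m),
      forall m, (i < q * mdeg m)%N -> t m = 0 &
      u = \sum_(m <- mons n (i %/ q)) dq m * t m].
Proof.
rewrite filtF_FR.
pose U : set D := [set u | exists t : 'X_{1..n} -> D,
  [/\ forall m, FR box (i - q * mdeg m) (t m),
      forall m, (i < q * mdeg m)%N -> t m = 0 &
      u = \sum_(m <- mons n (i %/ q)) dq m * t m]].
have U_sub : subspace U.
  split.
    exists (fun=> 0); split=> // [m|]; first exact: (proj1 (lspan_subspace _)).
    by rewrite big1 // => m _; rewrite mulr0.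
  move=> c x y [t [t1 t2 ->]] [s [s1 s2 ->]]; exists (fun m => c *: t m + s m); split=> [m|m|].
  - by apply: (proj2 (lspan_subspace _)); [exact: t1|exact: s1].
  - by move=> h; rewrite t2 // s2 // scaler0 addr0.
  - rewrite scaler_sumr -big_split; apply: eq_bigr => m _ /=.
    by rewrite mulrDr -scalerAr.
apply: (lspan_min U_sub) => _ [a [b [_ h ->]]].
pose c : 'X_{1..n} := [multinom (b j %/ q)%N | j < n].
pose r : 'X_{1..n} := [multinom (b j %% q)%N | j < n].
have hr : box r by move=> j; rewrite mnmE ltn_mod q_gt0.
have eb : (b = c *+ q + r)%MM.
  by apply/mnmP => j; rewrite mnmDE mulmnE !mnmE -divn_eq.
have db : mdeg b = (q * mdeg c + mdeg r)%N by rewrite {1}eb mdegD mdegMn mulnC.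
have ci : (q * mdeg c <= i)%N by lia.
exists (fun m => if m == c then divpow K r * mulop 'X_[a] else 0); split=> [m|m|].
- case: eqP => [->|_]; last exact: (proj1 (lspan_subspace _)).
  apply: sub_lspan; exists a, r; split=> //; lia.
- by case: eqP => // -> ; rewrite ltnNge ci.
rewrite (bigD1_seq c) ?mons_uniq ?mem_mons //=; last by rewrite leq_divRL ?q_gt0 // mulnC.
rewrite eqxx big1 ?addr0 => [|m /negPf->]; last by rewrite mulr0.
rewrite mulrA dq_divpow //; congr (_ * _); apply: eq_divpow => j.
by rewrite eb mnmDE mulmnE mulnC.
Qed.

Lemma decomp_ex u : exists t : 'X_{1..n} -> D, decomp u t.
Proof.
have [i /decomp_FR[t [t1 t2 ->]]] := filtF_exhaust u.
exists t, (i %/ q)%N; split=> // m; first exact: FR_inT (t1 m).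
by rewrite ltn_divLR ?q_gt0 // mulnC; exact: t2.
Qed.

(** The choice is harmless by [decomp_unique]; additivity and right linearity over T_k then follow
    by exhibiting decompositions. *)
Definition coefD u : 'X_{1..n} -> D := projT1 (cid (decomp_ex u)).

Lemma coefDP u : decomp u (coefD u).
Proof. by rewrite /coefD; case: cid. Qed.

Lemma inT_coefD u m : inT p k (coefD u m).
Proof. by have [N [h _ _]] := coefDP u. Qed.

Lemma coefDE u (t : 'X_{1..n} -> D) : decomp u t -> coefD u =1 t.
Proof. exact: decomp_unique (coefDP u). Qed.

Lemma coefD_add u v m : coefD (u + v) m = coefD u m + coefD v m.
Proof.
have [N [h1 h2 h3]] := coefDP u; have [N' [h1' h2' h3']] := coefDP v.
apply: (coefDE (t := fun m => coefD u m + coefD v m)).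
exists (N + N')%N; split=> [c|c hc|].
- by have := inTD 1 (h1 c) (h1' c); rewrite scale1r.
- by rewrite h2 ?h2' ?addr0 //; apply: leq_ltn_trans hc; rewrite ?leq_addl ?leq_addr.
under eq_bigr do rewrite mulrDr.
rewrite big_split /= {1}h3 {1}h3'; congr (_ + _); apply/esym/mons_widen;
  rewrite ?leq_addl ?leq_addr // => c hc.
- by rewrite h2 // mulr0.
- by rewrite h2' // mulr0.
Qed.

Lemma coefD_mulT u t m : inT p k t -> coefD (u * t) m = coefD u m * t.
Proof.
move=> ht; have [N [h1 h2 h3]] := coefDP u.
apply: (coefDE (t := fun m => coefD u m * t)); exists N; split=> [c|c hc|].
- exact: inTM.
- by rewrite h2 // mul0r.
by rewrite {1}h3 mulr_suml; apply: eq_bigr => c _; rewrite mulrA.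
Qed.

Lemma coefD_dq c t m : inT p k t -> coefD (dq c * t) m = if m == c then t else 0.
Proof.
move=> ht; apply: (coefDE (t := fun m => if m == c then t else 0)).
exists (mdeg c); split=> [d|d|].
- by case: ifP => _ //; exact: inT0.
- by case: eqP => // ->; rewrite ltnn.
rewrite (bigD1_seq c) ?mons_uniq ?mem_mons //= eqxx big1 ?addr0 // => d /negPf->.
by rewrite mulr0.
Qed.

(** An element of T_k is its own coefficient at exponent zero, as [dq0] shows, and [decomp_FR]
    places that coefficient in the box part of the same degree. *)
Lemma inT_filtF_FR i t : inT p k t -> filtF i t -> FR box i t.
Proof.
move=> ht /decomp_FR[s [s1 s2 e]].
have -> : t = s 0%MM.
  have := coefD_dq 0%MM 0%MM ht; rewrite eqxx dq0 mul1r => h; rewrite -[LHS]h.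
  apply: (coefDE (t := s)); exists (i %/ q)%N; split=> // m; first exact: FR_inT (s1 m).
  by rewrite ltn_divLR ?q_gt0 // mulnC; exact: s2.
by have := s1 0%MM; rewrite mdeg0 muln0 subn0.
Qed.

Lemma FR_box_filtF i t : FR box i t -> filtF i t.
Proof.
rewrite filtF_FR; apply: lspan_min; first exact: lspan_subspace.
by move=> _ [a [b [_ h ->]]]; apply: sub_lspan; exists a, b.
Qed.

(** In degree less than [q] no divided power can leave the box, because every entry of [b] is at
    most [mdeg b]. *)
Lemma filtF_inT i t : (i < q)%N -> filtF i t -> inT p k t.
Proof.
move=> iq; rewrite filtF_FR; apply: (lspan_min inT_subspace).
move=> _ [a [b [_ h ->]]]; apply: inT_mulr; apply: inT_divpow => j.
apply: leq_ltn_trans iq; apply: leq_trans h; apply: leq_trans (leq_addl _ _).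
by rewrite mdegE (bigD1 j) //= leq_addr.
Qed.

End TkDecomposition.

(** * Filtered algebras and generating subspaces *)

Section ActSet.
Variables (K : fieldType) (A : algType K) (M : lmodType A).
Implicit Types (S : set A) (U W : set M).

Definition ksubspace (U : set M) := subspace (U : set (restr M)).

Lemma restrZ (c : K) (x : M) : (c *: (x : restr M) : restr M) = (c%:A *: x : M).
Proof. by []. Qed.

Lemma scale_linear (a : A) : linear (fun x : restr M => (a *: (x : M) : restr M)).
Proof.
move=> c x y; rewrite !restrZ.
have h (z1 z2 : M) : a *: (z1 + z2) = a *: z1 + a *: z2 by rewrite scalerDr.
by rewrite [LHS]h !scalerA -scalerAl mul1r -scalerAr mulr1.
Qed.

Lemma scalel_linear (x : M) : linear (fun a : A => (a *: x : restr M)).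
Proof. by move=> c a b; rewrite restrZ scalerDl scalerA -scalerAl mul1r. Qed.

Lemma act_set_min S U W : ksubspace W -> (forall s u, S s -> U u -> W (s *: u)) ->
  act_set S U `<=` W.
Proof.
move=> hW h x [m [s [u [su ->]]]]; apply: (subspace_sum _ hW) => j _.
by have [? ?] := su j; exact: h.
Qed.

Lemma act_set_mem S U s u : S s -> U u -> act_set S U (s *: u).
Proof. by move=> Ss Uu; exists 1%N, (fun=> s), (fun=> u); rewrite big_ord1. Qed.

Lemma act_set_ksubspace S U : subspace S -> ksubspace (act_set S U).
Proof.
move=> hS; split; first by exists 0%N, (fun=> 0), (fun=> 0); split; [case|rewrite big_ord0].
move=> c _ _ [m1 [s1 [u1 [h1 ->]]]] [m2 [s2 [u2 [h2 ->]]]].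
exists (m1 + m2)%N,
  (fun j => match split j with inl j => c *: s1 j | inr j => s2 j end),
  (fun j => match split j with inl j => u1 j | inr j => u2 j end); split.
  move=> j; case: (split j) => i; last exact: h2.
  by have [? ?] := h1 i; split=> //; exact: subspaceZ.
rewrite big_split_ord /= restrZ scaler_sumr; congr (_ + _); apply: eq_bigr => j _.
  by rewrite (unsplitK (inl j : 'I_m1 + 'I_m2)) scalerA -scalerAl mul1r.
by rewrite (unsplitK (inr j : 'I_m1 + 'I_m2)).
Qed.

Lemma act_setS S S' U U' : S `<=` S' -> U `<=` U' -> act_set S U `<=` act_set S' U'.
Proof.
move=> SS UU x [m [s [u [su ->]]]]; exists m, s, u; split=> // j.
by have [? ?] := su j; split; [exact: SS|exact: UU].
Qed.

Lemma act_set_act S S' S'' U : subspace S'' -> (forall s s', S s -> S' s' -> S'' (s * s')) ->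
  act_set S (act_set S' U) `<=` act_set S'' U.
Proof.
move=> hS h; apply: act_set_min; first exact: act_set_ksubspace.
move=> s _ Ss [m [s' [u [su ->]]]]; rewrite scaler_sumr.
apply: (subspace_sum _ (act_set_ksubspace U hS)) => j _; rewrite scalerA.
by have [? ?] := su j; apply: act_set_mem => //; exact: h.
Qed.

Lemma act_set_fin S U : fin_dim S -> fin_dim_sub U -> fin_dim_sub (act_set S U).
Proof.
move=> hS hU; have Ss := fin_dim_subspace hS.
have [m /has_dim_spanv[a [_ eS]]] := hS.
have [r /has_dim_spanv[b [_ eU]]] := hU.
pose L := [seq (x *: (y : M) : restr M) | x <- a, y <- b].
apply: (@fin_dim_subset _ (restr M) _ (spanv L)).
- exact: fin_dim_spanv.
- exact: act_set_ksubspace.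
apply: act_set_min; first exact: spanv_subspace.
move=> s u; rewrite eS spanv_lspan => hs hu; move: hu.
rewrite -[U u]/((U : set (restr M)) u) eU spanv_lspan => hu.
apply: (lspan_map (scalel_linear u) (spanv_subspace L) _ hs) => x xa.
apply: (lspan_map (scale_linear x) (spanv_subspace L) _ hu) => y yb.
by apply: spanv_mem; apply: allpairs_f.
Qed.

End ActSet.

Lemma pow_set_subspace (K : fieldType) (A : algType K) (W : set A) i :
  subspace W -> subspace (pow_set W i).
Proof.
move=> hW; case: i => [|i] /=.
  split; first by exists 0; rewrite ?scale0r.
  by move=> d _ _ [x _ <-] [y _ <-]; exists (d * x + y); rewrite // scalerDl scalerA.
have [h0 hD] := @act_set_ksubspace K A A^o _ (pow_set W i) hW.
split=> // d x y hx hy; rewrite -[d *: x]mulr_algl; exact: hD.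
Qed.

Section FilteredAlgebra.
Variables (K : fieldType) (A : algType K) (F : nat -> set A).
Hypothesis F_fin : forall i, fin_dim (F i).
Hypothesis F_le : forall i j, (i <= j)%N -> F i `<=` F j.
Hypothesis F_mul : forall i j s t, F i s -> F j t -> F (i + j) (s * t).
Hypothesis F_ex : forall t, exists i, F i t.
Hypothesis F1 : F 0%N 1.

Let F_sub i : subspace (F i).
Proof. exact: fin_dim_subspace. Qed.

Lemma fin_dim_filtered (W : set A) : fin_dim W -> exists a, W `<=` F a.
Proof.
move=> [m /has_dim_spanv[s [_ ->]]].
have [a ha] : exists a, forall x, x \in s -> F a x.
  elim: s => [|x s [a IH]]; first by exists 0%N.
  have [b hb] := F_ex x; exists (a + b)%N => y; rewrite inE => /orP[/eqP->|/IH].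
    by apply: F_le hb; exact: leq_addl.
  by apply: F_le; exact: leq_addr.
by exists a; apply: spanv_min.
Qed.

Lemma pow_set_filtered (W : set A) a i : W `<=` F a -> pow_set W i `<=` F (a * i).
Proof.
move=> WF; elim: i => [|i IH].
  move=> _ [c _ <-]; rewrite muln0; apply: subspaceZ; [exact: F_sub|exact: F1].
move=> x [m [s [u [su ->]]]]; rewrite mulnS; apply: subspace_sum => // j _.
by have [/WF ? /IH ?] := su j; exact: F_mul.
Qed.

Variable M : lmodType A.

Lemma act_filtered_fin (M0 : set M) i : fin_dim_sub M0 -> fin_dim_sub (act_set (F i) M0).
Proof. exact: act_set_fin. Qed.

Lemma fin_dim_sub_filtered (U M0 : set M) : fin_dim_sub U -> fd_generating M0 ->
  exists a, U `<=` act_set (F a) M0.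
Proof.
move=> [m /has_dim_spanv[s [_ es]]] [_ gen].
have h i j : (i <= j)%N -> act_set (F i) M0 `<=` act_set (F j) M0.
  by move=> ij; apply: act_setS => //; exact: F_le.
have sub i : ksubspace (act_set (F i) M0) by exact: act_set_ksubspace.
have [a ha] : exists a, forall x, x \in s -> act_set (F a) M0 x.
  elim: s {es} => [|x s [a IH]]; first by exists 0%N.
  have [b hb] : exists b, act_set (F b) M0 x.
    have : act_set setT M0 x by rewrite gen.
    move=> [r [c [u [cu ->]]]].
    have hc j : exists i, F i (c j) by exact: F_ex.
    have [d hd] := choice hc; exists (\max_j d j)%N.
    apply: (subspace_sum _ (sub _)) => j _; apply: act_set_mem; last by case: (cu j).
    by apply: F_le (hd j); exact: (leq_bigmax j).
  exists (a + b)%N => y; rewrite inE => /orP[/eqP->|/IH].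
    by apply: h hb; exact: leq_addl.
  by apply: h; exact: leq_addr.
exists a => x Ux; have : (U : set (restr M)) x by [].
by rewrite es; apply: (spanv_min (sub a)).
Qed.

(** Once [M0] lies in F_a M1, multiplicativity of the filtration puts F_i M0 inside F_(i+a) M1. *)
Lemma fd_generating_compare (M0 M1 : set M) : fd_generating M0 -> fd_generating M1 ->
  exists a, forall i, (dim_sub (act_set (F i) M0) <= dim_sub (act_set (F (i + a)) M1))%N.
Proof.
move=> g0 g1; have [a ha] := fin_dim_sub_filtered (proj1 g0) g1.
exists a => i; apply: dimK_le; first last.
- by apply: act_filtered_fin; case: g1.
- by apply: act_filtered_fin; case: g0.
apply: (subset_trans (act_setS (fun s h => h) ha)).
by apply: act_set_act => // s s' hs hs'; exact: F_mul.
Qed.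

Lemma fd_generating_compare2 (M0 M1 : set M) : fd_generating M0 -> fd_generating M1 ->
  exists a, (forall i, (dim_sub (act_set (F i) M0) <= dim_sub (act_set (F (i + a)) M1))%N) /\
    forall i, (dim_sub (act_set (F i) M1) <= dim_sub (act_set (F (i + a)) M0))%N.
Proof.
move=> g0 g1; have [a ha] := fd_generating_compare g0 g1.
have [b hb] := fd_generating_compare g1 g0.
have mono (N : set M) i j : fd_generating N -> (i <= j)%N ->
    (dim_sub (act_set (F i) N) <= dim_sub (act_set (F j) N))%N.
  move=> [fN _] ij; apply: dimK_le; [|exact: act_filtered_fin|exact: act_filtered_fin].
  by apply: act_setS => //; exact: F_le.
exists (a + b)%N; split=> i.
  by apply: (leq_trans (ha i)); apply: mono => //; rewrite leq_add2l leq_addr.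
by apply: (leq_trans (hb i)); apply: mono => //; rewrite leq_add2l leq_addl.
Qed.

Lemma act_set_base (M0 : set M) i : M0 `<=` act_set (F i) M0.
Proof.
move=> x Mx; rewrite -[x]scale1r; apply: act_set_mem => //.
by apply: F_le F1.
Qed.

(** Since 1 lies in the filtration, dimension zero would make [M0] zero, and with it the module that
    it generates. *)
Lemma dim_sub_gt0 (M0 : set M) i : fd_generating M0 -> (exists x : M, x != 0) ->
  (0 < dim_sub (act_set (F i) M0))%N.
Proof.
move=> [fM gen] [x x0]; have hd := fin_dimP (act_filtered_fin i fM).
rewrite lt0n; apply/eqP => e.
have hd' : has_dim (act_set (F i) M0 : set (restr M)) 0 by rewrite -e.
have z y : act_set (F i) M0 y -> y = 0.
  by move=> hy; have [b [_ /(_ y)[/(_ hy)[c ->] _]]] := hd'; rewrite big_ord0.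
have : act_set setT M0 x by rewrite gen.
move=> [m [c [u [cu ex]]]]; move: x0; rewrite ex big1 ?eqxx // => j _.
have [_ uj] := cu j; rewrite (z (u j)) ?scaler0 //.
exact: act_set_base.
Qed.

Lemma fin_generated_fd : fin_generated M -> exists M0 : set M, fd_generating M0.
Proof.
move=> [m [g hg]]; pose s : seq (restr M) := [seq (g j : restr M) | j <- enum 'I_m].
exists (spanv s : set M); split; first exact: fin_dim_spanv.
apply/seteqP; split=> // x _; have [a ->] := hg x.
exists m, a, g; split=> // j; split=> //; apply: spanv_mem.
by rewrite map_f ?mem_enum.
Qed.

End FilteredAlgebra.

(** * The Hilbert function of a T_k-module *)

Section TkFacts.
Variables (K : fieldType) (n p : nat) (hp : p \in [pchar K]) (k : nat).
Local Notation D := (diffop K n).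
Local Notation T := (Tk n hp k).
Local Notation q := (p ^ k)%N.
Local Notation FT := (@filtT K n p hp k).
Implicit Types (a b m : 'X_{1..n}) (t u : D) (s : T).

Lemma Tk_valD (s s' : T) : Tk_val (s + s') = Tk_val s + Tk_val s'.
Proof. exact: (raddfD (\val : T -> D)). Qed.
Lemma Tk_val0 : Tk_val (0 : T) = 0.
Proof. exact: (raddf0 (\val : T -> D)). Qed.
Lemma Tk_valM (s s' : T) : Tk_val (s * s') = Tk_val s * Tk_val s'.
Proof. exact: (rmorphM (\val : T -> D)). Qed.
Lemma Tk_val1 : Tk_val (1 : T) = 1.
Proof. exact: (rmorph1 (\val : T -> D)). Qed.
Lemma Tk_valZ c s : Tk_val (c *: s) = c *: Tk_val s.
Proof. exact: (linearZZ (\val : T -> D)). Qed.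
Lemma Tk_val_linear : linear (@Tk_val K n p hp k).
Proof. by move=> c x y; rewrite Tk_valD Tk_valZ. Qed.
Lemma Tk_val_inj : injective (@Tk_val K n p hp k).
Proof. exact: val_inj. Qed.
Lemma inT_Tk_val s : inT p k (Tk_val s).
Proof. by case: s => t /= /asboolP. Qed.

Definition toTk (t : D) : T := insubd (0 : T) t.

Lemma toTkK t : inT p k t -> Tk_val (toTk t) = t.
Proof. by move=> ht; apply: (@insubdK _ _ T); apply/asboolP. Qed.

Lemma filtTE i s : FT i s = filtF i (Tk_val s).
Proof. by []. Qed.

Lemma filtT_subspace i : subspace (FT i).
Proof. exact: (subspace_preim Tk_val_linear (@filtF_subspace K n i)). Qed.

Lemma filtT_span i : FT i =
  lspan [set s | exists a b, [/\ box p k b, (mdeg a + mdeg b <= i)%N &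
     s = toTk (mulop 'X_[a] * divpow K b)]].
Proof.
apply/seteqP; split=> s; last first.
  move: s; apply: lspan_min; first exact: filtT_subspace.
  move=> _ [a [b [hb h ->]]]; rewrite filtTE toTkK; last first.
    by apply: inT_mull => //; exact: inT_divpow.
  by rewrite filtFE; apply: sub_lspan; exists a, b.
move=> hs; have := inT_filtF_FR hp (inT_Tk_val s) hs.
rewrite -FLR; last exact: box_down.
move=> [m [c [w [hw e]]]]; exists m, c, (fun j => toTk (w j)); split.
  by move=> j; have [a [b [hb h ->]]] := hw j; exists a, b.
apply: Tk_val_inj; rewrite e.
elim/big_rec2: _ => [|j y1 y2 _ ->]; first by rewrite Tk_val0.
rewrite Tk_valD Tk_valZ toTkK //; have [a [b [hb h ->]]] := hw j.
by apply: inT_mull => //; exact: inT_divpow.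
Qed.

Lemma filtT_fin i : fin_dim (FT i).
Proof.
pose L := [seq toTk (mulop 'X_[x.1] * divpow K (x.2 : 'X_{1..n})) | x <- allpairs pair (mons n i) (mons n i)].
apply: (fin_dim_subset (fin_dim_spanv L) (filtT_subspace i)).
rewrite filtT_span; apply: lspan_min; first exact: spanv_subspace.
move=> _ [a [b [hb h ->]]]; apply: spanv_mem; apply/mapP; exists (a, b) => //.
by apply: allpairs_f; rewrite mem_mons; apply: leq_trans h; rewrite ?leq_addl ?leq_addr.
Qed.

Lemma filtT_le i j : (i <= j)%N -> FT i `<=` FT j.
Proof. by move=> ij s; exact: filtF_le. Qed.

Lemma filtTM i j (s s' : T) : FT i s -> FT j s' -> FT (i + j) (s * s').
Proof. by move=> hs hs'; rewrite filtTE Tk_valM; exact: filtFM. Qed.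

Lemma filtT_exhaust s : exists i, FT i s.
Proof. by have [i hi] := filtF_exhaust (Tk_val s); exists i. Qed.

Lemma filtT0_1 : FT 0 (1 : T).
Proof. by rewrite filtTE Tk_val1; exact: filtF0_1. Qed.

(** The Gelfand-Kirillov dimension is computed from powers of a subspace, so its lower bound needs
    one subspace whose powers dominate the filtration. *)
Lemma filtT_pow : exists W : set T, [/\ fin_dim W, W 1 &
  forall i, FT i `<=` pow_set W i].
Proof.
(* [n * q] bounds the degree of a box divided power and 1 is the degree of a variable, so [W]
   contains all the letters from which elements are spelled. *)
pose c := (1 + n * q)%N; pose W := FT c.
have W1 : W 1 by apply: filtT_le filtT0_1.
exists W; split=> //; first exact: filtT_fin.
have pow_sub i : subspace (pow_set W i) by apply: pow_set_subspace; exact: filtT_subspace.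
have powS i s s' : W s -> pow_set W i s' -> pow_set W i.+1 (s * s').
  by move=> ? ?; exact: (@act_set_mem _ _ T^o).
have pow_le i j s : (i <= j)%N -> pow_set W i s -> pow_set W j s.
  move=> /subnK<-; elim: (j - i)%N => // d IH hs; rewrite addSn -[s]mul1r.
  by apply: powS => //; exact: IH.
have qle b : box p k b -> (mdeg b <= n * q)%N.
  move=> hb; rewrite mdegE -[n in X in (_ <= X)%N]card_ord -sum_nat_const.
  by apply: leq_sum => j _; exact: ltnW.
move=> i; rewrite filtT_span; apply: lspan_min; first exact: pow_sub.
move=> _ [a [b [hb h ->]]]; apply: (pow_le _ _ _ h).
have hX d : inT p k (mulop 'X_[d] : D).
  by rewrite -[mulop _]mulr1; apply: inT_mull => //; exact: inT1.
have hB : inT p k (divpow K b) by exact: inT_divpow.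
have -> : toTk (mulop 'X_[a] * divpow K b) = toTk (mulop 'X_[a]) * toTk (divpow K b).
  by apply: Tk_val_inj; rewrite Tk_valM !toTkK //; exact: inT_mull.
elim/mnm_ind: a {h} => [|j a IH].
  rewrite mdeg0 add0n (_ : toTk (mulop 'X_[0%MM]) = 1) ?mul1r; last first.
    by apply: Tk_val_inj; rewrite toTkK // Tk_val1 mpolyX0.
  have [b0|] := posnP (mdeg b).
    rewrite b0; exists 1 => //; rewrite scale1r; apply: Tk_val_inj.
    rewrite Tk_val1 toTkK //; move/eqP: b0; rewrite mdeg_eq0 => /eqP->.
    rewrite -[LHS](dq0 K n p k); apply: eq_divpow => j; by rewrite mnmE muln0.
  (* A nontrivial divided power counts as a single letter. Its degree is at least 1, so the word is
     no longer than the degree, and [pow_le] pads it with 1. *)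
  case eb : (mdeg b) => [//|d] _; rewrite -[toTk _]mulr1; apply: powS.
    rewrite /W filtTE toTkK //; apply: (@filtF_le _ _ (mdeg b)).
      by rewrite /c addnC; apply: leq_trans (qle b hb) (leq_addr _ _).
    by rewrite filtFE; exact: FL_divpow.
  apply: (pow_le 0%N) => //; exists 1 => //; by rewrite scale1r.
rewrite mdegD mdeg1 -addnA add1n.
rewrite (_ : toTk _ = toTk (mulop 'X_[U_(j)]) * toTk (mulop 'X_[a])); last first.
  by apply: Tk_val_inj; rewrite Tk_valM !toTkK // mulopM mpolyXD.
rewrite -mulrA; apply: powS => //; rewrite /W filtTE toTkK //.
apply: (@filtF_le _ _ 1); first exact: leq_addr.
rewrite filtFE; apply: sub_lspan; exists U_(j)%MM, 0%MM; split=> //.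
  by rewrite mdeg1 mdeg0.
rewrite -[LHS]mulr1 -(dq0 K n p k); congr (_ * _); apply: eq_divpow => l.
by rewrite mnmE muln0.
Qed.

Section Hilbert.
Variable M' : lmodType T.

(** The vectors x^a d^[b] g_j, with [b] in the box and [g] a basis of [M0'], span the filtration.
    Multiplication by variables acts on [a] alone, so this is a filtered module over the polynomial
    ring with finitely many generators, of weight |b|. *)
Lemma hilbT_rational (M0' : set M') : fin_dim_sub M0' ->
  rational_seq (fun i => (hilbT M0' i)%:Z).
Proof.
move=> [r [g [_ hg]]].
have hX d : inT p k (mulop 'X_[d] : D).
  by rewrite -[mulop _]mulr1; apply: inT_mull => //; exact: inT1.
have hX' (l : 'I_n) : inT p k (mulop 'X_l : D) by exact: hX.
pose J : finType := ({ffun 'I_n -> 'I_q} * 'I_r)%type.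
pose bx (f : {ffun 'I_n -> 'I_q}) : 'X_{1..n} := [multinom (f i : nat) | i < n].
have hbx f : box p k (bx f) by move=> i; rewrite mnmE.
pose v (a : 'X_{1..n}) (j : J) : restr M' :=
  toTk (mulop 'X_[a]) *: (toTk (divpow K (bx j.1)) *: (g j.2 : M')).
pose X (l : 'I_n) (x : restr M') : restr M' := toTk (mulop 'X_l) *: (x : M').
have X_lin l : linear (X l) by exact: scale_linear.
have Xv l a j : X l (v a j) = v (a + U_(l))%MM j.
  have e : toTk (mulop 'X_l) * toTk (mulop 'X_[a]) = toTk (mulop 'X_[a + U_(l)]).
    by apply: Tk_val_inj; rewrite Tk_valM !toTkK // mulopM addmC mpolyXD.
  by rewrite /X /v [LHS]scalerA e.
have [f [rf hf]] := @rational_span_dim K (restr M') n J (fun j => mdeg (bx j.1)) v X X_lin Xv.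
apply: rational_seq_ext rf => i; congr Posz; apply/esym.
rewrite /hilbT /dim_sub; apply: has_dimP.
rewrite (_ : act_set _ _ = lspan [set y | exists a j, (mdeg a + mdeg (bx j.1) <= i)%N /\ y = v a j]) //.
have gM j : M0' (g j) by exact: has_dim_mem hg j.
apply/seteqP; split.
  apply: act_set_min; first exact: lspan_subspace.
  move=> s u; rewrite filtT_span => hs /hg[c ->].
  apply: (lspan_map (scalel_linear _) (lspan_subspace _) _ hs) => _ [a [b [hb h ->]]].
  pose f0 := [ffun j => Ordinal (hb j)].
  have eb : bx f0 = b by apply/mnmP => j; rewrite mnmE ffunE.
  have e0 : toTk (mulop 'X_[a]) * toTk (divpow K b) = toTk (mulop 'X_[a] * divpow K b).
    by apply: Tk_val_inj; rewrite Tk_valM !toTkK //; [apply: inT_mull => //|..]; exact: inT_divpow.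
  have -> : (toTk (mulop 'X_[a] * divpow K b) *: (\sum_j c j *: g j : M') : restr M') =
      \sum_j c j *: (v a (f0, j)).
    have L := scale_linear (M := M') (toTk (mulop 'X_[a] * divpow K b)).
    elim/big_rec2: _ => [|j y1 y2 _ <-]; first exact: (linear_zero L).
    rewrite [LHS]L; congr (_ *: _ + _); rewrite /v /= eb [RHS]scalerA e0 //.
  apply: subspace_sum => [|j _]; first exact: lspan_subspace.
  apply: subspaceZ; first exact: lspan_subspace.
  by apply: sub_lspan; exists a, (f0, j); rewrite /= eb.
apply: (lspan_min (act_set_ksubspace M0' (filtT_subspace i))).
move=> _ [a [[f0 j] [h ->]]]; rewrite /v /= [X in act_set _ _ X]scalerA.
apply: act_set_mem => //; rewrite filtTE Tk_valM !toTkK //; last by apply: inT_divpow; exact: hbx.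
by rewrite filtFE; apply: sub_lspan; exists a, (bx f0).
Qed.

Hypothesis M'_neq0 : exists x : M', x != 0.

Lemma hilbT_gt0 (M0' : set M') i : fd_generating M0' -> (0 < hilbT M0' i)%N.
Proof.
move=> gen; apply: (dim_sub_gt0 filtT_fin filtT_le filtT0_1) => //.
Qed.

Lemma hilbT_normal (M0' : set M') : fd_generating M0' ->
  exists d (B : {poly int}), conv ((1 - 'X) ^+ d.+1) (fun i => (hilbT M0' i)%:Z) =1
    (fun i => B`_i) /\ B.[1] != 0.
Proof.
move=> gen; have [N [A hA]] := hilbT_rational (proj1 gen).
apply: conv_normalize hA => -[i0 h]; have := h i0 (leqnn _).
by case: (hilbT M0' i0) (hilbT_gt0 i0 gen).
Qed.

End Hilbert.
End TkFacts.

(** * Period, leading coefficient and sign *)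

Section QuasiPolynomialOfSeries.
Variables (q n d : nat) (g : nat -> nat) (A : {poly int}).
Hypothesis q_gt0 : (0 < q)%N.
Hypothesis hg : conv ((1 - 'X) ^+ d.+1 * (1 - 'X^q) ^+ n) (fun i => (g i)%:Z) =1 (fun i => A`_i).
Hypothesis A1 : A.[1] != 0.

Let B := A * geom_poly q ^+ d.+1.

(** Since [1 - 'X^q] is [1 - 'X] times [geom_poly q], the factor [geom_poly q ^+ d.+1] in the
    numerator turns the whole denominator into a power of [1 - 'X^q]. *)
Lemma conv_common_denominator :
  conv ((1 - 'X^q) ^+ (n + d).+1) (fun i => (g i)%:Z) =1 (fun i => B`_i).
Proof.
move=> i; rewrite /B mulrC -conv_coef -(eq_conv _ hg) -convM; congr (conv _ _ i).
by rewrite -addnS exprD [in RHS]mulrA -exprMn [geom_poly q * _]mulrC -geom_polyE mulrC.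
Qed.

(** One of the [d.+1] factors [geom_poly q] equalises the residue sums; the remaining [d] are
    evaluated at 1 and give q^d. *)
Lemma residue_sum_numerator s : (s < q)%N -> residue_sum q s B = A.[1] * (q ^ d)%N%:Z.
Proof.
move=> sq; rewrite /B exprSr mulrA residue_sum_geom // hornerM horner_exp geom_poly1.
by rewrite -[Posz (q ^ d)%N]natz natrX natz.
Qed.

Lemma residue_sum_numerator_neq0 s : (s < q)%N -> residue_sum q s B != 0.
Proof.
move=> sq; rewrite residue_sum_numerator // mulf_neq0 //.
by rewrite -lt0n expn_gt0 q_gt0.
Qed.

Lemma quasi_comp_lead_series s : (s < q)%N ->
  size (quasi_comp q (n + d) B s) = (n + d).+1 /\
  lead_coef (quasi_comp q (n + d) B s) = A.[1]%:~R / (q ^ n * (n + d)`!)%N%:R.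
Proof.
move=> sq; have [-> ->] := quasi_comp_lead q_gt0 (n + d) residue_sum_numerator_neq0 sq.
split=> //; rewrite residue_sum_numerator // intrM -pmulrn expnD [(q ^ n * q ^ d)%N]mulnC -mulnA.
rewrite [in LHS]natrM invfM mulrA mulfK // pnatr_eq0 -lt0n expn_gt0 q_gt0 //.
Qed.

Lemma almost_poly_series : exists P : nat -> {poly rat},
  [/\ almost_poly_of q g P,
      coefs_from q P [set z%:~R / (q ^ (n + d) * (n + d)`!)%N%:R | z in [set: int]]
    & forall s, (s < q)%N -> size (P s) = (n + d).+1 /\
        lead_coef (P s) = A.[1]%:~R / (q ^ n * (n + d)`!)%N%:R].
Proof.
exists (quasi_comp q (n + d) B); split; last exact: quasi_comp_lead_series.
- split; first split=> //.
    exists (size B) => // i /= hi; exact: quasi_compE conv_common_denominator hi.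
  move=> s t sq tq; have [-> ->] := quasi_comp_lead_series sq.
  by have [-> ->] := quasi_comp_lead_series tq.
- by move=> s sq j; rewrite quasi_comp_coef; eexists.
Qed.

Lemma asym_series (R : realType) :
  asym (fun i => (g i)%:R : R) (n + d) (A.[1]%:~R / (q ^ n * (n + d)`!)%N%:R).
Proof.
have <- : ratr (A.[1]%:~R / (q ^ n * (n + d)`!)%N%:R) =
    A.[1]%:~R / (q ^ n * (n + d)`!)%N%:R :> R.
  by rewrite rmorphM /= fmorphV /= ratr_int ratr_nat.
apply: (@asym_quasi _ _ q _ (quasi_comp q (n + d) B) _ (size B)) => //.
  exact: quasi_comp_lead_series.
by move=> i hi; exact: quasi_compE conv_common_denominator hi.
Qed.

(** A nonnegative counting function has a nonnegative leading coefficient, and this coefficient has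
    the sign of [A.[1]]. *)
Lemma series_numerator_gt0 (R : realType) : 0 < A.[1].
Proof.
rewrite lt0r A1 /=; have := asym_ge (asym_series R) (fun i => ler0n _ _).
rewrite pmulr_lge0 ?ler0z // invr_gt0 ltr0n muln_gt0 expn_gt0 q_gt0 fact_gt0 //.
Qed.

End QuasiPolynomialOfSeries.

(** * Gelfand-Kirillov dimension and multiplicity of M' *)

Section GelfandKirillov.
Variables (R : realType) (K : fieldType) (n p : nat) (hp : p \in [pchar K]) (k : nat).
Local Notation T := (Tk n hp k).
Local Notation FT := (@filtT K n p hp k).
Variable M' : lmodType T.
Hypothesis M'_neq0 : exists x : M', x != 0.

Section Series.
Variables (M0' : set M') (d : nat) (B : {poly int}).
Hypothesis gen : fd_generating M0'.
Hypothesis hB : conv ((1 - 'X) ^+ d.+1) (fun i => (hilbT M0' i)%:Z) =1 (fun i => B`_i).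
Hypothesis B1 : B.[1] != 0.

(** A trivial factor puts the series of [M'] in the shape treated above, with period 1, so that the
    quasi-polynomial is a polynomial. *)
Let hB' : conv ((1 - 'X) ^+ d.+1 * (1 - 'X^1) ^+ 0) (fun i => (hilbT M0' i)%:Z) =1 (fun i => B`_i).
Proof. by move=> i; rewrite expr0 mulr1 hB. Qed.

Lemma hilbT_asym : asym (fun i => (hilbT M0' i)%:R : R) d (`|B.[1]|%N%:R / d`!%:R).
Proof.
have := asym_series (ltn0Sn 0) hB' B1 R; rewrite add0n expn0 mul1n.
have := series_numerator_gt0 (ltn0Sn 0) hB' B1 R.
by case: (B.[1]) => // e _; rewrite absz_nat.
Qed.

Lemma hilbT_asym_gt0 : 0 < `|B.[1]|%N%:R / d`!%:R :> R.
Proof. by rewrite divr_gt0 // ltr0n ?fact_gt0 // lt0n absz_eq0. Qed.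

Lemma hilbT_poly : exists h : {poly rat},
  [/\ \forall i \near \oo, (hilbT M0' i)%:R = h.[i%:R],
      size h = d.+1 & lead_coef h = `|B.[1]|%N%:R / (d`!)%:R].
Proof.
have [P [[[_ [i0 _ hP]] _] _ /(_ 0%N isT)[sz ld]]] := almost_poly_series (ltn0Sn 0) hB' B1.
exists (P 0%N); split=> //.
  by exists i0 => // i /= hi; rewrite hP // modn1.
rewrite ld add0n expn0 mul1n; have := series_numerator_gt0 (ltn0Sn 0) hB' B1 R.
by case: (B.[1]) => // e _; rewrite absz_nat.
Qed.

(** Upper bound: any [W] and [U] lie in pieces of the filtrations, so the powers grow at most like
    [hilbT] at a linear argument. Lower bound: the subspace given by [filtT_pow] dominates the
    filtration. *)
Lemma GKdimE : GKdim R M' = (d%:R)%:E.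
Proof.
have Fex := @filtT_exhaust K n p hp k.
apply/eqP; rewrite eq_le; apply/andP; split.
  apply: ge_ereal_sup => _ [W [U [fW W1 fU ->]]].
  have [a ha] := fin_dim_filtered (@filtT_fin _ _ _ hp k) (@filtT_le _ _ _ hp k) Fex fW.
  have [b hb] := fin_dim_sub_filtered (@filtT_fin _ _ _ hp k) (@filtT_le _ _ _ hp k) Fex fU gen.
  have [c [i0 [c0 hc]]] := asym_upper hilbT_asym.
  (* [a.+1] in place of [a] keeps the argument of [hilbT] at least [i], hence past the threshold
     [i0]. *)
  have le i : (dim_sub (act_set (pow_set W i) U) <= hilbT M0' (a.+1 * i + b))%N.
    have fin : fin_dim_sub (act_set (FT (a.+1 * i + b)) M0').
      by apply: act_set_fin; [exact: filtT_fin|case: gen].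
    have ha' : W `<=` FT a.+1 by apply: subset_trans ha _; exact: filtT_le.
    have hpow := pow_set_filtered (@filtT_fin _ _ _ hp k) (@filtTM _ _ _ hp k) (@filtT0_1 _ _ _ hp k) (i := i) ha'.
    have sub : act_set (pow_set W i) U `<=` act_set (FT (a.+1 * i + b)) M0'.
      apply: (subset_trans (act_setS hpow hb)).
      apply: act_set_act; first exact: filtT_subspace.
      by move=> s s'; exact: filtTM.
    apply: dimK_le => //; apply: (fin_dim_subset fin _ sub).
    by apply: act_set_ksubspace; apply: pow_set_subspace; exact: fin_dim_subspace.
  (* For i >= 1 the argument is at most (a + 1 + b) i, which gives the constant. *)
  apply: (@growth_le R _ d (c * (a.+1 + b)%:R ^+ d) (maxn 1 i0)) => i.
  rewrite geq_max => /andP[i1 hi].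
  apply: (@le_trans _ _ (hilbT M0' (a.+1 * i + b))%:R); first by rewrite ler_nat.
  apply: (le_trans (hc _ _)).
    by apply: (leq_trans hi); rewrite mulSn -addnA leq_addr.
  rewrite -mulrA (ler_wpM2l (ltW c0)) // -exprMn -natrM lerXn2r ?nnegrE // ler_nat.
  by rewrite mulnDl leq_add2l leq_pmulr.
have [W [fW W1 hW]] := @filtT_pow K n p hp k.
have fM : fin_dim_sub M0' by case: gen.
apply: (@le_trans _ _ (growth R (fun i => dim_sub (act_set (pow_set W i) M0')))); last first.
  by apply: ereal_sup_ubound; exists W, M0'.
have [c [i0 [c0 hc]]] := asym_lower hilbT_asym hilbT_asym_gt0.
apply: (growth_ge c0 (i0 := i0)) => i hi; apply: (le_trans (hc i hi)).
rewrite ler_nat; apply: dimK_le; first exact: act_setS.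
  by apply: act_set_fin => //; exact: filtT_fin.
have [a ha] := fin_dim_filtered (@filtT_fin _ _ _ hp k) (@filtT_le _ _ _ hp k) Fex fW.
have hpow := pow_set_filtered (@filtT_fin _ _ _ hp k) (@filtTM _ _ _ hp k) (@filtT0_1 _ _ _ hp k) (i := i) ha.
apply: act_set_fin => //; apply: (fin_dim_subset (@filtT_fin _ _ _ hp k _) _ hpow).
by apply: pow_set_subspace; exact: fin_dim_subspace.
Qed.

End Series.

(** Interleaving gives both Hilbert functions the same leading term, and a normalised series
    determines this term as |B(1)| / d! in degree [d]. *)
Lemma hilbT_series_unique (M0 M1 : set M') d d' (B B' : {poly int}) :
  fd_generating M0 -> fd_generating M1 ->
  conv ((1 - 'X) ^+ d.+1) (fun i => (hilbT M0 i)%:Z) =1 (fun i => B`_i) -> B.[1] != 0 ->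
  conv ((1 - 'X) ^+ d'.+1) (fun i => (hilbT M1 i)%:Z) =1 (fun i => B'`_i) -> B'.[1] != 0 ->
  d = d' /\ `|B.[1]|%N = `|B'.[1]|%N.
Proof.
move=> g0 g1 hB B1 hB' B1'.
have [a [h1 h2]] := fd_generating_compare2 (@filtT_fin _ _ _ hp k) (@filtT_le _ _ _ hp k)
  (@filtTM _ _ _ hp k) (@filtT_exhaust _ _ _ hp k) g0 g1.
have as1 := hilbT_asym hB B1; have as2 := hilbT_asym hB' B1'.
have as3 : asym (fun i => (hilbT M1 i)%:R : R) d (`|B.[1]|%N%:R / d`!%:R).
  by apply: (asym_sandwich (a := a) as1) => i; rewrite ler_nat; [exact: h2|exact: h1].
have [ed el] := asym_unique as3 as2 (hilbT_asym_gt0 _ B1) (hilbT_asym_gt0 _ B1').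
split=> //; move: el; rewrite ed => /divIf h; apply/eqP.
by rewrite -(eqr_nat R); apply/eqP/h; rewrite pnatr_eq0 -lt0n fact_gt0.
Qed.

Lemma has_GK_multP (M0' : set M') d (B : {poly int}) : fd_generating M0' ->
  conv ((1 - 'X) ^+ d.+1) (fun i => (hilbT M0' i)%:Z) =1 (fun i => B`_i) -> B.[1] != 0 ->
  has_GK_mult R M' d `|B.[1]|%N.
Proof.
move=> gen hB B1; split; first exact: GKdimE gen hB B1.
move=> M1 g1; have [d' [B' [hB' B1']]] := hilbT_normal M'_neq0 g1.
by have [-> ->] := hilbT_series_unique gen g1 hB B1 hB' B1'; exact: hilbT_poly.
Qed.

End GelfandKirillov.

Lemma subspaceB (K : fieldType) (V : lmodType K) (U : set V) x y :
  subspace U -> U x -> U y -> U (x - y).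
Proof. by move=> hU ux uy; rewrite addrC -scaleN1r; exact: (proj2 hU). Qed.

(** * Subgroups as types *)

Section Subgroups.
Variables (V : zmodType) (S : set V).

Definition subgroup_closed := S 0 /\ forall x y, S x -> S y -> S (x - y).

(** The closure proof is an argument so that the type [subgroup hS] carries what its group structure
    is built from. The type serves both for the span of pure tensors and for the T_k-submodule
    M'. *)
Definition subgroup_pred (hS : subgroup_closed) : pred V := fun x => `[< S x >].

Record subgroup (hS : subgroup_closed) :=
  Subgroup { subgroup_val : V; _ : subgroup_pred hS subgroup_val }.

End Subgroups.

Section SubgroupStructure.
Variables (V : zmodType) (S : set V) (hS : subgroup_closed S).

Fact subgroup_zmod_closed : GRing.zmod_closed (subgroup_pred hS).
Proof.
split; first by apply/asboolP; case: hS.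
by move=> x y /asboolP hx /asboolP hy; apply/asboolP; case: hS => _; apply.
Qed.

HB.instance Definition _ := [isSub for @subgroup_val V S hS].
HB.instance Definition _ := [Choice of subgroup hS by <:].
HB.instance Definition _ := GRing.SubChoice_isSubZmodule.Build V
  (subgroup_pred hS) (subgroup hS) subgroup_zmod_closed.

Lemma subgroup_valD (x y : subgroup hS) :
  subgroup_val (x + y) = subgroup_val x + subgroup_val y.
Proof. exact: (raddfD (\val : subgroup hS -> V)). Qed.

Lemma subgroup_valP (x : subgroup hS) : S (subgroup_val x).
Proof. by case: x => x /= /asboolP. Qed.

End SubgroupStructure.

(** * Division of a series by (1 - X^q)^n *)

Section PoincareSeries.
Variables (q n : nat) (f : nat -> int).
Hypothesis q_gt0 : (0 < q)%N.

(** Each variable contributes one geometric series in X^q. For a single variable the difference at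
    distance [q] telescopes: the terms at [i], the first one removed, are the terms at [i - q]. *)
Lemma conv_mons_sum :
  conv ((1 - 'X^q) ^+ n) (fun i => \sum_(m <- mons n (i %/ q)) f (i - q * mdeg m)%N) =1 f.
Proof.
have e i : \sum_(m <- mons n (i %/ q)) f (i - q * mdeg m)%N =
    \sum_(a <- exps n (i %/ q)) f (i - q * sumn a)%N.
  rewrite big_map !big_seq; apply: eq_bigr => a; rewrite mem_exps => /andP[/eqP sa _].
  by rewrite mdeg_mnm_of.
move=> i; rewrite (eq_conv _ e) {e}; elim: n i => [|m IH] i.
  by rewrite expr0 conv1 big_seq1 muln0 subn0.
rewrite exprSr convM -IH; apply: eq_conv => {IH}i.
pose H j l := \sum_(a <- exps m ((j - q * l) %/ q)) f (j - q * l - q * sumn a)%N.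
have h j : \sum_(a <- exps m.+1 (j %/ q)) f (j - q * sumn a)%N =
    \sum_(l < (j %/ q).+1) H j l.
  rewrite exps_sum; apply: eq_bigr => l _; rewrite /H.
  have -> : ((j - q * l) %/ q = j %/ q - l)%N by rewrite mulnC divnBMl.
  by apply: eq_bigr => a _ /=; rewrite mulnDr subnDA.
have H0 : H i 0%N = \sum_(a <- exps m (i %/ q)) f (i - q * sumn a)%N.
  by rewrite /H muln0 subn0.
rewrite convB1Xn // !h -H0 big_ord_recl; case: leqP => qi; last first.
  by rewrite divn_small // big_ord0 addr0 subr0.
have -> : (i %/ q = ((i - q) %/ q).+1)%N.
  by rewrite -{1}(subnK qi) divnDr ?dvdnn // divnn q_gt0 addn1.
rewrite -addrA -sumrB big1 ?addr0 // => l _.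
by rewrite lift0 /H mulnS subnDA subrr.
Qed.

End PoincareSeries.

(** * The induced module and its Hilbert function *)

Section Tensor.
Variables (K : fieldType) (n p : nat) (hp : p \in [pchar K]) (k : nat).
Local Notation D := (diffop K n).
Local Notation T := (Tk n hp k).
Local Notation FT := (@filtT K n p hp k).
Local Notation q := (p ^ k)%N.
Variables (M' : lmodType T) (M : lmodType D) (tau : D -> M' -> M).
Hypothesis tens : is_tensor (@Tk_val K n p hp k) tau.

Lemma tauDl a a' x : tau (a + a') x = tau a x + tau a' x.
Proof. by case: tens => -[]. Qed.
Lemma tauDr a x x' : tau a (x + x') = tau a x + tau a x'.
Proof. by case: tens => -[]. Qed.
Lemma tau_bal a (t : T) x : tau (a * Tk_val t) x = tau a (t *: x).
Proof. by case: tens => -[]. Qed.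
Lemma tau_act a a' x : tau (a * a') x = a *: tau a' x.
Proof. by case: tens. Qed.
Lemma tau1 a x : tau a x = a *: tau 1 x.
Proof. by rewrite -tau_act mulr1. Qed.
Lemma tau0r a : tau a 0 = 0.
Proof. by apply: (@addIr _ (tau a 0)); rewrite -tauDr addr0 add0r. Qed.
Lemma tau0l x : tau 0 x = 0.
Proof. by rewrite tau1 scale0r. Qed.

Lemma tau_sumr a I (r : seq I) (F : I -> M') :
  tau a (\sum_(i <- r) F i) = \sum_(i <- r) tau a (F i).
Proof. by elim: r => [|i r IH]; rewrite ?big_nil ?tau0r // !big_cons tauDr IH. Qed.

Lemma tau_suml x I (r : seq I) (F : I -> D) :
  tau (\sum_(i <- r) F i) x = \sum_(i <- r) tau (F i) x.
Proof. by elim: r => [|i r IH]; rewrite ?big_nil ?tau0l // !big_cons tauDl IH. Qed.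

Lemma tau_linear a : linear (fun x : restr M' => (tau a x : restr M)).
Proof.
move=> c x y; rewrite restrZ [LHS]tauDr; congr (_ + _).
by rewrite restrZ -tau_bal -tau_act Tk_valZ Tk_val1 mulr_algl mulr_algr.
Qed.

(* the coordinates of [D (x) M'] in [\bigoplus_m dq m (x) M'] come from the
   universal property, applied to the right [T]-linear maps [coefD _ m] *)
Lemma tensor_coord m : exists g : {additive M -> M'},
  forall a x, g (tau a x) = toTk hp k (coefD hp k a m) *: x.
Proof.
have [_ _ univ] := tens.
have [|g [hg _]] := univ M' (fun a x => toTk hp k (coefD hp k a m) *: x); last by exists g.
split=> [a a' x|a x x'|a t x].
- rewrite -scalerDl; congr (_ *: _); apply: Tk_val_inj.
  rewrite Tk_valD !toTkK; [exact: coefD_add|exact: inT_coefD..].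
- by rewrite scalerDr.
- rewrite scalerA; congr (_ *: _); apply: Tk_val_inj.
  rewrite Tk_valM !toTkK; [|exact: inT_coefD..].
  by rewrite coefD_mulT //; exact: inT_Tk_val.
Qed.

(** The coordinate of index [m] sends [tau (dq K p k m) x] to [x] and kills the summands of every
    other index. *)
Lemma tau_indep (r : seq 'X_{1..n}) (x : 'X_{1..n} -> M') : uniq r ->
  \sum_(m <- r) tau (dq K p k m) (x m) = 0 -> forall m, m \in r -> x m = 0.
Proof.
move=> ur e m mr; have [g hg] := tensor_coord m.
have := congr1 g e; rewrite raddf0 raddf_sum (bigD1_seq m) //=.
have h c : coefD hp k (dq K p k c) m = if m == c then 1 else 0.
  by rewrite -[dq _ _ _ c]mulr1 coefD_dq //; exact: inT1.
rewrite big1 => [|c cm]; rewrite hg h.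
  rewrite eqxx addr0 => <-; rewrite (_ : toTk hp k 1 = 1) ?scale1r //.
  by apply: Tk_val_inj; rewrite toTkK ?Tk_val1 //; exact: inT1.
rewrite eq_sym (negPf cm) (_ : toTk hp k 0 = 0) ?scale0r //.
by apply: Tk_val_inj; rewrite toTkK ?Tk_val0 //; exact: inT0.
Qed.

Lemma tau1_inj x : tau 1 x = 0 -> x = 0.
Proof.
move=> e; apply: (@tau_indep [:: 0%MM] (fun=> x) _ _ 0%MM) => //; last exact: mem_head.
by rewrite big_seq1 dq0.
Qed.

(** The span of the pure tensors receives [tau] as a balanced map, so M maps to it; by the
    uniqueness clause the composite with the inclusion is the identity of M. *)
Lemma tau_generates (y : M) : act_set setT (range (tau 1)) y.
Proof.
pose S : set M := act_set setT (range (tau 1)).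
have S_sub : ksubspace S by exact: act_set_ksubspace.
have hS : subgroup_closed S.
  split; first exact: (proj1 S_sub).
  by move=> x z hx hz; exact: (subspaceB S_sub hx hz).
have tS a x : S (tau a x) by rewrite tau1; apply: act_set_mem => //; exists x.
have [[_ _ _] tact univ] := tens.
pose b a x : subgroup hS := Subgroup (introT (asboolP _) (tS a x)).
have [|g [hg _]] := univ (subgroup hS) b.
  split=> [a a' x|a x x'|a t x]; apply: val_inj => /=.
  - by rewrite tauDl.
  - by rewrite tauDr.
  - by rewrite tau_bal.
have [|h [hh hu]] := univ M tau; first by case: tens.
have -> : y = subgroup_val (g y).
  have e1 := hu ((\val : {additive subgroup hS -> M}) \o g) (fun a x => congr1 val (hg a x)) y.
  have e2 := hu (@idfun M : {additive M -> M}) (fun a x => erefl) y.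
  by rewrite -[LHS]/(idfun y) [LHS]e2 -e1.
exact: subgroup_valP.
Qed.

Lemma tensor_neq0 : (exists y : M, y != 0) -> exists x : M', x != 0.
Proof.
move=> [y y0]; apply: contrapT => h; move/eqP: y0; apply.
have x0 (x : M') : x = 0.
  by apply: contrapT => /eqP nx; apply: h; exists x.
have [m [s [u [su ->]]]] := tau_generates y; rewrite big1 // => j _.
by have [_ [x _ <-]] := su j; rewrite (x0 x) tau0r scaler0.
Qed.

Lemma tensor_generating (M0' : set M') : fd_generating M0' -> fd_generating (tau 1 @` M0').
Proof.
move=> [[m hm] gen]; split.
  exists m; apply: (has_dim_image (tau_linear 1) _ hm) => x _; exact: tau1_inj.
apply/seteqP; split=> // y _.
have W_sub : ksubspace (act_set setT (tau 1 @` M0')) by exact: act_set_ksubspace.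
apply: (act_set_min W_sub _ (tau_generates y)) => s _ _ [x _ <-].
have : act_set setT M0' x by rewrite gen.
move=> [r [t [u [tu ->]]]]; rewrite tau_sumr scaler_sumr.
apply: (subspace_sum _ W_sub) => j _; rewrite -tau_bal mul1r tau1 scalerA.
by apply: act_set_mem => //; exists (u j) => //; case: (tu j).
Qed.

(** The summand of [m] is [dq] of [m] tensored with the piece of degree [i - q * mdeg m]. The sum
    stops at [i %/ q]: beyond it the degree exceeds [i], and truncated subtraction would wrongly
    count the piece of degree zero. *)
Lemma hilbF_tensor (M0' : set M') i : fin_dim_sub M0' ->
  hilbF (tau 1 @` M0') i = (\sum_(m <- mons n (i %/ q)) hilbT M0' (i - q * mdeg m))%N.
Proof.
move=> fM; rewrite /hilbF /dim_sub; apply: has_dimP.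
have q0 := q_gt0 hp k.
have hd := @has_dim_dsum K (restr M') (restr M) 'X_{1..n} (mons n (i %/ q))
  (fun m x => tau (dq K p k m) x) (fun m => act_set (FT (i - q * mdeg m)%N) M0')
  (fun m => hilbT M0' (i - q * mdeg m)) (mons_uniq _ _) (fun m => tau_linear _).
have {}hd := hd (fun m _ => fin_dimP (act_set_fin (@filtT_fin K n p hp k (i - q * mdeg m)%N) fM)).
have {}hd := hd (fun x _ e => @tau_indep _ x (mons_uniq _ _) e).
set U := (X in has_dim X _) in hd; rewrite (_ : act_set _ _ = U) //.
apply/seteqP; split.
  apply: (act_set_min (has_dim_subspace hd)) => s _ hs [u Mu <-].
  have [t [t1 t2 es]] := decomp_FR hp k hs.
  have ht m := FR_inT (t1 m).
  exists (fun m => toTk hp k (t m) *: u); split.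
    move=> m _; apply: act_set_mem => //; rewrite filtTE toTkK //.
    exact: FR_box_filtF (t1 m).
  rewrite -tau1 es tau_suml; apply: eq_bigr => m _.
  by rewrite -tau_bal toTkK.
have W_sub := act_set_ksubspace (tau 1 @` M0') (@filtF_subspace K n i).
move=> y [x [hx ->]]; apply: (subspace_sum_seq W_sub) => m mr.
have qm : (q * mdeg m <= i)%N by move: mr; rewrite mem_mons leq_divRL // mulnC.
have [r [s [u [su ->]]]] := hx m mr; rewrite tau_sumr.
apply: (subspace_sum _ W_sub) => j _; have [hs hu] := su j.
rewrite -tau_bal tau1; apply: act_set_mem; last by exists (u j).
by rewrite -(subnKC qm); apply: filtFM => //; exact: filtF_dq.
Qed.

Section Conclusions.
Variables (R : realType) (M0' : set M') (d : nat) (A : {poly int}).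
Hypothesis gen : fd_generating M0'.
Hypothesis hA : conv ((1 - 'X) ^+ d.+1) (fun i => (hilbT M0' i)%:Z) =1 (fun i => A`_i).
Hypothesis A1 : A.[1] != 0.

Let f := hilbF (tau 1 @` M0').

Lemma hilbF_series : conv ((1 - 'X) ^+ d.+1 * (1 - 'X^q) ^+ n) (fun i => (f i)%:Z) =1
  (fun i => A`_i).
Proof.
move=> i; rewrite convM -hA; apply: eq_conv => {}i.
rewrite -[RHS](@conv_mons_sum q n (fun i => (hilbT M0' i)%:Z) (q_gt0 hp k)).
by apply: eq_conv => {}i; rewrite /f hilbF_tensor ?Posz_sum //; case: gen.
Qed.

Let q0 : (0 < q)%N := q_gt0 hp k.
Let e := `|A.[1]|%N.

Lemma numerator_absz : A.[1] = e%:Z.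
Proof.
by rewrite /e; have := series_numerator_gt0 q0 hilbF_series A1 R; case: (A.[1]).
Qed.

Lemma tensor_almost_poly : exists P : nat -> {poly rat},
  [/\ almost_poly_of q f P,
      coefs_from q P [set z%:~R / (p ^ (k * (n + d)) * (n + d)`!)%N%:R | z in [set: int]]
    & forall s, (s < q)%N -> size (P s) = (n + d).+1 /\
        lead_coef (P s) = e%:R / (p ^ (k * n) * (n + d)`!)%N%:R].
Proof.
have := almost_poly_series q0 hilbF_series A1.
by rewrite numerator_absz !expnM.
Qed.

Let l : R := e%:R / (q ^ n * (n + d)`!)%N%:R.

Lemma tensor_asym (M0 : set M) : fd_generating M0 ->
  asym (fun i => (hilbF M0 i)%:R : R) (n + d) l.
Proof.
have h := asym_series q0 hilbF_series A1 R; rewrite numerator_absz in h.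
move=> g0; have [a [h1 h2]] := fd_generating_compare2 (@filtF_fin K n) (@filtF_le K n)
  (@filtFM K n) (@filtF_exhaust K n) (tensor_generating gen) g0.
by apply: (asym_sandwich (a := a) h) => i; rewrite ler_nat; [exact: h2|exact: h1].
Qed.

Lemma tensor_has_Dim : has_Dim M ((n + d)%N%:R : R)%:E.
Proof.
split; first by exists (tau 1 @` M0'); exact: tensor_generating.
move=> M0 /tensor_asym h; apply: asym_growth h _.
by rewrite divr_gt0 // ltr0n ?lt0n ?absz_eq0 // -lt0n muln_gt0 fact_gt0 expn_gt0 q0.
Qed.

Lemma tensor_has_mult : has_mult M (e%:R / (p ^ (k * n))%N%:R : R).
Proof.
exists (n + d)%N; split; first exact: tensor_has_Dim.
move=> M0 /tensor_asym/asym_littleo.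
by rewrite expnM /l natrM invfM mulrA.
Qed.

(** The denominator is (1 - X)^(n+d+1) times the n-th power of [geom_poly q], whose value at 1 is
    q^n; the order of the pole and the multiplicity are read off this factorisation. *)
Lemma tensor_poincare : exists P_M : {fraction {poly R}},
  [/\ expands_as P_M (fun i => (f i)%:R),
      exists t : nat, pole_order P_M 1 t /\ (n + d = t.-1)%N
    & has_value (FracField.tofrac ((1 - 'X) ^+ (n + d).+1) * P_M) 1
        (e%:R / (p ^ (k * n))%N%:R)].
Proof.
pose QZ : {poly int} := (1 - 'X) ^+ d.+1 * (1 - 'X^q) ^+ n.
pose N : {poly R} := map_poly intr A.
pose Q : {poly R} := map_poly intr QZ.
pose G : {poly R} := map_poly intr (geom_poly q).
have eQ : Q = (1 - 'X) ^+ (n + d).+1 * G ^+ n.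
  rewrite /Q /QZ geom_polyE exprMn mulrA -exprD addSn addnC.
  by rewrite rmorphM !rmorphXn /= rmorphB rmorph1 /= map_polyX.
have G1 : G.[1] = q%:R.
  by rewrite /G -[1 in LHS](rmorph1 (intr : int -> R)) horner_map /= geom_poly1.
have Gn1 : (G ^+ n).[1] != 0.
  by rewrite horner_exp G1 expf_neq0 // pnatr_eq0 -lt0n.
have N1 : N.[1] = e%:R.
  by rewrite /N -[1 in LHS](rmorph1 (intr : int -> R)) horner_map /= numerator_absz.
have G0 : G ^+ n != 0 by apply: contraNneq Gn1 => ->; rewrite horner0.
have X0 : (1 - 'X) ^+ (n + d).+1 != 0 :> {poly R}.
  by rewrite expf_neq0 // -oppr_eq0 opprB polyXsubC_eq0.
exists (FracField.tofrac N / FracField.tofrac Q); split.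
- exists N, Q; split=> //.
    rewrite horner_coef0 coef_map /= /QZ coef0_prod_eq1 ?oner_eq0 //.
      by apply: coef0_exp_eq1; rewrite coefB coef1 coefX subr0.
    by apply: coef0_exp_eq1; exact: coef0_B1Xn.
  move=> i; rewrite coef_map /= -hilbF_series /conv rmorph_sum /=.
  by apply: eq_bigr => j _; rewrite coef_map /= intrM.
- exists (n + d).+1; split=> //; split=> //.
  (* [pole_order] uses X - 1 whereas the denominator has 1 - X; the power of -1 goes into the
     cofactor. *)
  exists N, ((-1) ^+ (n + d).+1 *: G ^+ n); split.
  + by rewrite N1 pnatr_eq0 absz_eq0.
  + by rewrite hornerZ mulf_neq0 // signr_eq0.
  + congr (_ / FracField.tofrac _); rewrite eQ -scalerAr scalerAl; congr (_ * _).
    by rewrite -exprZn scaleN1r opprB.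
- exists N, (G ^+ n); split=> //; last by rewrite N1 horner_exp G1 expnM natrX.
  rewrite eQ rmorphM /= invfM mulrCA !mulrA mulfK ?tofrac_eq0 //.
Qed.

End Conclusions.
End Tensor.

(** * Descent of a presentation to T_k *)

Section TkSpan.
Variables (K : fieldType) (n p : nat) (hp : p \in [pchar K]) (k : nat).
Local Notation D := (diffop K n).
Local Notation T := (Tk n hp k).
Variables (M : lmodType D) (m : nat) (e : 'I_m -> M).

Definition Tspan : set M :=
  [set x | exists t : 'I_m -> T, x = \sum_j Tk_val (t j) *: e j].

Fact Tspan_closed : subgroup_closed Tspan.
Proof.
split; first by exists (fun=> 0); rewrite big1 // => j _; rewrite Tk_val0 scale0r.
move=> _ _ [t ->] [s ->]; exists (fun j => t j - s j); rewrite -sumrB.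
by apply: eq_bigr => j _; rewrite -scalerBl.
Qed.

Definition Tspan_mod := subgroup Tspan_closed.
HB.instance Definition _ := GRing.Zmodule.on Tspan_mod.

Fact Tspan_scale_subproof (t : T) (x : Tspan_mod) :
  subgroup_pred Tspan_closed (Tk_val t *: subgroup_val x).
Proof.
have [s ->] := subgroup_valP x; apply/asboolP; exists (fun j => t * s j).
by rewrite scaler_sumr; apply: eq_bigr => j _; rewrite Tk_valM scalerA.
Qed.

Definition Tspan_scale (t : T) (x : Tspan_mod) : Tspan_mod :=
  Subgroup (Tspan_scale_subproof t x).

Fact Tspan_scalerA t s x : Tspan_scale t (Tspan_scale s x) = Tspan_scale (t * s) x.
Proof. by apply: val_inj; rewrite /= scalerA. Qed.
Fact Tspan_scale1r : left_id 1 Tspan_scale.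
Proof. by move=> x; apply: val_inj; rewrite /= scale1r. Qed.
Fact Tspan_scalerDr : right_distributive Tspan_scale +%R.
Proof. by move=> t x y; apply: val_inj; rewrite /= scalerDr. Qed.
Fact Tspan_scalerDl x : {morph Tspan_scale^~ x : t s / t + s}.
Proof. by move=> t s; apply: val_inj; rewrite /= scalerDl. Qed.

HB.instance Definition _ := GRing.Zmodule_isLmodule.Build T Tspan_mod
  Tspan_scalerA Tspan_scale1r Tspan_scalerDr Tspan_scalerDl.

Definition Tspan_tau (a : D) (x : Tspan_mod) : M := a *: subgroup_val x.

Lemma Tspan_valZ t (x : Tspan_mod) : subgroup_val (t *: x) = Tk_val t *: subgroup_val x.
Proof. by []. Qed.

Fact Tspan_gen_subproof j : subgroup_pred Tspan_closed (e j).
Proof.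
apply/asboolP; exists (fun i => if i == j then 1 else 0).
rewrite (bigD1 j) //= eqxx Tk_val1 scale1r big1 ?addr0 // => i /negPf->.
by rewrite Tk_val0 scale0r.
Qed.

Definition Tspan_gen j : Tspan_mod := Subgroup (Tspan_gen_subproof j).

Lemma Tspan_val_sum (t : 'I_m -> T) :
  subgroup_val (\sum_j t j *: Tspan_gen j) = \sum_j Tk_val (t j) *: e j.
Proof. exact: (raddf_sum (\val : {additive subgroup Tspan_closed -> M})). Qed.

Lemma Tspan_expand (x : Tspan_mod) : exists t : 'I_m -> T, x = \sum_j t j *: Tspan_gen j.
Proof.
by have [t et] := subgroup_valP x; exists t; apply: val_inj; rewrite /= et -Tspan_val_sum.
Qed.

Lemma Tspan_fin_generated : fin_generated Tspan_mod.
Proof. by exists m, Tspan_gen; exact: Tspan_expand. Qed.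

Variables (r : nat) (B : 'M[D]_(r, m)).
Hypothesis e_gen : forall x : M, exists a : 'I_m -> D, x = \sum_j a j *: e j.
Hypothesis e_rel : forall a : 'I_m -> D, \sum_j a j *: e j = 0 ->
  exists u : 'I_r -> D, forall j, a j = \sum_l u l * B l j.
Hypothesis B_rel : forall l, \sum_j B l j *: e j = 0.
Hypothesis B_inT : forall l j, inT p k (B l j).

Section Universal.
Variables (Z : zmodType) (beta : D -> Tspan_mod -> Z).
Hypothesis bal : balanced (@Tk_val K n p hp k) beta.

Let betaDl a a' x : beta (a + a') x = beta a x + beta a' x.
Proof. by case: bal. Qed.
Let betaDr a x x' : beta a (x + x') = beta a x + beta a x'.
Proof. by case: bal. Qed.
Let beta_bal a t x : beta (a * Tk_val t) x = beta a (t *: x).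
Proof. by case: bal. Qed.
Let beta0l x : beta 0 x = 0.
Proof. by apply: (@addIr _ (beta 0 x)); rewrite -betaDl addr0 add0r. Qed.
Let beta0r a : beta a 0 = 0.
Proof. by apply: (@addIr _ (beta a 0)); rewrite -betaDr addr0 add0r. Qed.
Let beta_suml x I (s : seq I) (F : I -> D) :
  beta (\sum_(i <- s) F i) x = \sum_(i <- s) beta (F i) x.
Proof. by elim: s => [|i s IH]; rewrite ?big_nil ?beta0l // !big_cons betaDl IH. Qed.
Let beta_sumr a I (s : seq I) (F : I -> Tspan_mod) :
  beta a (\sum_(i <- s) F i) = \sum_(i <- s) beta a (F i).
Proof. by elim: s => [|i s IH]; rewrite ?big_nil ?beta0r // !big_cons betaDr IH. Qed.
Let betaBl a a' x : beta (a - a') x = beta a x - beta a' x.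
Proof. by apply: (@addIr _ (beta a' x)); rewrite -betaDl !subrK. Qed.

(** A relation is a combination of the rows of [B]. The entries of [B] lie in T_k and move across
    [beta], where each row becomes a relation among the generators and vanishes. *)
Lemma Tspan_beta_rel (a : 'I_m -> D) : \sum_j a j *: e j = 0 ->
  \sum_j beta (a j) (Tspan_gen j) = 0.
Proof.
move=> /e_rel[u eu].
under eq_bigr => j _ do rewrite eu beta_suml.
rewrite exchange_big big1 //= => l _.
transitivity (beta (u l) (\sum_j toTk hp k (B l j) *: Tspan_gen j)).
  by rewrite beta_sumr; apply: eq_bigr => j _; rewrite -beta_bal toTkK.
rewrite (_ : \sum_j _ = 0) ?beta0r //; apply: val_inj.
rewrite [LHS]Tspan_val_sum -[RHS](B_rel l); apply: eq_bigr => j _.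
by rewrite toTkK.
Qed.

Lemma Tspan_beta_eq (a a' : 'I_m -> D) : \sum_j a j *: e j = \sum_j a' j *: e j ->
  \sum_j beta (a j) (Tspan_gen j) = \sum_j beta (a' j) (Tspan_gen j).
Proof.
move=> h; apply/eqP; rewrite -subr_eq0 -sumrB; apply/eqP.
under eq_bigr do rewrite -betaBl; apply: Tspan_beta_rel.
by under eq_bigr do rewrite scalerBl; rewrite sumrB h subrr.
Qed.

(** The choice of coefficients for each [x] is harmless by [Tspan_beta_eq], which also makes [g]
    additive. *)
Lemma Tspan_univ : exists g : {additive M -> Z},
  (forall a x, g (Tspan_tau a x) = beta a x) /\
  (forall g' : {additive M -> Z}, (forall a x, g' (Tspan_tau a x) = beta a x) -> g' =1 g).
Proof.
have [c hc] := choice e_gen.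
pose g x := \sum_j beta (c x j) (Tspan_gen j).
have gE x (a : 'I_m -> D) : x = \sum_j a j *: e j -> g x = \sum_j beta (a j) (Tspan_gen j).
  by move=> ex; apply: Tspan_beta_eq; rewrite -ex -hc.
have gB : {morph g : x y / x - y}.
  move=> x y; rewrite (gE (x - y) (fun j => c x j - c y j)); last first.
    by under eq_bigr do rewrite scalerBl; rewrite sumrB -!hc.
  by rewrite /g -sumrB; apply: eq_bigr => j _; rewrite betaBl.
pose gM := GRing.isZmodMorphism.Build M Z g gB.
pose G : {additive M -> Z} := HB.pack g gM.
exists G; split=> [a x|g' hg' x] /=.
  have [t ->] := Tspan_expand x.
  rewrite (gE _ (fun j => a * Tk_val (t j))).
    by rewrite beta_sumr; apply: eq_bigr => j _; rewrite beta_bal.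
  rewrite /Tspan_tau Tspan_val_sum scaler_sumr.
  by apply: eq_bigr => j _; rewrite scalerA.
rewrite {1}(hc x) raddf_sum; apply: eq_bigr => j _.
by rewrite -hg'.
Qed.

End Universal.

Lemma Tspan_tensor : is_tensor (@Tk_val K n p hp k) Tspan_tau.
Proof.
split; last exact: Tspan_univ.
  split=> [a a' x|a x x'|a t x]; rewrite /Tspan_tau.
  - by rewrite scalerDl.
  - by rewrite subgroup_valD scalerDr.
  - by rewrite Tspan_valZ scalerA.
by move=> a a' x; rewrite /Tspan_tau scalerA.
Qed.

End TkSpan.

Section Presentation.
Variables (A : nzRingType) (M : lmodType A) (m r : nat) (B : 'M[A]_(r, m)).
Variable phi : {linear 'rV[A]_m -> M}.
Hypothesis phi_surj : forall x, exists v, phi v = x.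
Hypothesis phi_ker : forall v, phi v = 0 <-> exists u : 'rV[A]_r, v = u *m B.

Let e j := phi (delta_mx 0 j).

Lemma presentation_sum (a : 'I_m -> A) : \sum_j a j *: e j = phi (\row_j a j).
Proof.
rewrite [in RHS](row_sum_delta (\row_j a j)) linear_sum; apply: eq_bigr => j _.
by rewrite linearZ mxE.
Qed.

Lemma presentation_gen (x : M) : exists a : 'I_m -> A, x = \sum_j a j *: e j.
Proof.
have [v <-] := phi_surj x; exists (fun j => v 0 j); rewrite presentation_sum.
by congr (phi _); apply/rowP => j; rewrite mxE.
Qed.

Lemma presentation_rel (a : 'I_m -> A) : \sum_j a j *: e j = 0 ->
  exists u : 'I_r -> A, forall j, a j = \sum_l u l * B l j.
Proof.
rewrite presentation_sum => /phi_ker[u eu]; exists (fun l => u 0 l) => j.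
by have /rowP/(_ j) := eu; rewrite !mxE.
Qed.

Lemma presentation_row l : \sum_j B l j *: e j = 0.
Proof.
rewrite presentation_sum; apply/phi_ker; exists (delta_mx 0 l).
by rewrite -rowE; apply/rowP => j; rewrite !mxE.
Qed.

End Presentation.

Lemma fin_presented_tensor (K : fieldType) (n p : nat) (hp : p \in [pchar K])
    (M : lmodType (diffop K n)) : fin_presented M ->
  exists (k : nat) (M' : lmodType (Tk n hp k)) (tau : diffop K n -> M' -> M),
    fin_generated M' /\ is_tensor (@Tk_val K n p hp k) tau.
Proof.
move=> [m [r [B [phi [surj ker]]]]].
have h (lj : 'I_r * 'I_m) : exists i, filtF i (B lj.1 lj.2) by exact: filtF_exhaust.
(* [k] bounds the filtration degree of all entries of [B], and k < p^k, so [filtF_inT] puts them in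
   T_k. *)
have [N hN] := choice h; pose k := \max_lj N lj.
exists k, (Tspan_mod hp k (fun j => phi (delta_mx 0 j))),
  (@Tspan_tau _ _ _ hp k _ _ (fun j => phi (delta_mx 0 j))).
split; first exact: Tspan_fin_generated.
apply: (@Tspan_tensor _ _ _ _ _ _ _ _ _ B).
- exact: presentation_gen.
- exact: presentation_rel.
- exact: presentation_row.
- move=> l j; apply: (filtF_inT (i := k)).
    by apply: ltn_expl; rewrite prime_gt1 // (pcharf_prime hp).
  by apply: filtF_le (hN (l, j)); exact: (leq_bigmax (l, j)).
Qed.

(** * Cokernels of matrices as left modules *)

Section Cokernel.
Variables (A : nzRingType) (m r : nat) (B : 'M[A]_(r, m)).

Definition row_image : {pred 'rV[A]_m} := fun v => `[< exists u : 'rV[A]_r, v = u *m B >].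

Fact row_image_zmod_closed : GRing.zmod_closed row_image.
Proof.
split; first by apply/asboolP; exists 0; rewrite mul0mx.
by move=> _ _ /asboolP[u ->] /asboolP[v ->]; apply/asboolP; exists (u - v); rewrite mulmxBl.
Qed.
HB.instance Definition _ := GRing.isZmodClosed.Build 'rV[A]_m row_image row_image_zmod_closed.

Local Notation I := (row_image : zmodClosed 'rV[A]_m).
Definition coker := Quotient.quot I.
HB.instance Definition _ := GRing.Zmodule.on coker.

Definition coker_pi : 'rV[A]_m -> coker := \pi_(Quotient.quot I)%qT.
Definition coker_repr : coker -> 'rV[A]_m := repr.

Lemma coker_reprK x : coker_pi (coker_repr x) = x.
Proof. exact: reprK. Qed.

Lemma coker_pi_eq v w : coker_pi v = coker_pi w <-> row_image (v - w).
Proof.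
have h := Quotient.idealrBE I v w; split=> [e|vw].
  by rewrite -[row_image _]/((v - w) \in row_image) h; apply/eqP.
by apply/eqP; rewrite -h.
Qed.

Lemma coker_piD v w : coker_pi (v + w) = coker_pi v + coker_pi w.
Proof. exact: (raddfD (\pi_(Quotient.quot I)%qT)). Qed.

(** Scalars act through a representative; [coker_piZ] gives independence of it, because the image of
    [B] is stable under left multiplication. *)
Definition coker_scale (a : A) (x : coker) : coker := coker_pi (a *: coker_repr x).

Lemma coker_piZ a v : coker_scale a (coker_pi v) = coker_pi (a *: v).
Proof.
apply/coker_pi_eq; have /coker_pi_eq/asboolP[u e] := coker_reprK (coker_pi v).
by apply/asboolP; exists (a *: u); rewrite -scalerBr e scalemxAl.
Qed.

Fact coker_scalerA a b x : coker_scale a (coker_scale b x) = coker_scale (a * b) x.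
Proof. by rewrite -[x]coker_reprK !coker_piZ scalerA. Qed.
Fact coker_scale1r : left_id 1 coker_scale.
Proof. by move=> x; rewrite -[x]coker_reprK coker_piZ scale1r. Qed.
Fact coker_scalerDr : right_distributive coker_scale +%R.
Proof.
move=> a x y; rewrite -[x]coker_reprK -[y]coker_reprK.
by rewrite -coker_piD !coker_piZ scalerDr coker_piD.
Qed.
Fact coker_scalerDl x : {morph coker_scale^~ x : a b / a + b}.
Proof. by move=> a b; rewrite -[x]coker_reprK !coker_piZ scalerDl coker_piD. Qed.

HB.instance Definition _ := GRing.Zmodule_isLmodule.Build A coker
  coker_scalerA coker_scale1r coker_scalerDr coker_scalerDl.

Fact coker_pi_linear : linear coker_pi.
Proof. by move=> a v w; rewrite coker_piD -coker_piZ. Qed.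
HB.instance Definition _ := GRing.isLinear.Build A 'rV[A]_m coker *:%R coker_pi coker_pi_linear.

Lemma coker_pi_surj (x : coker) : exists v, coker_pi v = x.
Proof. by exists (coker_repr x); exact: coker_reprK. Qed.

Lemma coker_pi_ker v : coker_pi v = 0 <-> exists u : 'rV[A]_r, v = u *m B.
Proof.
rewrite -[0](linear0 coker_pi); split=> [/coker_pi_eq/asboolP|h].
  by rewrite subr0.
by apply/coker_pi_eq/asboolP; rewrite subr0.
Qed.

End Cokernel.

(** * Modules of every dimension between n and 2n *)

Section Interval.
Variables (R : realType) (K : fieldType) (n p : nat) (hp : p \in [pchar K]) (d : nat).
Hypothesis dn : (d <= n)%N.
Local Notation D := (diffop K n).
Local Notation P := {mpoly K[n]}.
Local Notation T := (Tk n hp 0).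
Local Notation FT := (@filtT K n p hp 0).

(* its cokernel is [D / \sum_(l >= d) D x_l] *)
Definition var_mx : 'M[D]_(n, 1) := \matrix_(l, j) (if (d <= l)%N then mulop 'X_l else 0).
Local Notation M := (coker var_mx).
Let e (j : 'I_1) : M := coker_pi var_mx (delta_mx 0 j).
Local Notation M' := (Tspan_mod hp 0 e).
Let x0 : M' := Tspan_gen hp 0 e 0.

Lemma inT_mulop k (f : P) : inT p k (mulop f : D).
Proof. by rewrite -[mulop f]mulr1; apply: inT_mull => //; exact: inT1. Qed.

Lemma interval_tensor : is_tensor (@Tk_val K n p hp 0) (@Tspan_tau K n p hp 0 M 1 e).
Proof.
apply: (@Tspan_tensor _ _ _ _ _ _ _ _ _ var_mx).
- exact: (presentation_gen (@coker_pi_surj _ _ _ var_mx)).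
- exact: (presentation_rel (@coker_pi_ker _ _ _ var_mx)).
- exact: (presentation_row (@coker_pi_ker _ _ _ var_mx)).
- move=> l j; rewrite mxE; case: ifP => _; first exact: inT_mulop.
  exact: inT0.
Qed.

Lemma coefD_sum k I (s : seq I) (F : I -> D) m :
  coefD hp k (\sum_(i <- s) F i) m = \sum_(i <- s) coefD hp k (F i) m.
Proof.
elim: s => [|i s IH]; last by rewrite !big_cons coefD_add IH.
rewrite !big_nil; apply: (@addIr _ (coefD hp k 0 m)).
by rewrite -coefD_add !add0r.
Qed.

Lemma mcoeff_mulX l (g : P) (a : 'X_{1..n}) : a l = 0%N -> ('X_l * g)@_a = 0.
Proof.
move=> al; elim/mpolyind: g => [|c m g _ _ IH]; first by rewrite mulr0 mcoeff0.
rewrite mulrDr mcoeffD IH addr0 -scalerAr mcoeffZ -mpolyXD mcoeffX.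
case: eqP => [ea|_]; last by rewrite mulr0.
by move: al; rewrite -ea mnmDE mnm1E eqxx.
Qed.

Lemma var_gen_eq0 (l : 'I_n) : (d <= l)%N -> mulop 'X_l *: e 0 = 0.
Proof.
move=> dl; have := presentation_row (@coker_pi_ker _ _ _ var_mx) l.
by rewrite big_ord1 mxE dl.
Qed.

(** Such an [f] is a combination, over D, of the x_l with [d <= l]. Taking coefficients at exponent
    zero makes it a combination over T_0, which commutes with the variables; evaluation at 1 then
    puts [f] in the ideal of these x_l. *)
Lemma mulop_gen_eq0 (f : P) (a : 'X_{1..n}) : mulop f *: e 0 = 0 ->
  (forall l : 'I_n, (d <= l)%N -> a l = 0%N) -> f@_a = 0.
Proof.
move=> fe ha.
have [|u eu] := presentation_rel (@coker_pi_ker _ _ _ var_mx) (a := fun=> mulop f).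
  by rewrite big_ord1.
have {}eu := eu 0.
have h : mulop f = \sum_l coefD hp 0 (u l) 0%MM * var_mx l 0.
  have := coefD_dq hp 0%MM 0%MM (inT_mulop 0 f); rewrite eqxx dq0 mul1r => <-.
  rewrite eu coefD_sum; apply: eq_bigr => l _; apply: coefD_mulT.
  by rewrite mxE; case: ifP => _; [exact: inT_mulop|exact: inT0].
have {}h : f = \sum_l (coefD hp 0 (u l) 0%MM * var_mx l 0) 1.
  rewrite -[LHS]mulr1 -[LHS]/(mulop f 1) h.
  by elim/big_rec2: _ => // l y1 y2 _ <-.
rewrite h raddf_sum big1 // => l _; rewrite mxE; case: leqP => dl; last first.
  by rewrite mulr0 /= mcoeff0.
have := inT_commXq hp l (inT_coefD hp 0 (u l) 0%MM); rewrite expn0 expr1 => ->.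
exact: mcoeff_mulX (ha l dl).
Qed.

Lemma x0_val : subgroup_val x0 = e 0. Proof. by []. Qed.

Let mon (a : seq nat) : T := toTk hp 0 (mulop 'X_[mnm_of n a]).

Lemma mon_scale (c : K) a : subgroup_val (c%:A *: (mon a *: x0)) = mulop (c *: 'X_[mnm_of n a]) *: e 0.
Proof.
rewrite !Tspan_valZ x0_val scalerA Tk_valZ Tk_val1 mulr_algl toTkK ?mulopZ //.
exact: inT_mulop.
Qed.

Definition base_line : set M' := [set x | exists c : K, x = c%:A *: x0].

Lemma base_line_generating : fd_generating base_line.
Proof.
split.
  rewrite /fin_dim_sub (_ : base_line = spanv [:: x0 : restr M']); first exact: fin_dim_spanv.
  apply/seteqP; split=> x /=; first by move=> [c ->]; exists c, 0; rewrite addr0.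
  by move=> [c [z [-> ->]]]; exists c; rewrite addr0.
apply/seteqP; split=> // x _; have [t ->] := Tspan_expand x.
rewrite big_ord1; apply: act_set_mem => //; exists 1.
by rewrite scale1r scale1r.
Qed.

Lemma mnm_of_zero a l : size a = d -> (d <= l)%N -> nth 0%N a l = 0%N.
Proof. by move=> sa dl; rewrite nth_default // sa. Qed.

Lemma mdeg_mnm_of_short a : size a = d -> mdeg (mnm_of n a) = sumn a.
Proof.
move=> sa; have -> : mnm_of n a = mnm_of n (a ++ nseq (n - d) 0%N).
  apply/mnmP => j; rewrite !mnmE nth_cat; case: ltnP => // aj.
  by rewrite nth_nseq if_same nth_default.
rewrite mdeg_mnm_of ?size_cat ?size_nseq ?sa ?subnKC // sumn_cat sumn_nseq mul0n addn0 //.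
Qed.

Lemma mnm_of_short_inj a b : size a = d -> size b = d -> mnm_of n a = mnm_of n b -> a = b.
Proof.
move=> sa sb /mnmP h; apply: (@eq_from_nth _ 0%N); rewrite sa ?sb // => i di.
by have := h (Ordinal (leq_trans di dn)); rewrite !mnmE.
Qed.

Lemma mnm_of_short_surj (a : 'X_{1..n}) : (forall l : 'I_n, (d <= l)%N -> a l = 0%N) ->
  exists2 a', size a' = d & a = mnm_of n a'.
Proof.
move=> ha; pose a' := [seq nth 0%N a j | j <- iota 0 d].
have sa' : size a' = d by rewrite size_map size_iota.
exists a' => //; apply/mnmP => j; rewrite mnmE; case: (ltnP j d) => dj; last first.
  by rewrite ha // nth_default // sa'.
rewrite (nth_map 0%N) ?size_iota // nth_iota // add0n.
by rewrite -[nth _ _ _](tnth_nth 0%N (val a) j).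
Qed.

(** For k = 0 the box contains only zero, so T_0 is the polynomial ring. The monomials involving
    some x_l with [d <= l] kill the generator, and those in the first [d] variables stay independent
    by [mulop_gen_eq0]. *)
Lemma hilbT_interval i : hilbT base_line i = size (exps d i).
Proof.
rewrite /hilbT /dim_sub; apply: has_dimP.
have one : has_dim (setT : set K^o) 1.
  exists (fun=> 1); split=> [c|v]; first by rewrite big_ord1 => h j; rewrite (ord1 j) -[LHS]mulr1.
  by split=> // _; exists (fun=> v); rewrite big_ord1 -[LHS]mulr1.
pose f (a : seq nat) (c : K^o) : restr M' := ((c : K)%:A : T) *: (mon a *: x0).
have f_lin a : linear (f a).
  move=> c x y; rewrite /f restrZ.
  have -> : ((c *: x + y : K^o) : K)%:A = c%:A * (x : K)%:A + (y : K)%:A :> T.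
    by rewrite scalerDl -scalerAl mul1r scalerA.
  by rewrite [LHS]scalerDl -scalerA.
have f_sum (s : seq (seq nat)) (x : seq nat -> K) :
    subgroup_val (\sum_(a <- s) f a (x a)) = mulop (\sum_(a <- s) x a *: 'X_[mnm_of n a]) *: e 0.
  elim: s => [|a s IH].
    rewrite !big_nil; have -> : mulop (0 : P) = 0 by apply: diffop_eq => g; rewrite /= mul0r.
    by rewrite scale0r.
  by rewrite !big_cons subgroup_valD IH mon_scale -scalerDl -mulopD.
have hd := @has_dim_dsum K K^o (restr M') (seq nat) (exps d i) f (fun=> setT) (fun=> 1%N)
  (exps_uniq _ _) f_lin (fun _ _ => one).
have {}hd := hd _.
set U := (X in has_dim X _) in hd.
have {}hd : has_dim U (size (exps d i)).
  rewrite -sum1_size; apply: hd => x _ ex a ar.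
  have /(congr1 (@subgroup_val _ _ _)) := ex; rewrite f_sum => e0.
  have sz b : b \in exps d i -> size b = d by rewrite mem_exps => /andP[/eqP].
  have := mulop_gen_eq0 e0 (a := mnm_of n a); rewrite raddf_sum (bigD1_seq a) ?exps_uniq //=.
  rewrite mcoeffZ mcoeffX eqxx mulr1 big_seq_cond big1 ?addr0.
    by apply=> l dl; rewrite mnmE mnm_of_zero // sz.
  move=> b /andP[br ba]; rewrite mcoeffZ mcoeffX; case: eqP => [h|_]; last by rewrite mulr0.
  by rewrite (mnm_of_short_inj (sz _ br) (sz _ ar) h) eqxx in ba.
rewrite (_ : act_set _ _ = U) //; apply/seteqP; split.
  apply: (act_set_min (has_dim_subspace hd)) => s _ hs [c ->].
  move: s hs; rewrite filtT_span.
  have L := lspan_map (scalel_linear (M := M') (c%:A *: x0)) (has_dim_subspace hd).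
  apply: L => _ [a [b [hb h ->]]]; clear hd one f_sum f_lin.
  have -> : divpow K b = 1.
    rewrite -(dq0 K n p 0); apply: eq_divpow => j; rewrite mnmE muln0.
    by have := hb j; rewrite expn0; case: (b j).
  have e2 : toTk hp 0 (mulop 'X_[a]) *: (c%:A *: x0) =
      c%:A *: (toTk hp 0 (mulop 'X_[a]) *: x0).
    by rewrite [LHS]scalerA [RHS]scalerA mulr_algr mulr_algl.
  rewrite mulr1 {}e2; have [hz|] := pselect (forall l : 'I_n, (d <= l)%N -> a l = 0%N).
    have [a' sa' ea] := mnm_of_short_surj hz.
    exists (fun b => if b == a' then c else 0); split=> //.
    have a'r : a' \in exps d i.
      rewrite mem_exps sa' eqxx -mdeg_mnm_of_short // -ea.
      by apply: leq_trans h; exact: leq_addr.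
    rewrite (bigD1_seq a') ?exps_uniq //= eqxx big1 ?addr0 => [|b' /negPf->]; last first.
      by rewrite /f scale0r scale0r.
    by rewrite /f /mon -ea.
  move=> nz; exists (fun=> 0); split=> //; rewrite big1 => [|b' _]; last first.
    by rewrite /f scale0r scale0r.
  have [l [dl al]] : exists l : 'I_n, (d <= l)%N /\ (0 < a l)%N.
    apply: contrapT => h'; apply: nz => l dl; apply/eqP; rewrite -leqn0 leqNgt.
    by apply/negP => al; apply: h'; exists l.
  rewrite (_ : _ *: x0 = 0) ?scaler0 //; apply: val_inj; rewrite /= toTkK; last exact: inT_mulop.
  have Ul : (U_(l) <= a)%MM by rewrite lep1mP -lt0n.
  by rewrite -(submK Ul) mpolyXD -mulopM -scalerA var_gen_eq0 ?scaler0.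
have W_sub := act_set_ksubspace base_line (@filtT_subspace K n p hp 0 i).
move=> y [x [_ ->]]; apply: (subspace_sum_seq W_sub) => a ar.
have /andP[/eqP sa ha] : (size a == d) && (sumn a <= i)%N by rewrite -mem_exps.
apply: (subspaceZ (x a) W_sub); apply: act_set_mem; last by exists 1; rewrite !scale1r.
rewrite filtTE toTkK; last exact: inT_mulop.
apply: sub_lspan; exists (mnm_of n a), 0%MM; split.
  by rewrite mdeg0 addn0 mdeg_mnm_of_short.
rewrite -[LHS]mulr1 -(dq0 K n p 0); congr (_ * _); apply: eq_divpow => j.
by rewrite mnmE muln0.
Qed.

(** The count of exponents in [d] variables is [conv_mons_sum] for the constant sequence 1 with
    period 1; the last factor [1 - 'X] turns that sequence into the numerator 1. *)
Lemma hilbT_interval_series :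
  conv ((1 - 'X) ^+ d.+1) (fun i => (hilbT base_line i)%:Z) =1 (fun i => (1 : {poly int})`_i).
Proof.
move=> i; rewrite exprS convM.
have h : conv ((1 - 'X) ^+ d) (fun i => (hilbT base_line i)%:Z) =1 (fun=> 1).
  move=> j; rewrite -[RHS](@conv_mons_sum 1 d (fun=> 1) (ltn0Sn 0) j) expr1.
  apply: eq_conv => {}j; rewrite hilbT_interval divn1 big_const_seq count_predT.
  by rewrite size_map iter_addr addr0 natz.
rewrite (eq_conv _ h) -['X]expr1 convB1Xn // coef1.
by case: i => [|i] /=; rewrite ?subr0 ?subrr.
Qed.

Lemma interval_neq0 : exists x : M, x != 0.
Proof.
exists (e 0); apply/eqP => e0.
have := @mulop_gen_eq0 1 0%MM; rewrite mulop1 scale1r e0 => /(_ erefl).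
by rewrite mcoeff1 eqxx => h; have /eqP := h (fun l _ => mnm0E l); rewrite oner_eq0.
Qed.

Lemma interval_has_Dim : has_Dim M ((n + d)%N%:R : R)%:E.
Proof.
apply: (tensor_has_Dim interval_tensor R base_line_generating hilbT_interval_series).
by rewrite hornerC oner_eq0.
Qed.

Lemma interval_fin_presented : fin_presented M.
Proof.
by exists 1%N, n, var_mx, (coker_pi var_mx); split;
  [exact: coker_pi_surj|exact: coker_pi_ker].
Qed.

End Interval.

Theorem theorem5p5 (R : realType) (K : fieldType) (p : nat)
    (hp : p \in [pchar K]) (n : nat) (hn : (0 < n)%N) :
  (forall M : lmodType (diffop K n),
     (exists x : M, x != 0) -> fin_presented M ->
     (exists (k : nat) (M' : lmodType (Tk n hp k))
             (tau : diffop K n -> M' -> M),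
        fin_generated M' /\ is_tensor (@Tk_val K n p hp k) tau) /\
     (forall (k : nat) (M' : lmodType (Tk n hp k))
             (tau : diffop K n -> M' -> M),
        fin_generated M' -> is_tensor (@Tk_val K n p hp k) tau ->
        exists d e : nat,
          has_GK_mult R M' d e /\
          forall M0' : set M', fd_generating M0' ->
            [/\ exists P : nat -> {poly rat},
                  [/\ almost_poly_of (p ^ k) (hilbF (tau 1 @` M0')) P,
                      coefs_from (p ^ k) P
                        [set z%:~R / (p ^ (k * (n + d)) * (n + d)`!)%N%:R
                          | z in [set: int]]
                    & forall s, (s < p ^ k)%N ->
                        size (P s) = (n + d).+1 /\
                        lead_coef (P s) =
                          e%:R / (p ^ (k * n) * (n + d)`!)%N%:R],
                has_mult M (e%:R / (p ^ (k * n))%N%:R : R),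
                has_Dim M ((n + d)%N%:R : R)%:E /\ (n <= n + d)%N
              & exists P_M : {fraction {poly R}},
                  [/\ expands_as P_M (fun i => (hilbF (tau 1 @` M0') i)%:R),
                      exists t : nat, pole_order P_M 1 t /\ (n + d = t.-1)%N
                    & has_value
                        (FracField.tofrac ((1 - 'X) ^+ (n + d).+1) * P_M) 1
                        (e%:R / (p ^ (k * n))%N%:R)]])) /\
  (forall D : nat, (n <= D <= n + n)%N ->
     exists M : lmodType (diffop K n),
       [/\ exists x : M, x != 0, fin_presented M & has_Dim M (D%:R : R)%:E]).
Proof.
split=> [M M_neq0 fpM|D /andP[nD Dn]]; last first.
  have dn : (D - n <= n)%N by rewrite leq_subLR.
  exists (coker (var_mx K n (D - n))); split.
  - exact: (interval_neq0 n hp (D - n)).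
  - exact: interval_fin_presented.
  - by have := interval_has_Dim R hp dn; rewrite subnKC.
split; first exact: fin_presented_tensor.
move=> k M' tau fgM' tens; have M'_neq0 := tensor_neq0 tens M_neq0.
have [M0 gen0] := fin_generated_fd fgM'.
(* The degree and the multiplicity must be fixed before [M0'] is given, so they come from an
   auxiliary generating subspace, and [hilbT_series_unique] carries them over. *)
have [d [A [hA A1]]] := hilbT_normal M'_neq0 gen0.
exists d, `|A.[1]|%N; split; first exact: has_GK_multP gen0 hA A1.
move=> M0' gen; have [d' [A' [hA' A1']]] := hilbT_normal M'_neq0 gen.
have [-> ->] := hilbT_series_unique R gen0 gen hA A1 hA' A1'.
split.
- exact: (tensor_almost_poly tens R gen hA' A1').
- exact: (tensor_has_mult tens R gen hA' A1').
- by split; [exact: (tensor_has_Dim tens R gen hA' A1')|exact: leq_addr].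
- exact: (tensor_poincare tens R gen hA' A1').
Qed.
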